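(* Let $\mu=\sum_{\lambda\in\Lambda}c_\lambda\delta_\lambda$ with $\Lambda\subset\mathbb R$ locally finite and $c_\lambda$ positive integers, be a temperate distribution whose Fourier transform is a measure $\hat\mu=\sum_{\gamma\in\Gamma}b_\gamma\delta_\gamma$ ($\Gamma\subset\mathbb R$ countable) such that $|\hat\mu|$ is also a temperate distribution. Let $A=\{a_n\}_{n\in\mathbb Z}$ be the multiset in which each $\lambda\in\Lambda$ occurs $c_\lambda$ times, enumerated so that $a_n\le a_{n+1}$, and assume $0\notin A$. Let $$f(z)=(1-z/a_0)\prod_{n=1}^\infty(1-z/a_n)(1-z/a_{-n}),\qquad g(z)=\sum_{\gamma\in\Gamma,\ 0<\gamma<1}b_\gamma\frac{e^{2\pi i\gamma z}-1}{\gamma}.$$ Then $F(z)=e^{g(z)}f(z)$ is an almost periodic entire function.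
   Context: The Fourier transform is taken in the sense of tempered distributions with the convention $\hat\varphi(\lambda)=\int_{\mathbb R}\varphi(t)e^{-2\pi i\lambda t}\,dt$. An entire function $F$ is almost periodic if it is almost periodic in the strip $\mathbb C$: for every $-\infty<\alpha\le\beta<\infty$ and every $\varepsilon>0$ the set $\{\tau\in\mathbb R:\ \sup_{x\in\mathbb R,\ \alpha\le y\le\beta}|F(x+\tau+iy)-F(x+iy)|<\varepsilon\}$ is relatively dense in $\mathbb R$ (meets every interval of some length $L$ depending on $\varepsilon,\alpha,\beta$). *)

(* Defs.v *)
From HB Require Import structures.
From mathcomp Require Import all_boot all_order all_algebra.
From mathcomp Require Import all_classical all_reals all_analysis.
From mathcomp Require Export complex.
Import Order.TTheory GRing.Theory Num.Theory numFieldNormedType.Exports.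
Set Implicit Arguments. Unset Strict Implicit. Unset Printing Implicit Defensive.
Local Open Scope classical_set_scope.
Local Open Scope ring_scope.

Notation CC R := ((R[i])^o).

Definition cabs {R : realType} (z : CC R) : R := Normc.normc (z : R[i]).

Definition cexp {R : realType} (z : CC R) : CC R :=
  ((expR (complex.Re z))%:C * (cos (complex.Im z) +i* sin (complex.Im z)))%C.

Definition real_schwartz {R : realType} (u : R -> R) : Prop :=
  (forall (n : nat) (x : R), derivable (derive1n n u) x 1) /\
  (forall k n : nat, exists M : R, forall x : R, `|x ^+ k * derive1n n u x| <= M).

Definition schwartz {R : realType} (phi : R -> CC R) : Prop :=
  real_schwartz (fun t => complex.Re (phi t)) /\ real_schwartz (fun t => complex.Im (phi t)).

(* Fourier transform  phi^(xi) = int_R phi(t) e^{-2 pi i xi t} dt, written out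
   via real and imaginary parts (Lebesgue integrals on R). *)
Definition fourier {R : realType} (phi : R -> CC R) (xi : R) : CC R :=
  (Rintegral (@lebesgue_measure R) setT
     (fun t => complex.Re (phi t) * cos (2 * pi * xi * t) + complex.Im (phi t) * sin (2 * pi * xi * t))
   +i*
   Rintegral (@lebesgue_measure R) setT
     (fun t => complex.Im (phi t) * cos (2 * pi * xi * t) - complex.Re (phi t) * sin (2 * pi * xi * t)))%C.

Definition has_sum {R : realType} (S : set R) (h : R -> CC R) (s : CC R) : Prop :=
  forall e : R, 0 < e -> exists F0 : set R,
    [/\ finite_set F0, F0 `<=` S &
      forall F : set R, finite_set F -> F0 `<=` F -> F `<=` S ->
        cabs (\sum_(x \in F) h x - s) < e].

(* The positive discrete measure sum_{x in S} w(x) delta_x (w >= 0) is a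
   temperate (tempered) measure: int (1+|x|)^{-N} d(measure) < oo for some N. *)
Definition tempered_discrete {R : realType} (S : set R) (w : R -> R) : Prop :=
  exists N : nat, (\esum_(x in S) ((w x) / (1 + `|x|) ^+ N)%:E < +oo)%E.

(* Fourier transform (in the sense of tempered distributions) of
   mu = sum_{l in Lam} c_l delta_l equals nu = sum_{g in Gam} b_g delta_g:
   <nu, phi> = <mu, phi^> for every Schwartz test function phi. *)
Definition fourier_transform_is {R : realType} (Lam : set R) (c : R -> nat)
    (Gam : set R) (b : R -> CC R) : Prop :=
  forall phi : R -> CC R, schwartz phi ->
    exists s : CC R,
      has_sum Lam (fun l => (c l)%:R * fourier phi l) s /\
      has_sum Gam (fun g => b g * phi g) s.

Definition partial_prod {R : realType} (a : int -> R) (z : CC R) (N : nat) : CC R :=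
  (1 - z / ((a 0)%:C)%C) *
  \prod_(1 <= n < N.+1)
     ((1 - z / ((a (n%:Z))%:C)%C) * (1 - z / ((a (- (n%:Z)))%:C)%C)).

Definition entire {R : realType} (F : CC R -> CC R) : Prop :=
  forall z : CC R, derivable F z 1.

Definition almost_periodic {R : realType} (F : CC R -> CC R) : Prop :=
  forall alpha beta : R, alpha <= beta -> forall eps : R, 0 < eps ->
    exists L : R, forall a : R, exists tau : R, a <= tau <= a + L /\
      exists delta : R, delta < eps /\
        forall x y : R, alpha <= y <= beta ->
          cabs (F ((x + tau) +i* y)%C - F (x +i* y)%C) <= delta.

(* Main.v *)
(* Testing the Fourier transform against Gaussians gives the smoothed counting
   function of (a_n) as an absolutely convergent exponential sum over Gam.  It is
   almost periodic, so (a_n) has bounded gaps, and it is uniformly close to the mean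
   density b_0 > 0; hence a_n is asymptotically linear and a_n + a_{-n} = o(n).

   Testing against a Gaussian-smoothed half-line exponential gives, for Im z > 0, a
   Gaussian summation of sum_n 1 / (z - a_n), whose value tends to
     L(z) = - 2 pi i (b_0 / 2 + sum_(gam > 0) b_gam e^(2 pi i gam z)),
   where 1 / 2 is gcdf 0, a value that the argument never needs.
   By the near symmetry of (a_n) the symmetric partial sums of 1 / (z - a_n) have the
   same limit (a Tauberian theorem).  So the symmetric products converge to an entire
   f with f' = L f in the upper half-plane, and integrating L there,
     e^g f = const * e^(- i pi b_0 z) * exp (- sum_(gam >= 1) b_gam e^(2 pi i gam z) / gam),
   which is almost periodic in strips of the upper half-plane.  The zeros of f are
   real, so |f| increases away from the real axis and F is bounded in every strip; the
   three circles theorem applied to F(z + tau) - F(z) then carries almost periodicity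
   to all strips.

   Holomorphy is replaced throughout by being a locally uniform limit of polynomials,
   for which the Cauchy estimates follow from averages over roots of unity. *)
Require Import Defs.
From HB Require Import structures.
From mathcomp Require Import all_boot all_order all_algebra.
From mathcomp Require Import all_classical all_reals all_analysis.
From mathcomp Require Import measurable_realfun complex.
From mathcomp Require Import zify ring lra.
From mathcomp Require cyclic separable cyclotomic.
Import Order.TTheory GRing.Theory Num.Theory numFieldNormedType.Exports.
Local Open Scope classical_set_scope.
Local Open Scope ring_scope.
Set Implicit Arguments. Unset Strict Implicit. Unset Printing Implicit Defensive.

(** The spectral measure is accessible only through Schwartz functions, so 1 / (z - a_n), up to a
    constant the transform of a half-line exponential, cannot be reached directly. Replacing the
    indicator of the half-line by a Gaussian distribution function makes it Schwartz, with transform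
    the Cauchy kernel times exp (- pi sg^2 (z - l)^2). The price is the passage sg -> 0 in a series
    that converges only conditionally. It is paid by tying sg to the number of terms, sg = 1 / N:
    each pair with n <= N is then wrong by O((1 + |a_n + a_(-n)|) / N^2), and the bound o(n) for a_n
    + a_(-n) makes the total vanish.

    Temperance of |mu^| gives every spectral sum an absolutely summable majorant, so finitely many
    frequencies decide it up to epsilon; this yields both the limits in sg and the almost periods.
    The exponent g is needed because integrating the series divides b_gam by gam, and the b_gam /
    gam need not be summable near 0: e^g cancels the frequencies where this happens. *)

(** * Modulus and convergence of complex sequences *)

Section ComplexModulus.
Context {R : realType}.
Implicit Types (x y : R) (z w : R[i]).

(** Convertible to [cabs], but typed on the field [R[i]] rather than on its regular-module copy
    [CC R], so that field lemmas apply without a change of type. *)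
Definition cmod (z : R[i]) : R := Normc.normc z.

Lemma cmodE z : cmod z = Num.sqrt (complex.Re z ^+ 2 + complex.Im z ^+ 2).
Proof. by case: z. Qed.

Lemma cmod_ge0 z : 0 <= cmod z. Proof. by rewrite cmodE sqrtr_ge0. Qed.

Lemma sqr_cmod z : cmod z ^+ 2 = complex.Re z ^+ 2 + complex.Im z ^+ 2.
Proof. by rewrite cmodE sqr_sqrtr // addr_ge0 // sqr_ge0. Qed.

Lemma cmod0 : cmod 0 = 0. Proof. exact: Normc.normc0. Qed.
Lemma cmod1 : cmod 1 = 1. Proof. exact: Normc.normc1. Qed.
Lemma cmod_eq0 z : cmod z = 0 -> z = 0. Proof. exact: Normc.eq0_normc. Qed.
Lemma cmodM z w : cmod (z * w) = cmod z * cmod w. Proof. exact: Normc.normcM. Qed.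
Lemma cmodN z : cmod (- z) = cmod z. Proof. exact: normcN. Qed.
Lemma cmodD z w : cmod (z + w) <= cmod z + cmod w. Proof. exact: le_normcD. Qed.
Lemma cmodB z w : cmod (z - w) <= cmod z + cmod w.
Proof. by rewrite -(cmodN w) cmodD. Qed.
Lemma cmodV z : cmod z^-1 = (cmod z)^-1. Proof. exact: Normc.normcV. Qed.
Lemma cmod_dist z w : cmod (z - w) = cmod (w - z).
Proof. by rewrite -cmodN opprB. Qed.
Lemma cmod_tri w z t : cmod (z - t) <= cmod (z - w) + cmod (w - t).
Proof. by have := cmodD (z - w) (w - t); rewrite addrA subrK. Qed.
Lemma cmod_rtri z w : cmod z <= cmod w + cmod (z - w).
Proof. by have := cmodD w (z - w); rewrite addrC subrK. Qed.
Lemma cmodX z n : cmod (z ^+ n) = cmod z ^+ n.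
Proof. by elim: n => [|n IH]; rewrite ?expr0 ?cmod1 // !exprS cmodM IH. Qed.
Lemma cmod_sum (I : Type) (r : seq I) (P : pred I) (F : I -> R[i]) :
  cmod (\sum_(i <- r | P i) F i) <= \sum_(i <- r | P i) cmod (F i).
Proof.
elim/big_ind2: _ => [|a b c d ab cd|//]; first by rewrite cmod0.
by apply: le_trans (cmodD _ _) _; apply: lerD.
Qed.
Lemma cmodR x : cmod x%:C%C = `|x|.
Proof. by rewrite cmodE /= expr0n addr0 sqrtr_sqr. Qed.
Lemma cmod_nat n : cmod n%:R = n%:R.
Proof. by rewrite -(rmorph_nat (real_complex R)) cmodR ger0_norm. Qed.
Lemma cmodi : cmod 'i%C = 1.
Proof. by rewrite cmodE /= expr0n add0r expr1n sqrtr1. Qed.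
Lemma cmod_Re z : `|complex.Re z| <= cmod z.
Proof.
rewrite -(ler_pXn2r (n := 2)) ?nnegrE ?cmod_ge0 // sqr_cmod real_normK ?num_real //.
by rewrite lerDl sqr_ge0.
Qed.
Lemma cmod_Im z : `|complex.Im z| <= cmod z.
Proof.
rewrite -(ler_pXn2r (n := 2)) ?nnegrE ?cmod_ge0 // sqr_cmod real_normK ?num_real //.
by rewrite lerDr sqr_ge0.
Qed.
Lemma cmod_le z : cmod z <= `|complex.Re z| + `|complex.Im z|.
Proof.
rewrite -(ler_pXn2r (n := 2)) ?nnegrE ?cmod_ge0 // ?addr_ge0 // sqr_cmod sqrrD.
by rewrite !real_normK ?num_real // lerD2r lerDl mulrn_wge0 // mulr_ge0.
Qed.
Lemma ReB z w : complex.Re (z - w) = complex.Re z - complex.Re w.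
Proof. by case: z w => [? ?] [? ?]. Qed.
Lemma ImB z w : complex.Im (z - w) = complex.Im z - complex.Im w.
Proof. by case: z w => [? ?] [? ?]. Qed.
Lemma ReD z w : complex.Re (z + w) = complex.Re z + complex.Re w.
Proof. by case: z w => [? ?] [? ?]. Qed.
Lemma ImD z w : complex.Im (z + w) = complex.Im z + complex.Im w.
Proof. by case: z w => [? ?] [? ?]. Qed.
Lemma ReM z w : complex.Re (z * w) =
  complex.Re z * complex.Re w - complex.Im z * complex.Im w.
Proof. by case: z w => [? ?] [? ?]. Qed.
Lemma ImM z w : complex.Im (z * w) =
  complex.Re z * complex.Im w + complex.Im z * complex.Re w.
Proof. by case: z w => [? ?] [? ?]. Qed.

(** Telescoping one factor at a time. [K >= 1] absorbs the missing power; [cexp_euler] takes for [K]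
    the exponential of the modulus of w / n, so that [K ^+ n] stays bounded. *)
Lemma cmod_pow_sub (a b : R[i]) (K : R) n : 1 <= K -> cmod a <= K -> cmod b <= K ->
  cmod (a ^+ n - b ^+ n) <= n%:R * K ^+ n * cmod (a - b).
Proof.
move=> K1 aK bK; have K0 : 0 <= K by lra.
elim: n => [|n IH]; first by rewrite !expr0 subrr cmod0 !mul0r.
have -> : a ^+ n.+1 - b ^+ n.+1 = a * (a ^+ n - b ^+ n) + (a - b) * b ^+ n.
  by rewrite !exprS; ring.
apply: le_trans (cmodD _ _) _; rewrite !cmodM cmodX.
have h1 : cmod a * cmod (a ^+ n - b ^+ n) <= K * (n%:R * K ^+ n * cmod (a - b)).
  by apply: ler_pM; rewrite ?cmod_ge0.
have h2 : cmod (a - b) * cmod b ^+ n <= cmod (a - b) * (K * K ^+ n).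
  apply: ler_wpM2l; first exact: cmod_ge0.
  apply: (@le_trans _ _ (K ^+ n)); first by rewrite lerXn2r // nnegrE ?cmod_ge0.
  by rewrite ler_peMl // exprn_ge0.
apply: le_trans (lerD h1 h2) _.
rewrite -[n.+1%:R]natr1 exprS le_eqVlt; apply/orP; left; apply/eqP; ring.
Qed.

Definition ccvg (u : nat -> R[i]) (l : R[i]) :=
  forall e : R, 0 < e -> exists N : nat, forall n, (N <= n)%N -> cmod (u n - l) <= e.

Definition rcvg (u : nat -> R) (l : R) :=
  forall e : R, 0 < e -> exists N : nat, forall n, (N <= n)%N -> `|u n - l| <= e.

Lemma rcauchy_cvg (u : nat -> R) :
  (forall e, 0 < e -> exists N, forall m n, (N <= m)%N -> (N <= n)%N -> `|u m - u n| <= e) ->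
  exists l, rcvg u l.
Proof.
move=> hu; have cu : cvg (u @ \oo).
  apply/cauchy_cvgP/cauchy_exP => e e0.
  have e20 : 0 < e / 2 by rewrite divr_gt0.
  have [N hN] := hu _ e20.
  exists (u N); exists N => // n /= Nn; rewrite /ball /=.
  by apply: le_lt_trans (hN _ _ (leqnn N) Nn) _; lra.
exists (limn u) => e e0.
have /cvgrPdist_le/(_ _ e0)[N _ hN] := cu.
by exists N => n Nn; rewrite distrC; apply: hN.
Qed.

Lemma ccauchy_cvg (u : nat -> R[i]) :
  (forall e, 0 < e -> exists N, forall m n, (N <= m)%N -> (N <= n)%N -> cmod (u m - u n) <= e) ->
  exists l, ccvg u l.
Proof.
move=> hu.
have [a ha] : exists a, rcvg (fun n => complex.Re (u n)) a.
  apply: rcauchy_cvg => e e0; have [N hN] := hu _ e0; exists N => m n Nm Nn.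
  by rewrite -ReB; apply: le_trans (cmod_Re _) (hN _ _ Nm Nn).
have [b hb] : exists b, rcvg (fun n => complex.Im (u n)) b.
  apply: rcauchy_cvg => e e0; have [N hN] := hu _ e0; exists N => m n Nm Nn.
  by rewrite -ImB; apply: le_trans (cmod_Im _) (hN _ _ Nm Nn).
exists (a +i* b)%C => e e0; have e20 : 0 < e / 2 by rewrite divr_gt0.
have [N1 h1] := ha _ e20; have [N2 h2] := hb _ e20.
exists (maxn N1 N2) => n; rewrite geq_max => /andP[n1 n2].
apply: le_trans (cmod_le _) _; rewrite ReB ImB /=.
by have := h1 _ n1; have := h2 _ n2; lra.
Qed.

Lemma ccvg_le u l (B : R) : ccvg u l -> (forall n, cmod (u n) <= B) -> cmod l <= B.
Proof.
move=> hu hB; apply/ler_addgt0Pl => e e0; have [N hN] := hu _ e0.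
have := cmod_rtri l (u N); rewrite cmod_dist.
by have := hN _ (leqnn _); have := hB N; lra.
Qed.

Lemma ccvgD u v l m : ccvg u l -> ccvg v m -> ccvg (fun n => u n + v n) (l + m).
Proof.
move=> hu hv e e0; have e20 : 0 < e / 2 by rewrite divr_gt0.
have [N1 k1] := hu _ e20; have [N2 k2] := hv _ e20; exists (maxn N1 N2) => n.
rewrite geq_max => /andP[n1 n2].
have -> : u n + v n - (l + m) = (u n - l) + (v n - m) by ring.
apply: le_trans (cmodD _ _) _; have := k1 _ n1; have := k2 _ n2; lra.
Qed.

Lemma ccvg_cst l : ccvg (fun=> l) l.
Proof. by move=> e e0; exists 0%N => n _; rewrite subrr cmod0 ltW. Qed.

Lemma ccvgMl c u l : ccvg u l -> ccvg (fun n => c * u n) (c * l).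
Proof.
move=> hu e e0; have c0 := cmod_ge0 c; have c1 : 0 < cmod c + 1 by lra.
have [N hN] := hu (e / (cmod c + 1)) (divr_gt0 e0 c1).
exists N => n Nn; rewrite -mulrBr cmodM.
apply: (@le_trans _ _ ((cmod c + 1) * (e / (cmod c + 1)))).
  by apply: ler_pM; rewrite ?cmod_ge0 ?hN //; lra.
by rewrite mulrCA mulfV ?gt_eqF // mulr1.
Qed.

Lemma ccvg_bounded u l : ccvg u l ->
  exists N B, forall n, (N <= n)%N -> cmod (u n) <= B.
Proof.
move=> hu; have [N hN] := hu _ ltr01; exists N, (cmod l + 1) => n Nn.
by have := cmod_rtri (u n) l; have := hN _ Nn; lra.
Qed.

Lemma ccvgM u v l m : ccvg u l -> ccvg v m -> ccvg (fun n => u n * v n) (l * m).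
Proof.
move=> hu hv e e0.
have [N0 [B hB]] := ccvg_bounded hu.
have B0 : 0 <= B by apply: le_trans (cmod_ge0 _) (hB _ (leqnn _)).
have m0 := cmod_ge0 m.
have e1 : 0 < e / 2 / (B + 1) by rewrite !divr_gt0 //; lra.
have e2 : 0 < e / 2 / (cmod m + 1) by rewrite !divr_gt0 //; lra.
have [N1 k1] := hu _ e2; have [N2 k2] := hv _ e1.
exists (maxn N0 (maxn N1 N2)) => n; rewrite !geq_max => /and3P[n0 n1 n2].
have -> : u n * v n - l * m = u n * (v n - m) + (u n - l) * m by ring.
apply: le_trans (cmodD _ _) _; rewrite !cmodM.
have p1 : cmod (u n) * cmod (v n - m) <= (B + 1) * (e / 2 / (B + 1)).
  by apply: ler_pM; rewrite ?cmod_ge0 ?k2 //; have := hB _ n0; lra.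
have p2 : cmod (u n - l) * cmod m <= (e / 2 / (cmod m + 1)) * (cmod m + 1).
  by apply: ler_pM; rewrite ?cmod_ge0 ?k1 //; lra.
rewrite [leRHS]mulrC divfK in p1; last by rewrite gt_eqF //; lra.
rewrite divfK in p2; last by rewrite gt_eqF //; lra.
lra.
Qed.

Lemma ccvg_ext u v l : (forall n, u n = v n) -> ccvg u l -> ccvg v l.
Proof. by move=> uv hu e e0; have [N hN] := hu _ e0; exists N => n Nn; rewrite -uv hN. Qed.

End ComplexModulus.

(** * Cauchy's estimates for polynomials *)

Section CauchyEstimates.
Context {R : realType}.
Local Notation C := (R[i]).
Implicit Types (p q : {poly C}) (z w h : C).

(** ['X^n - 1] is separable and splits over the algebraically closed [R[i]]; a field with [n]
    distinct [n]-th roots of unity has a primitive one. *)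
Lemma prim_root_exists n : (0 < n)%N -> exists z : C, n.-primitive_root z.
Proof.
move=> n_gt0; pose p : {poly C} := 'X^n - 1.
have [r Dp] := closed_field_poly_normal p.
rewrite (monicP _) ?monicXnsubC // scale1r in Dp.
have rn1 : all n.-unity_root r by apply/allP=> z; rewrite -root_prod_XsubC -Dp.
have sz_r : (n < (size r).+1)%N.
  by rewrite -(size_prod_XsubC r id) -Dp size_XnsubC.
have [|z] := hasP (cyclic.has_prim_root n_gt0 rn1 _ sz_r); last by exists z.
by rewrite -separable.separable_prod_XsubC -Dp cyclotomic.separable_Xn_sub_1 //
  pnatr_eq0 -lt0n.
Qed.

(* Averaging p(r w^j) w^(-jk) over the n-th roots of unity w^j isolates the
   coefficient of index k. *)
Lemma cauchy_coef p (r M : R) k : 0 <= r ->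
  (forall z, cmod z <= r -> cmod p.[z] <= M) -> cmod p`_k * r ^+ k <= M.
Proof.
move=> r0 hM; pose n := (size p + k).+1.
have [om prim_om] := @prim_root_exists n isT.
have om_n : om ^+ n = 1 by apply: prim_expr_order.
have cmod_om : cmod om = 1.
  apply/eqP; rewrite -(@pexpr_eq1 _ _ n) // ?cmod_ge0 //.
  by rewrite -cmodX om_n cmod1.
have key : \sum_(j < n) p.[r%:C%C * om ^+ j] * om ^+ (j * (n - k)) =
           n%:R * (p`_k * (r%:C%C) ^+ k).
  under eq_bigr => j _.
    rewrite (@horner_coef_wide _ n); last by rewrite /n -addnS leq_addr.
    rewrite mulr_suml.
    over.
  rewrite exchange_big /=.
  have kn : (k < n)%N by rewrite /n ltnS leq_addl.
  rewrite (bigD1 (Ordinal kn)) //= [X in _ + X]big1 ?addr0 => [|i /eqP ik].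
    rewrite (eq_bigr (fun=> p`_k * r%:C%C ^+ k)); last first.
      move=> j _; rewrite exprMn -!mulrA -exprM -exprD -mulnDr subnKC 1?ltnW //.
      by rewrite mulnC exprM om_n expr1n mulr1.
    by rewrite sumr_const card_ord mulr_natl.
  pose x := om ^+ (i + (n - k)).
  have x1 : x != 1.
    rewrite -(expr0 om) (eq_prim_root_expr prim_om) mod0n -/(dvdn _ _).
    apply/negP => /dvdnP[c hc]; apply: ik; apply: val_inj => /=.
    have ii : (i < n)%N := ltn_ord i.
    have c1 : (c = 1)%N by nia.
    by rewrite c1 in hc; lia.
  transitivity (p`_i * r%:C%C ^+ i * \sum_(j < n) x ^+ j).
    rewrite mulr_sumr; apply: eq_bigr => j _.
    rewrite exprMn -!mulrA -!exprM -exprD; congr (_ * (_ * om ^+ _)); lia.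
  have /eqP : (x - 1) * \sum_(j < n) x ^+ j = 0.
    rewrite -subrX1 /x -exprM mulnC exprM om_n expr1n subrr //.
  rewrite mulf_eq0 subr_eq0 (negPf x1) /= => /eqP ->.
  by rewrite mulr0.
have : n%:R * (cmod p`_k * r ^+ k) <= n%:R * M.
  have -> : n%:R * (cmod p`_k * r ^+ k) = cmod (n%:R * (p`_k * (r%:C%C) ^+ k)).
    by rewrite !cmodM cmod_nat cmodX cmodR ger0_norm.
  rewrite -key; apply: le_trans (cmod_sum _ _ _) _.
  apply: (@le_trans _ _ (\sum_(j < n) M)).
    apply: ler_sum => j _; rewrite cmodM cmodX cmod_om expr1n mulr1; apply: hM.
    by rewrite cmodM cmodX cmod_om expr1n mulr1 cmodR ger0_norm.
  by rewrite sumr_const card_ord mulr_natl.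
by rewrite ler_pM2l // ltr0n.
Qed.

(** The Taylor expansion at [w], written as a polynomial so that [cauchy_coef] bounds its
    coefficients. *)
Definition recenter p w : {poly C} := p \Po ('X + w%:P).

Lemma recenterE p w h : (recenter p w).[h] = p.[w + h].
Proof. by rewrite horner_comp !hornerE addrC. Qed.

Lemma recenter0 p w : (recenter p w)`_0 = p.[w].
Proof. by rewrite -horner_coef0 recenterE addr0. Qed.

Lemma recenter1 p w : (recenter p w)`_1 = p^`().[w].
Proof.
have <- : ((recenter p w)^`())`_0 = (recenter p w)`_1 by rewrite coef_deriv.
by rewrite -horner_coef0 deriv_comp derivD derivX derivC addr0 mulr1 recenterE addr0.
Qed.

Lemma cauchy_recenter p w (r M : R) k : 0 <= r ->
  (forall z, cmod (z - w) <= r -> cmod p.[z] <= M) ->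
  cmod (recenter p w)`_k * r ^+ k <= M.
Proof.
move=> r0 hM; apply: cauchy_coef => // h hr; rewrite recenterE; apply: hM.
by rewrite addrAC subrr add0r.
Qed.

Lemma sum_half_le n : \sum_(i < n) (2^-1 : R) ^+ i <= 2.
Proof.
have h : \sum_(i < n) (2^-1 : R) ^+ i = 2 - 2 * (2^-1) ^+ n.
  by elim: n => [|n IH]; rewrite ?big_ord0 ?expr0 ?mulr1 ?subrr // big_ord_recr /= IH exprS; field.
by rewrite h gerBl mulr_ge0 // exprn_ge0.
Qed.

Lemma poly_deriv_le p w (M : R) :
  (forall z, cmod (z - w) <= 1 -> cmod p.[z] <= M) -> cmod p^`().[w] <= M.
Proof.
by move=> hM; have := cauchy_recenter 1 ler01 hM; rewrite expr1 mulr1 recenter1.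
Qed.

(** By Cauchy's estimate on the unit disc every Taylor coefficient is at most [M], so for |h| <= 1/2
    the terms from degree 2 on form a geometric series of sum at most 2 M |h|^2. The degree of [p]
    does not enter, so the bound survives limits of polynomials. *)
Lemma poly_taylor1 p w h (M : R) :
  (forall z, cmod (z - w) <= 1 -> cmod p.[z] <= M) -> cmod h <= 2^-1 ->
  cmod (p.[w + h] - p.[w] - h * p^`().[w]) <= 2 * M * cmod h ^+ 2.
Proof.
move=> hM hh.
have M0 : 0 <= M.
  by apply: le_trans (cmod_ge0 p.[w]) (hM _ _); rewrite subrr cmod0.
pose q := recenter p w.
have -> : p.[w + h] - p.[w] - h * p^`().[w] = \sum_(i < size q) q`_i.+2 * h ^+ i.+2.
  rewrite -recenterE (@horner_coef_wide _ (size q).+2) ?leqW //.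
  rewrite !big_ord_recl /= -/q expr0 mulr1 expr1 /bump /= add1n.
  rewrite recenter0 recenter1.
  have -> (a b c d : C) : a + (b * c + d) - a - c * b = d by ring.
  by apply: eq_bigr => i _.
apply: le_trans (cmod_sum _ _ _) _.
apply: (@le_trans _ _ (\sum_(i < size q) M * cmod h ^+ 2 * 2^-1 ^+ i)).
  apply: ler_sum => i _; rewrite cmodM cmodX -addn2 exprD mulrA [leRHS]mulrAC.
  apply: ler_wpM2r; first by rewrite exprn_ge0 // cmod_ge0.
  apply: ler_pM; rewrite ?exprn_ge0 ?cmod_ge0 //.
    by have := cauchy_recenter (i + 2) ler01 hM; rewrite expr1n mulr1.
  by rewrite lerXn2r // nnegrE ?cmod_ge0 // invr_ge0.
rewrite -mulr_sumr; apply: le_trans (ler_wpM2l _ (sum_half_le _)) _.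
  by rewrite mulr_ge0 // exprn_ge0 // cmod_ge0.
rewrite le_eqVlt; apply/orP; left; apply/eqP; ring.
Qed.

(* Weak form of Hadamard's three circles theorem: smallness on a small disc and
   boundedness on a large disc force smallness on intermediate discs. *)
Lemma poly_three_circles (rho M eta : R) : 1 <= rho -> 0 <= M -> 0 < eta ->
  exists2 e : R, 0 < e & forall p w,
    (forall z, cmod (z - w) <= 1 -> cmod p.[z] <= e) ->
    (forall z, cmod (z - w) <= 2 * rho -> cmod p.[z] <= M) ->
    forall z, cmod (z - w) <= rho -> cmod p.[z] <= eta.
Proof.
move=> rho1 M0 eta0.
have rho0 : 0 < rho by lra.
(* The large disc bounds the k-th coefficient by M / (2 rho)^k, so on radius [rho] the terms from
   index [K] on add up to at most 2 M / 2^K. *)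
have [K hK] : exists K : nat, 2 * M * 2^-1 ^+ K <= eta / 2.
  have h0 : 0 < eta / 2 / (2 * M + 1) by rewrite !divr_gt0 //; lra.
  have /cvgrPdist_le/(_ _ h0)[K _ /(_ K (leqnn K))] :
      (fun n => (2^-1 : R) ^+ n) @ \oo --> (0 : R).
    by apply: cvg_expr; rewrite ger0_norm ?invr_ge0 // invf_lt1 ?ltr1n.
  rewrite /= sub0r normrN ger0_norm ?exprn_ge0 // => hK; exists K.
  apply: (@le_trans _ _ ((2 * M + 1) * (eta / 2 / (2 * M + 1)))).
    by apply: ler_pM => //; rewrite ?exprn_ge0 //; lra.
  by rewrite mulrC divfK // gt_eqF //; lra.
(* The small disc bounds every coefficient by the [e] to be found, so the first [K] terms cost at
   most [e * D]. *)
pose D := \sum_(k < K) rho ^+ k + 1.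
have D0 : 0 < D.
  have : 0 <= \sum_(k < K) rho ^+ k by apply: sumr_ge0 => i _; rewrite exprn_ge0 // ltW.
  by rewrite /D; lra.
exists (eta / 2 / D) => [|p w h1 h2 z hz]; first by rewrite !divr_gt0.
pose q := recenter p w; pose h := z - w.
have -> : p.[z] = \sum_(i < K + size q) q`_i * h ^+ i.
  by rewrite -(@horner_coef_wide _ (K + size q)) ?leq_addl // recenterE /h addrC subrK.
rewrite big_split_ord /=; apply: le_trans (cmodD _ _) _.
have p1 : cmod (\sum_(i < K) q`_i * h ^+ i) <= eta / 2.
  apply: le_trans (cmod_sum _ _ _) _.
  apply: (@le_trans _ _ (\sum_(i < K) eta / 2 / D * rho ^+ i)).
    apply: ler_sum => i _; rewrite cmodM cmodX.
    apply: ler_pM; rewrite ?exprn_ge0 ?cmod_ge0 //.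
      by have := cauchy_recenter i ler01 h1; rewrite expr1n mulr1.
    by rewrite lerXn2r // nnegrE ?cmod_ge0 // ltW.
  rewrite -mulr_sumr; apply: (@le_trans _ _ (eta / 2 / D * D)).
    apply: ler_wpM2l; first by rewrite !divr_ge0 // ltW.
    by rewrite /D lerDl.
  by rewrite divfK // gt_eqF.
have p2 : cmod (\sum_(i < size q) q`_(K + i) * h ^+ (K + i)) <= eta / 2.
  apply: le_trans (cmod_sum _ _ _) _.
  apply: (@le_trans _ _ (\sum_(i < size q) M * 2^-1 ^+ K * 2^-1 ^+ i)).
    apply: ler_sum => i _; rewrite cmodM cmodX -mulrA -exprD.
    have c1 : cmod q`_(K + i) * (2 * rho) ^+ (K + i) <= M.
      by apply: cauchy_recenter => //; rewrite mulr_ge0 // ltW.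
    apply: (@le_trans _ _ (cmod q`_(K + i) * (2 * rho) ^+ (K + i) * 2^-1 ^+ (K + i))).
      rewrite -mulrA -exprMn; apply: ler_wpM2l; first exact: cmod_ge0.
      rewrite lerXn2r // ?nnegrE ?cmod_ge0 //; last by rewrite mulrAC mulfV // mul1r.
      by rewrite !mulr_ge0 ?invr_ge0 // ltW.
    by apply: ler_wpM2r => //; rewrite exprn_ge0 // invr_ge0.
  rewrite -mulr_sumr; apply: le_trans (ler_wpM2l _ (sum_half_le _)) _.
    by rewrite mulr_ge0 // exprn_ge0 // invr_ge0.
  by apply: le_trans hK; rewrite le_eqVlt; apply/orP; left; apply/eqP; ring.
lra.
Qed.

End CauchyEstimates.

(** * Quantitative estimates for the complex exponential *)

Section ComplexExponential.
Context {R : realType}.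
Local Notation C := (R[i]).
Implicit Types (z w h : C).

Definition ce (z : C) : C := cexp z.

Lemma ceE z : ce z = ((expR (complex.Re z) * cos (complex.Im z)) +i*
                      (expR (complex.Re z) * sin (complex.Im z)))%C.
Proof.
rewrite /ce /cexp; apply/eqP; rewrite eq_complex ReM ImM /=.
by rewrite !mul0r subr0 addr0 !eqxx.
Qed.

Lemma ceD z w : ce (z + w) = ce z * ce w.
Proof.
rewrite !ceE ReD ImD expRD cosD sinD; apply/eqP; rewrite eq_complex /=.
by apply/andP; split; apply/eqP; ring.
Qed.

Lemma ce0 : ce 0 = 1.
Proof. by rewrite ceE /= expR0 cos0 sin0 mulr1 mulr0. Qed.

Lemma cmod_ce z : cmod (ce z) = expR (complex.Re z).
Proof.
have h : cmod (ce z) ^+ 2 = expR (complex.Re z) ^+ 2.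
  by rewrite sqr_cmod ceE /= !exprMn -mulrDr cos2Dsin2 mulr1.
by apply/eqP; rewrite -(@eqrXn2 _ 2) ?h ?cmod_ge0 ?expR_ge0.
Qed.

Lemma ce_neq0 z : ce z != 0.
Proof. by apply/eqP => h; have := cmod_ce z; rewrite h cmod0 => /eqP; rewrite eq_sym expR_eq0. Qed.

Lemma ceN z : ce (- z) = (ce z)^-1.
Proof. by apply: (mulfI (ce_neq0 z)); rewrite mulfV ?ce_neq0 // -ceD subrr ce0. Qed.

Lemma ceMn z n : ce (n%:R * z) = ce z ^+ n.
Proof.
elim: n => [|n IH]; first by rewrite mul0r ce0 expr0.
by rewrite -natr1 mulrDl mul1r ceD IH exprSr.
Qed.

Lemma cmod_ce_le z : cmod (ce z) <= expR (cmod z).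
Proof. by rewrite cmod_ce ler_expR; apply: le_trans (ler_norm _) (cmod_Re _). Qed.

Lemma sin_le_norm (x : R) : `|sin x| <= `|x|.
Proof.
wlog x0 : x / 0 <= x.
  move=> hw; have [x0|x0] := leP 0 x; first exact: hw.
  by have := hw (- x); rewrite sinN !normrN oppr_ge0; apply; apply: ltW.
have [c _] := @MVT_segment R sin cos 0 x x0 (fun y _ => is_derive_sin y)
  (continuous_subspaceT (@continuous_sin R)).
rewrite sin0 !subr0 => ->; rewrite normrM -[leRHS]mul1r.
by apply: ler_wpM2r => //; apply: cos_max.
Qed.

Lemma oneBcos_le (x : R) : `|1 - cos x| <= x ^+ 2 / 2.
Proof.
have -> : 1 - cos x = 2 * sin (x / 2) ^+ 2.
  have {1}-> : x = (x / 2) *+ 2 by rewrite mulr2n; field.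
  by rewrite cos_mulr2n cos2sin2 mulr2n; ring.
rewrite normrM normrX ger0_norm //.
have -> : x ^+ 2 / 2 = 2 * `|x / 2| ^+ 2 by rewrite real_normK ?num_real //; field.
by rewrite ler_pM2l // lerXn2r // ?nnegrE // sin_le_norm.
Qed.

Lemma sinB_le (x : R) : `|sin x - x| <= `|x| ^+ 3 / 2.
Proof.
wlog x0 : x / 0 <= x.
  move=> hw; have [x0|x0] := leP 0 x; first exact: hw.
  have := hw (- x); rewrite sinN -opprD !normrN oppr_ge0; apply; exact: ltW.
have hd (y : R) : y \in `]0, x[ -> is_derive y 1 (fun t => sin t - t) (cos y - 1).
  by move=> _; apply: is_derive_eq.
have hc : {within `[0, x], continuous (fun t : R => sin t - t)}.
  apply: continuous_subspaceT => y.
  by apply: cvgB; [exact: continuous_sin | exact: cvg_id].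
have [c] := @MVT_segment R _ _ 0 x x0 hd hc.
rewrite sin0 !subr0 in_itv /= => /andP[c0 cx] ->; rewrite normrM exprS mulrAC [leLHS]mulrC -mulrA.
rewrite ler_wpM2l // distrC; apply: le_trans (oneBcos_le _) _.
rewrite mulrC ler_pM2l ?invr_gt0 // lerXn2r // ?nnegrE // !ger0_norm //.
Qed.

Lemma expRB1D_le (x : R) : `|x| <= 2^-1 -> `|expR x - 1 - x| <= 2 * x ^+ 2.
Proof.
rewrite ler_norml => /andP[x1 x2].
have h1 := expR_ge1Dx x; have h2 := expR_ge1Dx (- x).
have h3 : expR x * (1 - x) <= 1.
  rewrite -[leRHS](expRxMexpNx_1 x); by apply: ler_wpM2l; [exact: expR_ge0 | exact: h2].
have h4 : 0 < expR x := expR_gt0 x.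
rewrite ger0_norm; nra.
Qed.

Lemma cexp_taylor1_small w : cmod w <= 2^-1 -> cmod (ce w - 1 - w) <= 5 * cmod w ^+ 2.
Proof.
move=> hw; rewrite sqr_cmod; move: (cmod_Re w) (cmod_Im w) => hx hy.
apply: le_trans (cmod_le _) _; rewrite !ReB !ImB ceE /= subr0.
move: (complex.Re w) (complex.Im w) hx hy => x y hx hy.
have x2 : `|x| <= 2^-1 by apply: le_trans hw.
have y2 : `|y| <= 2^-1 by apply: le_trans hw.
have E0 := expR_gt0 x; have hE := expRB1D_le x2.
have hc := oneBcos_le y; have hs := sinB_le y.
have E2 : expR x <= 2.
  move: x2 hE; rewrite !ler_norml => /andP[? ?] /andP[? ?]; nra.
have xx : `|x| ^+ 2 = x ^+ 2 by rewrite real_normK ?num_real.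
have yy : `|y| ^+ 2 = y ^+ 2 by rewrite real_normK ?num_real.
have -> : expR x * cos y - 1 - x = (expR x - 1 - x) - expR x * (1 - cos y) by ring.
have -> : expR x * sin y - y = expR x * (sin y - y) + ((expR x - 1 - x) + x) * y by ring.
have t1 := ler_normB (expR x - 1 - x) (expR x * (1 - cos y)).
have t2 := ler_normD (expR x * (sin y - y)) (((expR x - 1 - x) + x) * y).
have t3 := ler_normD (expR x - 1 - x) x.
move: t1 t2; rewrite !normrM (ger0_norm (expR_ge0 x)) => t1 t2.
have nx := normr_ge0 x; have ny := normr_ge0 y.
have s1 : expR x * `|1 - cos y| <= y ^+ 2.
  apply: (@le_trans _ _ (2 * (y ^+ 2 / 2))); last lra.
  by apply: ler_pM.
have s2 : expR x * `|sin y - y| <= `|y| ^+ 2 / 2.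
  apply: (@le_trans _ _ (2 * (`|y| ^+ 3 / 2))); first by apply: ler_pM.
  rewrite exprS; have : `|y| * `|y| ^+ 2 <= 2^-1 * `|y| ^+ 2 by rewrite ler_wpM2r // sqr_ge0.
  lra.
have s3 : `|expR x - 1 - x + x| * `|y| <= 2 * (x ^+ 2 + y ^+ 2).
  apply: (@le_trans _ _ ((2 * x ^+ 2 + `|x|) * `|y|)).
    by apply: ler_wpM2r => //; lra.
  have : 2 * x ^+ 2 + `|x| <= 2 * `|x|.
    have : `|x| * `|x| <= `|x| * 2^-1 by rewrite ler_wpM2l.
    rewrite -xx expr2; lra.
  have := sqr_ge0 (`|x| - `|y|); rewrite sqrrB -xx -yy => k1 k2.
  apply: (@le_trans _ _ (2 * `|x| * `|y|)); first by rewrite ler_wpM2r.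
  have := sqr_ge0 `|x|; have := sqr_ge0 `|y|; lra.
have := sqr_ge0 x; have := sqr_ge0 y; lra.
Qed.

(** For |w| > 1/2 the triangle inequality suffices, since then |w|^2 >= 1/4. The bound has to hold
    for all [w]: it is later applied to multiples of an unbounded frequency. *)
Lemma cexp_taylor1 w : cmod (ce w - 1 - w) <= 12 * cmod w ^+ 2 * expR (cmod w).
Proof.
have w0 := cmod_ge0 w; have E1 := expR_ge1Dx (cmod w).
have [hw|hw] := leP (cmod w) 2^-1.
  apply: le_trans (cexp_taylor1_small hw) _.
  rewrite -mulrA mulrCA [leRHS]mulrCA -mulrA; have := sqr_ge0 (cmod w); nra.
apply: le_trans (cmodB _ _) _; have h1 := cmodB (ce w) 1.
have h2 := cmod_ce_le w; rewrite cmod1 in h1.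
have : 4^-1 <= cmod w ^+ 2 by rewrite expr2; nra.
nra.
Qed.

Lemma cexp_sub1 w : cmod (ce w - 1) <= 4 * cmod w * expR (cmod w).
Proof.
have w0 := cmod_ge0 w; have E1 := expR_ge1Dx (cmod w).
have [hw|hw] := leP (cmod w) 2^-1.
  have h := cexp_taylor1_small hw.
  have -> : ce w - 1 = (ce w - 1 - w) + w by ring.
  apply: le_trans (cmodD _ _) _; nra.
have h1 := cmodB (ce w) 1; have h2 := cmod_ce_le w; rewrite cmod1 in h1; nra.
Qed.

Lemma cexp_dist z w :
  cmod (ce z - ce w) <= expR (cmod w) * (4 * cmod (z - w) * expR (cmod (z - w))).
Proof.
have -> : ce z - ce w = ce w * (ce (z - w) - 1).
  by rewrite mulrBr mulr1 -ceD [w + _]addrC subrK.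
by rewrite cmodM; apply: ler_pM; rewrite ?cmod_ge0 ?cmod_ce_le ?cexp_sub1.
Qed.

(** Euler's limit with an explicit rate, uniform on discs: this is how the exponential becomes a
    limit of polynomials. *)
Lemma cexp_euler w n : (2 * cmod w <= n.+1%:R) ->
  cmod (ce w - (1 + w / n.+1%:R) ^+ n.+1) <= 5 * cmod w ^+ 2 * expR (cmod w) / n.+1%:R.
Proof.
move=> hn; have n0 : 0 < n.+1%:R :> R by rewrite ltr0n.
have n0' : n.+1%:R != 0 :> C by rewrite pnatr_eq0.
pose u := w / n.+1%:R.
have cu : cmod u = cmod w / n.+1%:R by rewrite cmodM cmodV cmod_nat.
have w0 := cmod_ge0 w; have u0 := cmod_ge0 u.
have u1 : cmod u <= 2^-1 by rewrite cu ler_pdivrMr // mulrC ler_pdivlMr // mulrC.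
have -> : ce w = ce u ^+ n.+1 by rewrite -ceMn /u mulrC divfK.
apply: le_trans (@cmod_pow_sub _ _ _ (expR (cmod u)) n.+1 _ _ _) _.
- by have := expR_ge1Dx (cmod u); lra.
- exact: cmod_ce_le.
- apply: le_trans (cmodD _ _) _; rewrite cmod1; exact: expR_ge1Dx.
rewrite -expRM_natl.
have -> : n.+1%:R * cmod u = cmod w by rewrite cu mulrC divfK // gt_eqF.
have := cexp_taylor1_small u1; rewrite -/u opprD addrA => h.
apply: (@le_trans _ _ (n.+1%:R * expR (cmod w) * (5 * cmod u ^+ 2))).
  by apply: ler_wpM2l => //; rewrite mulr_ge0 ?expR_ge0 // ltW.
rewrite cu le_eqVlt; apply/orP; left; apply/eqP; field.
by rewrite -natr1 in n0; lra.
Qed.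

End ComplexExponential.

(** The constants live in [K] because the norm of a [numFieldType] takes its values in the field
    itself; for [R[i]] they are real numbers embedded there. *)
Lemma derivable_taylor1 (K : numFieldType) (F : K^o -> K^o) (w D M d : K) : 0 < d -> 0 <= M ->
  (forall h : K, `|h| <= d -> `|(F (w + h) : K) - F w - h * D| <= M * `|h| ^+ 2) ->
  derivable F w 1.
Proof.
move=> d0 M0 hF; apply/cvg_ex; exists D; apply/cvgrPdist_le => /= e e0.
have M1 : 0 < M + 1 by rewrite ltr_wpDl.
near=> h.
have h0 : h != 0 by near: h; rewrite near_withinE; apply: nearW.
have hd : `|h| <= d by near: h; exact: dnbhs0_le.
have he : `|h| <= e / (M + 1) by near: h; apply: dnbhs0_le; rewrite divr_gt0.
have hp : 0 < `|h| by rewrite normr_gt0.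
have -> : D - h^-1 *: (F (h%:A + w) - F w) = - (h^-1 * ((F (w + h) : K) - F w - h * D)).
  rewrite /GRing.scale /= mulr1 [h + w]addrC [in RHS]mulrBr mulKf // opprB //.
rewrite normrN normrM normfV mulrC ler_pdivrMr //; apply: le_trans (hF _ hd) _.
rewrite expr2 mulrA; apply: ler_wpM2r => //; rewrite mulrC.
apply: le_trans (_ : `|h| * (M + 1) <= _); first by rewrite ler_wpM2l // lerDl.
by rewrite -ler_pdivlMr.
Unshelve. all: by end_near. Qed.

(** * Limits of polynomials *)

(* The functions which are limits of polynomials, uniformly on discs; they play
   the part of the entire functions. *)
Section PolynomialLimits.
Context {R : realType}.
Local Notation C := (R[i]).
Implicit Types (F G : C -> C) (z w h : C).

Definition polylim F := forall r e : R, 0 < e ->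
  exists p : {poly C}, forall z, cmod z <= r -> cmod (p.[z] - F z) <= e.

Lemma poly_bounded (p : {poly C}) (r : R) : exists M : R, forall z, cmod z <= r -> cmod p.[z] <= M.
Proof.
exists (\sum_(i < size p) cmod p`_i * r ^+ i) => z hz.
rewrite horner_coef; apply: le_trans (cmod_sum _ _ _) _; apply: ler_sum => i _.
rewrite cmodM cmodX; apply: ler_wpM2l; first exact: cmod_ge0.
by rewrite lerXn2r // nnegrE ?cmod_ge0 // (le_trans (cmod_ge0 z)).
Qed.

Lemma polylim_bounded F (r : R) : polylim F ->
  exists2 M : R, 0 <= M & forall z, cmod z <= r -> cmod (F z) <= M.
Proof.
move=> hF; have [p hp] := hF r 1 ltr01; have [M hM] := poly_bounded p r.
exists (`|M| + 1) => [|z hz]; first by rewrite addr_ge0.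
have := cmod_rtri (F z) p.[z]; rewrite cmod_dist.
have := hp _ hz; have := hM _ hz; have := ler_norm M; lra.
Qed.

Lemma polylim_poly (p : {poly C}) : polylim (fun z => p.[z]).
Proof. by move=> r e e0; exists p => z _; rewrite subrr cmod0 ltW. Qed.

Lemma polylim_ext F G : F =1 G -> polylim F -> polylim G.
Proof. by move=> FG hF r e e0; have [p hp] := hF r e e0; exists p => z hz; rewrite -FG hp. Qed.

Lemma polylim_lim F : (forall r e : R, 0 < e -> exists2 G, polylim G &
  forall z, cmod z <= r -> cmod (G z - F z) <= e) -> polylim F.
Proof.
move=> hF r e e0; have e20 : 0 < e / 2 by rewrite divr_gt0.
have [G hG GF] := hF r _ e20; have [p hp] := hG r _ e20; exists p => z hz.
apply: le_trans (cmod_tri (G z) _ _) _; have := GF _ hz; have := hp _ hz; lra.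
Qed.

Lemma polylimD F G : polylim F -> polylim G -> polylim (fun z => F z + G z).
Proof.
move=> hF hG r e e0; have e20 : 0 < e / 2 by rewrite divr_gt0.
have [p hp] := hF r _ e20; have [q hq] := hG r _ e20; exists (p + q) => z hz.
have -> : (p + q).[z] - (F z + G z) = (p.[z] - F z) + (q.[z] - G z).
  by rewrite hornerD; ring.
apply: le_trans (cmodD _ _) _; have := hp _ hz; have := hq _ hz; lra.
Qed.

Lemma polylimM F G : polylim F -> polylim G -> polylim (fun z => F z * G z).
Proof.
move=> hF hG r e e0.
have [M M0 hM] := polylim_bounded r hF; have [N N0 hN] := polylim_bounded r hG.
have d0 : 0 < M + N + 1 by lra.
pose e1 := Num.min 1 (e / (M + N + 1)).
have e10 : 0 < e1 by rewrite lt_min ltr01 divr_gt0.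
have [p hp] := hF r _ e10; have [q hq] := hG r _ e10; exists (p * q) => z hz.
have -> : (p * q).[z] - F z * G z = (p.[z] - F z) * G z + (F z + (p.[z] - F z)) * (q.[z] - G z).
  by rewrite hornerM; ring.
apply: le_trans (cmodD _ _) _; rewrite !cmodM.
have h1 := hp _ hz; have h2 := hq _ hz; have h3 := hM _ hz; have h4 := hN _ hz.
have h5 : e1 * (M + N + 1) <= e by rewrite -ler_pdivlMr // /e1 ge_min lexx orbT.
have h6 : e1 <= 1 by rewrite /e1 ge_min lexx.
have p1 : cmod (p.[z] - F z) * cmod (G z) <= e1 * N by apply: ler_pM; rewrite ?cmod_ge0.
have p2 : cmod (F z + (p.[z] - F z)) * cmod (q.[z] - G z) <= (M + 1) * e1.
  apply: ler_pM; rewrite ?cmod_ge0 //; apply: le_trans (cmodD _ _) _; lra.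
lra.
Qed.

Lemma polylim_cst (c : C) : polylim (fun=> c).
Proof. by apply: polylim_ext (polylim_poly c%:P) => z; rewrite hornerC. Qed.

Lemma polylim_id : polylim id.
Proof. by apply: polylim_ext (polylim_poly 'X) => z; rewrite hornerX. Qed.

Lemma polylimMl (c : C) F : polylim F -> polylim (fun z => c * F z).
Proof. exact: polylimM (polylim_cst c). Qed.

Lemma polylimB F G : polylim F -> polylim G -> polylim (fun z => F z - G z).
Proof.
move=> hF hG; apply: polylim_ext (polylimD hF (polylimMl (-1) hG)) => z /=.
by rewrite mulN1r.
Qed.

Lemma polylim_shift F w : polylim F -> polylim (fun z => F (z + w)).
Proof.
move=> hF r e e0; have [p hp] := hF (r + cmod w) e e0.
exists (recenter p w) => z hz; rewrite recenterE [w + z]addrC; apply: hp.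
by apply: le_trans (cmodD _ _) _; rewrite lerD2r.
Qed.

(** [F] is replaced by a polynomial [p], then the exponential by (1 + p / n)^n, which is again a
    polynomial. *)
Lemma polylim_ce F : polylim F -> polylim (fun z => ce (F z)).
Proof.
move=> hF r e e0; have [M M0 hM] := polylim_bounded r hF.
have e20 : 0 < e / 2 by rewrite divr_gt0.
have EM := expR_gt0 M; have E1 := @expR_gt0 R 1; have EM1 := expR_gt0 (M + 1).
pose e1 := Num.min 1 (e / 2 / (expR M * (4 * expR 1))).
have D0 : 0 < expR M * (4 * expR 1) by rewrite !mulr_gt0.
have e10 : 0 < e1 by rewrite lt_min ltr01 divr_gt0.
have [p hp] := hF r _ e10.
have h5 : e1 * (expR M * (4 * expR 1)) <= e / 2 by rewrite -ler_pdivlMr // /e1 ge_min lexx orbT.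
have h6 : e1 <= 1 by rewrite /e1 ge_min lexx.
pose A := 5 * (M + 1) ^+ 2 * expR (M + 1).
have A0 : 0 <= A by apply: mulr_ge0; rewrite ?expR_ge0 //; apply: mulr_ge0; rewrite ?sqr_ge0.
(* Large enough for the hypothesis of [cexp_euler] on values of modulus up to [M + 1], and for its
   error [A / n] to be at most [e / 2]. *)
pose n := Num.truncn (2 * (M + 1) + A / (e / 2)).
have q0 : 0 <= A / (e / 2) by rewrite divr_ge0 // ltW.
have hn : 2 * (M + 1) + A / (e / 2) <= n.+1%:R.
  by rewrite ltW // truncnS_gt.
exists ((1 + p * (n.+1%:R^-1)%:P) ^+ n.+1) => z hz.
rewrite horner_exp !hornerE -[p.[z] / _]/(p.[z] / n.+1%:R).
have h1 := hp _ hz; have h3 := hM _ hz.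
have pM : cmod p.[z] <= M + 1 by have := cmod_rtri p.[z] (F z); lra.
apply: le_trans (cmod_tri (ce p.[z]) _ _) _.
have k1 : cmod ((1 + p.[z] / n.+1%:R) ^+ n.+1 - ce p.[z]) <= e / 2.
  rewrite cmod_dist; apply: le_trans (cexp_euler _) _; first lra.
  rewrite ler_pdivrMr ?ltr0n //; apply: (@le_trans _ _ A); last first.
    by rewrite mulrC -ler_pdivrMr //; apply: le_trans hn; rewrite lerDr; lra.
  have p0 := cmod_ge0 p.[z]; have P0 := expR_ge0 (cmod p.[z]).
  apply: ler_pM; rewrite ?ler_expR //; first by apply: mulr_ge0; rewrite ?sqr_ge0.
  by rewrite ler_pM2l // lerXn2r // nnegrE //; lra.
have k2 : cmod (ce p.[z] - ce (F z)) <= e / 2.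
  apply: le_trans (cexp_dist _ _) _; apply: le_trans h5.
  rewrite [leRHS]mulrCA; apply: ler_pM; rewrite ?expR_ge0 ?ler_expR //.
    by rewrite !mulr_ge0 ?cmod_ge0 ?expR_ge0.
  rewrite [leRHS]mulrCA -mulrA ler_pM2l //; apply: ler_pM; rewrite ?cmod_ge0 ?expR_ge0 //.
  by rewrite ler_expR; lra.
lra.
Qed.

Lemma poly_taylor1_lim F (p : nat -> {poly C}) w D (M : R) :
  (forall z, cmod (z - w) <= 1 -> ccvg (fun n => (p n).[z]) (F z)) ->
  (exists N, forall n, (N <= n)%N -> forall z, cmod (z - w) <= 1 -> cmod (p n).[z] <= M) ->
  ccvg (fun n => (p n)^`().[w]) D ->
  forall h, cmod h <= 2^-1 -> cmod (F (w + h) - F w - h * D) <= 2 * M * cmod h ^+ 2.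
Proof.
move=> hp [N hN] hD h hh.
have c1 : ccvg (fun n => (p n).[w + h]) (F (w + h)).
  by apply: hp; rewrite addrAC subrr add0r; lra.
have c2 : ccvg (fun n => (p n).[w]) (F w) by apply: hp; rewrite subrr cmod0.
have c3 : ccvg (fun n => (p n).[w + h] + (-1) * (p n).[w] + (- h) * (p n)^`().[w])
    (F (w + h) - F w - h * D).
  have -> : F (w + h) - F w - h * D = F (w + h) + (-1) * F w + (- h) * D by ring.
  apply: ccvgD; last exact: ccvgMl.
  by apply: ccvgD => //; apply: ccvgMl.
(* The bound [M] holds only from index [N] on, whereas [ccvg_le] wants it for all terms; hence the
   shifted sequence. *)
have c4 : ccvg (fun n => (p (n + N)%N).[w + h] + (-1) * (p (n + N)%N).[w] +
    (- h) * (p (n + N)%N)^`().[w]) (F (w + h) - F w - h * D).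
  move=> e e0; have [N' hN'] := c3 e e0; exists N' => n Nn.
  by apply: hN'; rewrite (leq_trans Nn) // leq_addr.
apply: ccvg_le c4 _ => n; rewrite mulN1r mulNr.
by apply: poly_taylor1 => // z hz; apply: hN => //; apply: leq_addl.
Qed.

Lemma polylim_taylor1 F w : polylim F -> exists D : C, exists2 M : R, 0 <= M &
  forall h, cmod h <= 2^-1 -> cmod (F (w + h) - F w - h * D) <= M * cmod h ^+ 2.
Proof.
move=> hF; pose r := cmod w + 1.
have en n : 0 < (n.+1%:R^-1 : R) by rewrite invr_gt0 ltr0n.
have /choice[p hp] : forall n, exists p : {poly C}, forall z, cmod z <= r ->
    cmod (p.[z] - F z) <= n.+1%:R^-1 by move=> n; apply: hF.
have zr z : cmod (z - w) <= 1 -> cmod z <= r by move=> ?; have := cmod_rtri z w; rewrite /r; lra.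
have small (e : R) : 0 < e -> exists N, forall n, (N <= n)%N -> (n.+1%:R^-1 : R) <= e.
  move=> e0; exists (Num.truncn e^-1) => n Nn.
  rewrite invf_ple ?posrE ?ltr0n // ltW // (lt_le_trans (truncnS_gt _)) //.
  by rewrite ler_nat ltnS.
have [M M0 hM] := polylim_bounded r hF.
(* The derivative is found as the limit of the derivatives of the approximating polynomials: by
   Cauchy's estimate, uniform closeness on the unit disc around [w] makes these a Cauchy
   sequence. *)
have [D hD] : exists D, ccvg (fun n => (p n)^`().[w]) D.
  apply: ccauchy_cvg => e e0; have e20 : 0 < e / 2 by rewrite divr_gt0.
  have [N hN] := small _ e20; exists N => m n Nm Nn.
  have -> : (p m)^`().[w] - (p n)^`().[w] = (p m - p n)^`().[w] by rewrite derivB !hornerE.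
  apply: poly_deriv_le => z /zr hz; rewrite !hornerE.
  apply: le_trans (cmod_tri (F z) _ _) _; rewrite (cmod_dist (F z)).
  have k1 := le_trans (hp m _ hz) (hN _ Nm).
  have k2 := le_trans (hp n _ hz) (hN _ Nn); lra.
exists D, (2 * (M + 1)) => [|h hh]; first lra.
apply: (poly_taylor1_lim _ _ hD) => // [z /zr hz e e0|].
  have [N hN] := small _ e0; exists N => n Nn.
  exact: le_trans (hp n _ hz) (hN _ Nn).
exists 0%N => n _ z /zr hz; have := cmod_rtri (p n).[z] (F z).
have k1 : (n.+1%:R^-1 : R) <= 1 by rewrite invf_le1 ?ltr0n // ler1n.
have := le_trans (hp n _ hz) k1; have := hM _ hz; lra.
Qed.

Lemma polylim_entire F : polylim F -> @entire R F.
Proof.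
move=> hF w; have [D [M M0 hM]] := polylim_taylor1 w hF.
apply: (@derivable_taylor1 R[i] F w D M%:C%C (2^-1)%:C%C); rewrite ?ltcR ?lecR // => h.
by rewrite -![Num.norm _]/((cmod _)%:C%C) lecR -rmorphXn -rmorphM lecR; apply: hM.
Qed.

(** The threshold [e] depends on neither [F] nor the centre [w], which makes the conclusion uniform
    along a strip. *)
Lemma polylim_three_circles (rho M eta : R) : 1 <= rho -> 0 <= M -> 0 < eta ->
  exists2 e : R, 0 < e & forall F w, polylim F ->
    (forall z, cmod (z - w) <= 1 -> cmod (F z) <= e) ->
    (forall z, cmod (z - w) <= 2 * rho -> cmod (F z) <= M) ->
    forall z, cmod (z - w) <= rho -> cmod (F z) <= eta.
Proof.
move=> rho1 M0 eta0; have eta2 : 0 < eta / 2 by rewrite divr_gt0.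
have M1 : 0 <= M + 1 by lra.
have [e e0 he] := poly_three_circles rho1 M1 eta2.
exists (e / 2) => [|F w hF h1 h2 z hz]; first by rewrite divr_gt0.
pose d := Num.min (e / 2) (Num.min 1 (eta / 2)).
have d0 : 0 < d by rewrite !lt_min ltr01 eta2 divr_gt0.
have [d1 d2 d3] : [/\ d <= e / 2, d <= 1 & d <= eta / 2].
  by rewrite /d; split; rewrite ?ge_min ?lexx ?orbT.
have [p hp] := hF (cmod w + 2 * rho) _ d0.
have hp' t (s : R) : s <= 2 * rho -> cmod (t - w) <= s -> cmod (p.[t] - F t) <= d.
  by move=> hs ht; apply: hp; have := cmod_rtri t w; lra.
have := cmod_rtri (F z) p.[z]; rewrite cmod_dist => h.
have hr : rho <= 2 * rho by lra.
have r1 : 1 <= 2 * rho by lra.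
have hpz := hp' z rho hr hz.
suff : cmod p.[z] <= eta / 2 by lra.
apply: (he p w) => // t ht.
- have := cmod_rtri p.[t] (F t); have := hp' t 1 r1 ht; have := h1 _ ht; lra.
- have := cmod_rtri p.[t] (F t); have := hp' t _ (lexx _) ht; have := h2 _ ht; lra.
Qed.

End PolynomialLimits.

(** * Integrals over the line of functions with quadratic decay *)

Section RapidIntegrals.
Context {R : realType}.
Implicit Types (u v F f : R -> R).

Lemma mean_value F f (x y : R) : x <= y -> (forall t : R, is_derive t (1 : R) F (f t)) ->
  exists2 c, x <= c <= y & F y - F x = f c * (y - x).
Proof.
move=> xy dF; have cF : {within `[x, y], continuous F}.
  apply: continuous_subspaceT => t; apply: differentiable_continuous.
  by apply/derivable1_diffP; apply: ex_derive.
have [c cxy ->] := MVT_segment xy (fun t _ => dF t) cF.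
by exists c => //; move: cxy; rewrite in_itv.
Qed.

Lemma derive_ge0_le F f (x y : R) : x <= y -> (forall t : R, is_derive t (1 : R) F (f t)) ->
  (forall t, x <= t <= y -> 0 <= f t) -> F x <= F y.
Proof.
move=> xy dF f0; have [c cxy h] := mean_value xy dF.
by rewrite -subr_ge0 h mulr_ge0 ?f0 // subr_ge0.
Qed.

Lemma derive0_cst F (x y : R) : (forall t : R, is_derive t (1 : R) F 0) -> F x = F y.
Proof.
move=> dF; wlog xy : x y / x <= y.
  by move=> hw; have [xy|/ltW yx] := leP x y; [exact: hw | rewrite (hw _ _ yx)].
have [c _] := mean_value xy dF; rewrite mul0r => /eqP.
by rewrite subr_eq0 => /eqP.
Qed.

Definition integ u : R := Rintegral (@lebesgue_measure R) setT u.

(** Decay of order 2 is enough both for integrability and for boundary terms at infinity to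
    vanish. *)
Definition rapid u := continuous u /\ exists M : R, forall x, (1 + x ^+ 2) * `|u x| <= M.

Lemma integrable_oneDsqrV : (@lebesgue_measure R).-integrable setT
  (EFin \o (fun x : R => (1 + x ^+ 2)^-1)).
Proof.
have c1 : continuous (fun x : R => (1 + x ^+ 2)^-1).
  by move=> x; apply: (@continuous_oneDsqrV R).
apply/integrableP; split.
  by apply/measurable_EFinP; exact: continuous_measurable_fun.
have p0 (x : R) : 0 < (1 + x ^+ 2)^-1.
  by rewrite invr_gt0; have := sqr_ge0 x; lra.
under eq_integral => x _ do rewrite /= ger0_norm ?(ltW (p0 x)) //.
rewrite ge0_symfun_integralT //.
- rewrite -set_itvcy; have := @integral0y_oneDsqr R; rewrite /oneDsqr => ->.
  by rewrite -EFinM ltry.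
- by move=> x; rewrite ltW.
- by move=> x; rewrite /= sqrrN.
Qed.

Lemma rapid_measurable u : rapid u -> measurable_fun setT u.
Proof. by case=> cu _; exact: continuous_measurable_fun. Qed.

Lemma rapid_integrable u : rapid u ->
  (@lebesgue_measure R).-integrable setT (EFin \o u).
Proof.
move=> ru; have mu := rapid_measurable ru; case: ru => cu [M hM].
have M0 : 0 <= M.
  by apply: le_trans (hM 0); rewrite mulr_ge0 // addr_ge0 // sqr_ge0.
have h := integrableZl measurableT M integrable_oneDsqrV.
apply: le_integrable h => //; first exact/measurable_EFinP.
move=> x _; rewrite /= lee_fin.
have p0 : 0 < 1 + x ^+ 2 by have := sqr_ge0 x; lra.
rewrite [leRHS]ger0_norm ?divr_ge0 //; last exact: ltW.
by rewrite ler_pdivlMr // mulrC.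
Qed.

Lemma rapidD u v : rapid u -> rapid v -> rapid (fun x => u x + v x).
Proof.
move=> [cu [M hM]] [cv [N hN]]; split; first by move=> x; apply: cvgD; [exact: cu|exact: cv].
exists (M + N) => x; apply: le_trans (lerD (hM x) (hN x)); rewrite -mulrDr.
apply: ler_wpM2l; [by have := sqr_ge0 x; lra | exact: ler_normD].
Qed.

Lemma rapidZ (c : R) u : rapid u -> rapid (fun x => c * u x).
Proof.
move=> [cu [M hM]]; split.
  by move=> x; apply: cvgM; [exact: cvg_cst | exact: cu].
exists (`|c| * M) => x; rewrite normrM mulrCA; apply: ler_wpM2l => //; exact: hM.
Qed.

Lemma intD u v : rapid u -> rapid v -> integ (fun x => u x + v x) = integ u + integ v.
Proof. by move=> ru rv; rewrite /integ RintegralD //; exact: rapid_integrable. Qed.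

Lemma intZ (c : R) u : rapid u -> integ (fun x => c * u x) = c * integ u.
Proof. by move=> ru; rewrite /integ RintegralZl //; exact: rapid_integrable. Qed.

Lemma eq_int u v : u =1 v -> integ u = integ v.
Proof. by move=> uv; apply: eq_Rintegral => x _; exact: uv. Qed.

(** Dominated convergence with majorant |u|. It serves to exhaust the line by intervals and to find
    the limits of the Gaussian distribution function at both ends. *)
Lemma set_limit_int u (A : nat -> set R) (B : set R) : rapid u ->
  (forall n, measurable (A n)) -> measurable B ->
  (forall x, exists N, forall n, (N <= n)%N -> (x \in A n) = (x \in B)) ->
  Rintegral (@lebesgue_measure R) (A n) u @[n --> \oo] -->
  Rintegral (@lebesgue_measure R) B u.
Proof.
move=> ru mA mB AB; have iu := rapid_integrable ru.
have key : (\int[@lebesgue_measure R]_x ((u \_ (A n)) x)%:E @[n --> \oo] -->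
    \int[@lebesgue_measure R]_x ((u \_ B) x)%:E)%E.
  apply: (@dominated_cvg _ _ _ (@lebesgue_measure R) setT measurableT
    (fun n x => ((u \_ (A n)) x)%:E) (fun x => ((u \_ B) x)%:E) (fun x => (`|u x|)%:E)) => //.
  - move=> n; apply/measurable_EFinP; apply/(measurable_restrictT _ (mA n)).
    exact: measurable_funS (rapid_measurable ru).
  - move=> x _; have [N hN] := AB x; apply: cvg_near_cst.
    by exists N => // n Nn; rewrite !patchE hN.
  - exact: (integrable_norm iu).
  - move=> n x _; rewrite lee_fin patchE; case: ifP => _ //; by rewrite normr0.
rewrite Rintegral_mkcond.
under eq_fun do rewrite Rintegral_mkcond.
apply: fine_cvg; rewrite fineK; first exact: key.
apply: integrable_fin_num => //.
have -> : (fun x => ((u \_ B) x)%:E) = (EFin \o u) \_ B by rewrite restrict_EFin.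
apply/integrable_restrict => //.
by rewrite setTI; apply: integrableS iu.
Qed.

End RapidIntegrals.

(** * Derivation rules and vanishing of the integral of a derivative *)

Section DerivationRules.
Context {R : realType}.
Implicit Types (f g : R -> R) (x a b : R).

Lemma deriveD_fun f g x a b : is_derive x (1 : R) f a -> is_derive x (1 : R) g b ->
  is_derive x (1 : R) (fun t => f t + g t) (a + b).
Proof. by move=> hf hg; exact: is_deriveD. Qed.

Lemma deriveM_fun f g x a b : is_derive x (1 : R) f a -> is_derive x (1 : R) g b ->
  is_derive x (1 : R) (fun t => f t * g t) (f x * b + g x * a).
Proof. by move=> hf hg; exact: is_deriveM. Qed.

Lemma derive_comp_fun f g x a b : is_derive (g x) (1 : R) f a -> is_derive x (1 : R) g b ->
  is_derive x (1 : R) (fun t => f (g t)) (a * b).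
Proof. by move=> hf hg; exact: (@is_derive1_comp R f g x a b). Qed.

Lemma deriveZ_fun c f x a : is_derive x (1 : R) f a ->
  is_derive x (1 : R) (fun t => c * f t) (c * a).
Proof. by move=> hf; exact: is_deriveZ. Qed.

Lemma derive_linear c x : is_derive x (1 : R) (fun t : R => c * t) c.
Proof. by apply: is_derive_eq (deriveZ_fun c (is_derive_id x 1)) _; rewrite mulr1. Qed.

Lemma derive_cos_linear c x : is_derive x (1 : R) (fun t : R => cos (c * t)) (- c * sin (c * x)).
Proof.
apply: is_derive_eq (derive_comp_fun (is_derive_cos _) (derive_linear c x)) _; ring.
Qed.

Lemma derive_sin_linear c x : is_derive x (1 : R) (fun t : R => sin (c * t)) (c * cos (c * x)).
Proof.
apply: is_derive_eq (derive_comp_fun (is_derive_sin _) (derive_linear c x)) _; ring.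
Qed.

Lemma derive_gauss (al be x : R) :
  is_derive x (1 : R) (fun t => expR (- al * t ^+ 2 - be * t))
    ((- 2 * al * x - be) * expR (- al * x ^+ 2 - be * x)).
Proof.
have h1 : is_derive x (1 : R) (fun t : R => - al * t ^+ 2 - be * t) (- 2 * al * x - be).
  have h2 : is_derive x (1 : R) (fun t : R => t ^+ 2) (2 * x).
    by apply: is_derive_eq (is_deriveX 2 (is_derive_id x 1)) _; rewrite /GRing.scale /= expr1; ring.
  apply: is_derive_eq (deriveD_fun (deriveZ_fun (- al) h2) (is_deriveN (derive_linear be x))) _.
  ring.
apply: is_derive_eq (derive_comp_fun (is_derive_expR _) h1) _; ring.
Qed.

Lemma derive_continuous f (df : R -> R) :
  (forall x : R, is_derive x (1 : R) f (df x)) -> continuous f.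
Proof.
move=> hf x; apply: differentiable_continuous; apply/derivable1_diffP.
exact: ex_derive.
Qed.

(** The fundamental theorem of calculus on [-n, n], where the decay of [f] leaves boundary terms of
    at most M / n. All integrations by parts below rest on this. *)
Lemma int_derive0 f (df : R -> R) : (forall x : R, is_derive x (1 : R) f (df x)) ->
  rapid f -> rapid df -> integ df = 0.
Proof.
move=> hf [cf [M hM]] rdf; have cdf := rdf.1.
have lim1 : Rintegral (@lebesgue_measure R) `[(- n%:R), n%:R] df @[n --> \oo] --> integ df.
  apply: set_limit_int => // x.
  exists (Num.truncn `|x|).+1 => n hn; rewrite in_setT; apply/mem_set.
  rewrite /= in_itv /= -ler_norml ltW // (lt_le_trans (truncnS_gt _)) //.
  by rewrite ler_nat.
have M0 : 0 <= M by apply: le_trans (hM 0); rewrite mulr_ge0 // addr_ge0 // sqr_ge0.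
have fb n : `|f n.+1%:R| <= M / n.+1%:R /\ `|f (- n.+1%:R)| <= M / n.+1%:R.
  have n1 : 1 <= n.+1%:R :> R by rewrite ler1n.
  have n0 : 0 < n.+1%:R :> R by lra.
  have hb (y : R) : y ^+ 2 = n.+1%:R ^+ 2 -> `|f y| <= M / n.+1%:R.
    move=> hy; rewrite ler_pdivlMr // mulrC; apply: le_trans (hM y).
    by apply: ler_wpM2r => //; rewrite hy; nra.
  by split; apply: hb; rewrite ?sqrrN.
have lim2 : Rintegral (@lebesgue_measure R) `[(- n%:R), n%:R] df @[n --> \oo] --> (0 : R).
  apply/cvgrPdist_le => e e0; near=> n; rewrite sub0r normrN.
  have n0 : (0 < n)%N by near: n; exists 1%N.
  have np : 0 < n%:R :> R by rewrite ltr0n.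
  have ab : - n%:R < n%:R :> R by lra.
  rewrite /Rintegral (@continuous_FTC2 _ df f) //; first last.
  - by move=> x _; rewrite derive1E; apply: derive_val.
  - split.
    + by move=> x _; apply: ex_derive.
    + by apply: cvg_at_right_filter; exact: cf.
    + by apply: cvg_at_left_filter; exact: cf.
  - exact: continuous_subspaceT.
  rewrite /=; have [h1 h2] := fb n.-1; rewrite prednK // in h1 h2.
  apply: le_trans (ler_normB _ _) _.
  have : 2 * M / e <= n%:R by near: n; exact: nbhs_infty_ger.
  rewrite ler_pdivrMr // => h3.
  have : M / n%:R <= e / 2 by rewrite ler_pdivrMr //; lra.
  lra.
exact: (cvg_unique (@Rhausdorff R) lim1 lim2).
Unshelve. all: by end_near. Qed.

Definition expdecay f := exists A d : R, 0 < d /\ forall t, `|f t| <= A * expR (- (d * `|t|)).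

Lemma exprn_le_expR (x : R) k : 0 <= x -> x ^+ k <= k`!%:R * expR x.
Proof.
move=> x0; case: k => [|k].
  by rewrite expr0 fact0 mul1r; have := expR_ge1Dx x; lra.
rewrite mulrC -ler_pdivrMr ?ltr0n ?fact_gt0 //; have := expR_ge1Dxn k x0; lra.
Qed.

Lemma expdecay_poly f (p : {poly R}) k : expdecay f ->
  exists M, forall t, `|t ^+ k * (f t * p.[t])| <= M.
Proof.
move=> [A [d [d0 hA]]]; pose c j : R := A * ((k + j)`!%:R / d ^+ (k + j)).
have A0 : 0 <= A.
  by have := hA 0; rewrite normr0 mulr0 oppr0 expR0 mulr1; apply: le_trans.
exists (\sum_(i < size p) `|p`_i| * c i) => t.
rewrite horner_coef !mulr_sumr; apply: le_trans (ler_norm_sum _ _ _) _.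
apply: ler_sum => i _; rewrite !normrM !normrX.
have -> : `|t| ^+ k * (`|f t| * (`|p`_i| * `|t| ^+ i)) = `|p`_i| * (`|f t| * `|t| ^+ (k + i)).
  by rewrite exprD; ring.
apply: ler_wpM2l => //.
apply: (@le_trans _ _ (A * expR (- (d * `|t|)) * `|t| ^+ (k + i))).
  by apply: ler_wpM2r; rewrite ?exprn_ge0.
rewrite /c -mulrA; apply: ler_wpM2l => //.
have := @exprn_le_expR (d * `|t|) (k + i) (mulr_ge0 (ltW d0) (normr_ge0 t)).
rewrite exprMn ler_pdivlMr ?exprn_gt0 // => h.
rewrite -mulrA mulrC [`|t| ^+ _ * _]mulrC expRN.
by rewrite ler_pdivrMr ?expR_gt0.
Qed.

End DerivationRules.

(** * A class of test functions closed under differentiation *)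

Section Waves.
Context {R : realType}.
Variables (K Psi : R -> R) (al be ka : R).
Hypothesis dK : forall x : R, is_derive x (1 : R) K ((- 2 * al * x - be) * K x).
Hypothesis dPsi : forall x : R, is_derive x (1 : R) Psi (ka * K x - be * Psi x).
Hypothesis decK : expdecay K.
Hypothesis decPsi : expdecay Psi.

(** The two profiles solve a triangular linear system: [K] will be a Gaussian with a linear term,
    [Psi] a smoothed half-line exponential. Differentiation therefore acts on the four polynomials
    only, by [wave_p] to [wave_s]; induction gives the Schwartz property, and each choice of
    polynomials in [int_wave0] is an integration by parts. *)
Definition wave (nu : R) (p q r s : {poly R}) (t : R) : R :=
  K t * (p.[t] * cos (nu * t) + q.[t] * sin (nu * t)) +
  Psi t * (r.[t] * cos (nu * t) + s.[t] * sin (nu * t)).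

Definition wave_p nu (p q r : {poly R}) : {poly R} :=
  p^`() - (2 * al) *: ('X * p) - be *: p + nu *: q + ka *: r.
Definition wave_q nu (p q s : {poly R}) : {poly R} :=
  q^`() - (2 * al) *: ('X * q) - be *: q - nu *: p + ka *: s.
Definition wave_r nu (r s : {poly R}) : {poly R} := r^`() - be *: r + nu *: s.
Definition wave_s nu (r s : {poly R}) : {poly R} := s^`() - be *: s - nu *: r.

Lemma derive_wave nu p q r s (x : R) : is_derive x (1 : R) (wave nu p q r s)
  (wave nu (wave_p nu p q r) (wave_q nu p q s) (wave_r nu r s) (wave_s nu r s) x).
Proof.
have hc := derive_cos_linear nu x; have hs := derive_sin_linear nu x.
have hpq (a b : {poly R}) := deriveD_fun (deriveM_fun (is_derive_poly a x) hc)
  (deriveM_fun (is_derive_poly b x) hs).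
apply: is_derive_eq (deriveD_fun (deriveM_fun (dK x) (hpq p q))
  (deriveM_fun (dPsi x) (hpq r s))) _.
rewrite /wave /wave_p /wave_q /wave_r /wave_s !(hornerD, hornerN, hornerZ, hornerM, hornerX); ring.
Qed.

Lemma wave_decay nu p q r s k : exists M, forall t, `|t ^+ k * wave nu p q r s t| <= M.
Proof.
have [M1 h1] := expdecay_poly p k decK; have [M2 h2] := expdecay_poly q k decK.
have [M3 h3] := expdecay_poly r k decPsi; have [M4 h4] := expdecay_poly s k decPsi.
exists (M1 + M2 + (M3 + M4)) => t; rewrite /wave.
have hb (a c M : R) : `|a| <= M -> `|c| <= 1 -> `|a * c| <= M.
  move=> ha hc; rewrite normrM; apply: le_trans ha; rewrite -[leRHS]mulr1.
  by apply: ler_wpM2l.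
have -> : t ^+ k * (K t * (p.[t] * cos (nu * t) + q.[t] * sin (nu * t)) +
  Psi t * (r.[t] * cos (nu * t) + s.[t] * sin (nu * t))) =
  (t ^+ k * (K t * p.[t]) * cos (nu * t) + t ^+ k * (K t * q.[t]) * sin (nu * t)) +
  (t ^+ k * (Psi t * r.[t]) * cos (nu * t) + t ^+ k * (Psi t * s.[t]) * sin (nu * t)) by ring.
do 2![apply: le_trans (ler_normD _ _) _; apply: lerD];
  by apply: hb; rewrite ?h1 ?h2 ?h3 ?h4 ?cos_max ?sin_max.
Qed.

Lemma wave_rapid nu p q r s : rapid (wave nu p q r s).
Proof.
split; first exact: derive_continuous (derive_wave nu p q r s).
have [M hM] := wave_decay nu p q r s 0; have [N hN] := wave_decay nu p q r s 2.
exists (M + N) => x; have := hM x; have := hN x.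
rewrite expr0 mul1r (normrM (x ^+ 2)) (ger0_norm (sqr_ge0 x)); lra.
Qed.

Lemma int_wave0 nu p q r s :
  integ (wave nu (wave_p nu p q r) (wave_q nu p q s) (wave_r nu r s) (wave_s nu r s)) = 0.
Proof. exact: (int_derive0 (derive_wave nu p q r s)) (wave_rapid _ _ _ _ _) (wave_rapid _ _ _ _ _). Qed.

Lemma wave_schwartz nu p q r s : real_schwartz (wave nu p q r s).
Proof.
have hn n : exists p' q' r' s', derive1n n (wave nu p q r s) = wave nu p' q' r' s'.
  elim: n => [|n [p' [q' [r' [s' IH]]]]]; first by exists p, q, r, s.
  exists (wave_p nu p' q' r'), (wave_q nu p' q' s'), (wave_r nu r' s'), (wave_s nu r' s').
  rewrite derive1nS IH; apply/funext => x; rewrite derive1E.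
  by have [_ ->] := derive_wave nu p' q' r' s' x.
split=> [n x|k n]; have [p' [q' [r' [s' ->]]]] := hn n.
  by have [] := derive_wave nu p' q' r' s' x.
exact: wave_decay.
Qed.

End Waves.

(** * The Fourier transform of a Gaussian with a linear term *)

Section Gaussian.
Context {R : realType}.

Definition gaussK (al be t : R) : R := expR (- al * t ^+ 2 - be * t).

(** Completing the square. The rate [B] is free, so the Gaussian can be played against any
    exponential. *)
Lemma gaussK_le (al be B t : R) : 0 < al ->
  gaussK al be t <= expR ((`|be| + B) ^+ 2 / (4 * al)) * expR (- (B * `|t|)).
Proof.
move=> al0; rewrite -expRD ler_expR.
have h1 : - (be * t) <= `|be| * `|t| by rewrite -normrM; apply: ler_normlW; rewrite normrN.
have h2 : - al * t ^+ 2 = - (al * `|t| ^+ 2) by rewrite real_normK ?num_real // mulNr.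
rewrite h2; set u := `|t| in h1 *; set c := `|be| in h1 *.
suff : (c + B) * u <= (c + B) ^+ 2 / (4 * al) + al * u ^+ 2 by lra.
rewrite -subr_ge0.
have -> : (c + B) ^+ 2 / (4 * al) + al * u ^+ 2 - (c + B) * u =
  al * (u - (c + B) / (2 * al)) ^+ 2 by field; lra.
by rewrite mulr_ge0 ?sqr_ge0 // ltW.
Qed.

Lemma gaussK_decay (al be : R) : 0 < al -> expdecay (gaussK al be).
Proof.
move=> al0; exists (expR ((`|be| + 1) ^+ 2 / (4 * al))), 1; split=> // t.
by rewrite ger0_norm ?expR_ge0 //; apply: gaussK_le.
Qed.

Lemma derive_gaussK (al be x : R) :
  is_derive x (1 : R) (gaussK al be) ((- 2 * al * x - be) * gaussK al be x).
Proof. exact: derive_gauss. Qed.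

Lemma zero_decay : expdecay (fun _ : R => 0 : R).
Proof. by exists 0, 1; split=> // t; rewrite normr0 mul0r. Qed.

(** The zero profile in the shape required of [Psi] with [ka = 0]: pure Gaussians become waves. *)
Lemma derive_zero (al be x : R) :
  is_derive x (1 : R) (fun _ : R => 0 : R) (0 * gaussK al be x - be * 0).
Proof. by apply: is_derive_eq (is_derive_cst _ _ _) _; ring. Qed.

Definition gwave (al be : R) := wave (gaussK al be) (fun=> 0).

Lemma gwave_rapid (al be nu : R) p q : 0 < al -> rapid (gwave al be nu p q 0 0).
Proof.
move=> al0; apply: (wave_rapid (derive_gaussK al be) (derive_zero al be)).
  exact: gaussK_decay.
exact: zero_decay.
Qed.

Lemma int_gaussK (al be : R) : 0 < al ->
  integ (gaussK al be) = Num.sqrt (pi / al) * expR (be ^+ 2 / (4 * al)).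
Proof.
(* Completing the square turns [gaussK] into a multiple of the normal density of mean [m] and
   standard deviation [s]. *)
move=> al0; pose s : R := (Num.sqrt (2 * al))^-1; pose m := - be / (2 * al).
have s2al : Num.sqrt (2 * al) != 0 by rewrite sqrtr_eq0 -ltNge mulr_gt0.
have s0 : s != 0 by rewrite invr_eq0.
have ss : s ^+ 2 *+ 2 = al^-1.
  by rewrite /s exprVn sqr_sqrtr ?mulr_ge0 ?(ltW al0) // -mulr_natl; field; lra.
have peakE : normal_peak s = (Num.sqrt (pi / al))^-1.
  by rewrite /normal_peak -mulrnAl ss mulrC.
have pa0 : 0 < Num.sqrt (pi / al) by rewrite sqrtr_gt0 divr_gt0 ?pi_gt0.
have KE x : gaussK al be x =
    Num.sqrt (pi / al) * expR (be ^+ 2 / (4 * al)) * normal_pdf m s x.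
  rewrite /normal_pdf (negPf s0) peakE mulrAC mulrA mulfV ?gt_eqF // mul1r /normal_fun ss invrK.
  rewrite mulrC -expRD; congr expR; rewrite /m; field; lra.
rewrite (eq_int KE) /integ RintegralZl //; last exact: integrable_normal_pdf.
by rewrite /Rintegral integral_normal_pdf /= mulr1.
Qed.

Section Transform.
Variables (al be : R).
Hypothesis al0 : 0 < al.
Local Notation K := (gaussK al be).

Definition gcos nu := integ (fun t => K t * cos (nu * t)).
Definition gsin nu := integ (fun t => K t * sin (nu * t)).
Definition gtcos nu := integ (fun t => K t * (t * cos (nu * t))).
Definition gtsin nu := integ (fun t => K t * (t * sin (nu * t))).

Lemma hornerC1 (t : R) : (1 : {poly R}).[t] = 1.
Proof. by rewrite -polyC1 hornerC. Qed.

Lemma rapid_ext (u v : R -> R) : u =1 v -> rapid u -> rapid v.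
Proof. by move=> /funext ->. Qed.

Lemma rapid_gcos nu : rapid (fun t => K t * cos (nu * t)).
Proof. by apply: rapid_ext (gwave_rapid be nu 1 0 al0) => t; rewrite /gwave /wave !(hornerC1, horner0, hornerX); ring. Qed.
Lemma rapid_gsin nu : rapid (fun t => K t * sin (nu * t)).
Proof. by apply: rapid_ext (gwave_rapid be nu 0 1 al0) => t; rewrite /gwave /wave !(hornerC1, horner0, hornerX); ring. Qed.
Lemma rapid_gtcos nu : rapid (fun t => K t * (t * cos (nu * t))).
Proof. by apply: rapid_ext (gwave_rapid be nu 'X 0 al0) => t; rewrite /gwave /wave !(hornerC1, horner0, hornerX); ring. Qed.
Lemma rapid_gtsin nu : rapid (fun t => K t * (t * sin (nu * t))).
Proof. by apply: rapid_ext (gwave_rapid be nu 0 'X al0) => t; rewrite /gwave /wave !(hornerC1, horner0, hornerX); ring. Qed.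

Lemma int_gwave0 nu (p q : {poly R}) :
  integ (gwave al be nu (wave_p al be 0 nu p q 0) (wave_q al be 0 nu p q 0) 0 0) = 0.
Proof.
have := int_wave0 (derive_gaussK al be) (derive_zero al be) (gaussK_decay be al0)
  zero_decay nu p q 0 0.
by rewrite /wave_r /wave_s !scaler0 deriv0 !subr0 addr0.
Qed.

(** The derivative of [K t * sin (nu * t)] has integral zero. With [gtcosE], this turns
    differentiation in [nu] into a linear differential system for [gcos] and [gsin], so that no
    shift of contour is needed to compute the transform. *)
Lemma gtsinE nu : gtsin nu = (nu * gcos nu - be * gsin nu) / (2 * al).
Proof.
have := int_gwave0 nu 0 1.
rewrite (@eq_int _ _ (fun t => - (2 * al) * (K t * (t * sin (nu * t))) +
  ((- be) * (K t * sin (nu * t)) + nu * (K t * cos (nu * t))))); last first.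
  move=> t; rewrite /gwave /wave /wave_p /wave_q.
  rewrite !(hornerD, hornerN, hornerZ, hornerM, hornerX, horner0, deriv0, derivC, hornerC, hornerC1); ring.
rewrite intD; [|exact: rapidZ (rapid_gtsin nu)|]; last first.
  by apply: rapidD; apply: rapidZ; [exact: rapid_gsin|exact: rapid_gcos].
rewrite intD; [|exact: rapidZ (rapid_gsin nu)|exact: rapidZ (rapid_gcos nu)].
rewrite (intZ _ (rapid_gtsin nu)) (intZ _ (rapid_gsin nu)) (intZ _ (rapid_gcos nu)).
rewrite -/(gtsin nu) -/(gsin nu) -/(gcos nu) => h.
apply: (@mulfI _ (2 * al)); first by rewrite gt_eqF // mulr_gt0.
rewrite mulrC [RHS]mulrC divfK ?gt_eqF ?mulr_gt0 //; lra.
Qed.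

Lemma gtcosE nu : gtcos nu = - (be * gcos nu + nu * gsin nu) / (2 * al).
Proof.
have := int_gwave0 nu 1 0.
rewrite (@eq_int _ _ (fun t => - (2 * al) * (K t * (t * cos (nu * t))) +
  ((- be) * (K t * cos (nu * t)) + (- nu) * (K t * sin (nu * t))))); last first.
  move=> t; rewrite /gwave /wave /wave_p /wave_q.
  rewrite !(hornerD, hornerN, hornerZ, hornerM, hornerX, horner0, deriv0, derivC, hornerC, hornerC1); ring.
rewrite intD; [|exact: rapidZ (rapid_gtcos nu)|]; last first.
  by apply: rapidD; apply: rapidZ; [exact: rapid_gcos|exact: rapid_gsin].
rewrite intD; [|exact: rapidZ (rapid_gcos nu)|exact: rapidZ (rapid_gsin nu)].
rewrite (intZ _ (rapid_gtcos nu)) (intZ _ (rapid_gsin nu)) (intZ _ (rapid_gcos nu)).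
rewrite -/(gtcos nu) -/(gsin nu) -/(gcos nu) => h.
apply: (@mulfI _ (2 * al)); first by rewrite gt_eqF // mulr_gt0.
rewrite mulrC [RHS]mulrC divfK ?gt_eqF ?mulr_gt0 //; lra.
Qed.

Lemma rapid_tK : rapid (fun t => K t * `|t|).
Proof.
split.
  move=> t; apply: cvgM; last exact: norm_continuous.
  exact: (derive_continuous (derive_gaussK al be)).
have [M hM] := expdecay_poly 'X 0 (gaussK_decay be al0).
have [N hN] := expdecay_poly 'X 2 (gaussK_decay be al0).
exists (M + N) => t; have := hM t; have := hN t; rewrite hornerX expr0 mul1r.
rewrite (normrM (t ^+ 2)) (ger0_norm (sqr_ge0 t)).
by rewrite !normrM normr_id; lra.
Qed.

(** Differentiation under the integral sign, with the majorant [K y * |y|], which does not depend on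
    the frequency. *)
Lemma derive_gcos nu : is_derive nu (1 : R) gcos (- gtsin nu).
Proof.
have hd (x y : R) : is_derive x (1 : R) (fun x => K y * cos (x * y)) (- (K y * (y * sin (x * y)))).
  have h1 := deriveZ_fun (K y) (derive_cos_linear y x).
  have -> : (fun x => K y * cos (x * y)) = (fun x => K y * cos (y * x)).
    by apply/funext => t; rewrite mulrC [y * _]mulrC mulrC.
  by apply: is_derive_eq h1 _; rewrite [x * y]mulrC; ring.
have I0 : `](nu - 1), (nu + 1)[%classic nu by rewrite /= in_itv /=; apply/andP; split; lra.
have h := @derivable_under_integral R _ _ (@lebesgue_measure R)
  (fun x y => K y * cos (x * y)) setT measurableT nu (nu - 1) (nu + 1) I0.
have h' := @differentiation_under_integral R _ _ (@lebesgue_measure R)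
  (fun x y => K y * cos (x * y)) setT measurableT nu (nu - 1) (nu + 1) I0.
have i1 (x : R) : `](nu - 1), (nu + 1)[%classic x ->
    (@lebesgue_measure R).-integrable setT (EFin \o (fun y => K y * cos (x * y))).
  by move=> _; exact: rapid_integrable (rapid_gcos x).
have d1 (x y : R) : `](nu - 1), (nu + 1)[%classic x -> setT y ->
    derivable (fun x : R => K y * cos (x * y)) x (1 : R) by move=> _ _; have [] := hd x y.
have d1E (x y : R) : partial1of2 (fun x y => K y * cos (x * y)) x y = - (K y * (y * sin (x * y))).
  by rewrite partial1of2E; have [_ ->] := hd x y.
have g0 y : 0 <= K y * `|y| by rewrite mulr_ge0 ?expR_ge0.
have gb (x y : R) : `](nu - 1), (nu + 1)[%classic x -> setT y ->
    `|partial1of2 (fun x y => K y * cos (x * y)) x y| <= K y * `|y|.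
  move=> _ _; rewrite d1E normrN !normrM ger0_norm ?expR_ge0 //.
  by apply: ler_wpM2l; rewrite ?expR_ge0 // -[leRHS]mulr1 ler_wpM2l // sin_max.
apply: DeriveDef; first exact: (h i1 d1 _ g0 (rapid_integrable rapid_tK) gb).
rewrite -derive1E; have := h' i1 d1 _ g0 (rapid_integrable rapid_tK) gb.
move=> ->; rewrite /gtsin -mulN1r -(intZ _ (rapid_gtsin nu)).
by apply: eq_Rintegral => y _; rewrite d1E mulN1r.
Qed.

Lemma derive_gsin nu : is_derive nu (1 : R) gsin (gtcos nu).
Proof.
have hd (x y : R) : is_derive x (1 : R) (fun x => K y * sin (x * y)) (K y * (y * cos (x * y))).
  have h1 := deriveZ_fun (K y) (derive_sin_linear y x).
  have -> : (fun x => K y * sin (x * y)) = (fun x => K y * sin (y * x)).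
    by apply/funext => t; rewrite mulrC [y * _]mulrC mulrC.
  by apply: is_derive_eq h1 _; rewrite [x * y]mulrC; ring.
have I0 : `](nu - 1), (nu + 1)[%classic nu by rewrite /= in_itv /=; apply/andP; split; lra.
have h := @derivable_under_integral R _ _ (@lebesgue_measure R)
  (fun x y => K y * sin (x * y)) setT measurableT nu (nu - 1) (nu + 1) I0.
have h' := @differentiation_under_integral R _ _ (@lebesgue_measure R)
  (fun x y => K y * sin (x * y)) setT measurableT nu (nu - 1) (nu + 1) I0.
have i1 (x : R) : `](nu - 1), (nu + 1)[%classic x ->
    (@lebesgue_measure R).-integrable setT (EFin \o (fun y => K y * sin (x * y))).
  by move=> _; exact: rapid_integrable (rapid_gsin x).
have d1 (x y : R) : `](nu - 1), (nu + 1)[%classic x -> setT y ->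
    derivable (fun x : R => K y * sin (x * y)) x (1 : R) by move=> _ _; have [] := hd x y.
have d1E (x y : R) : partial1of2 (fun x y => K y * sin (x * y)) x y = K y * (y * cos (x * y)).
  by rewrite partial1of2E; have [_ ->] := hd x y.
have g0 y : 0 <= K y * `|y| by rewrite mulr_ge0 ?expR_ge0.
have gb (x y : R) : `](nu - 1), (nu + 1)[%classic x -> setT y ->
    `|partial1of2 (fun x y => K y * sin (x * y)) x y| <= K y * `|y|.
  move=> _ _; rewrite d1E !normrM ger0_norm ?expR_ge0 //.
  by apply: ler_wpM2l; rewrite ?expR_ge0 // -[leRHS]mulr1 ler_wpM2l // cos_max.
apply: DeriveDef; first exact: (h i1 d1 _ g0 (rapid_integrable rapid_tK) gb).
rewrite -derive1E; have := h' i1 d1 _ g0 (rapid_integrable rapid_tK) gb.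
move=> ->; by apply: eq_Rintegral => y _; rewrite d1E.
Qed.

(* The rotated and rescaled integrals have derivative zero in nu. *)
Lemma gauss_transform nu :
  gcos nu = Num.sqrt (pi / al) * expR ((be ^+ 2 - nu ^+ 2) / (4 * al)) * cos (be / (2 * al) * nu) /\
  gsin nu = - (Num.sqrt (pi / al) * expR ((be ^+ 2 - nu ^+ 2) / (4 * al)) * sin (be / (2 * al) * nu)).
Proof.
have a1 : al != 0 by rewrite gt_eqF.
pose th := be / (2 * al).
(* This is exp (x^2 / (4 al)), written with a negative first parameter so that [derive_gauss]
   applies. *)
pose E (x : R) := expR (- (- (4 * al)^-1) * x ^+ 2 - 0 * x).
pose P x := E x * (gcos x * cos (th * x) + (-1) * (gsin x * sin (th * x))).
pose Q x := E x * (gcos x * sin (th * x) + gsin x * cos (th * x)).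
have dE x := derive_gauss (- (4 * al)^-1) 0 x.
have dP x : is_derive x (1 : R) P 0.
  apply: is_derive_eq (deriveM_fun (dE x) (deriveD_fun
    (deriveM_fun (derive_gcos x) (derive_cos_linear th x))
    (deriveZ_fun (-1) (deriveM_fun (derive_gsin x) (derive_sin_linear th x))))) _.
  by rewrite gtsinE gtcosE /th; field.
have dQ x : is_derive x (1 : R) Q 0.
  apply: is_derive_eq (deriveM_fun (dE x) (deriveD_fun
    (deriveM_fun (derive_gcos x) (derive_sin_linear th x))
    (deriveM_fun (derive_gsin x) (derive_cos_linear th x)))) _.
  by rewrite gtsinE gtcosE /th; field.
have E0 : E 0 = 1 by rewrite /E expr0n mulr0 mul0r subr0 expR0.
have P0 : P nu = Num.sqrt (pi / al) * expR (be ^+ 2 / (4 * al)).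
  rewrite (derive0_cst nu 0 dP) /P E0 mulr0 cos0 sin0 !mulr0 mulr1 addr0 mul1r -int_gaussK //.
  by apply: eq_int => t; rewrite mul0r cos0 mulr1.
have Q0 : Q nu = 0.
  rewrite (derive0_cst nu 0 dQ) /Q E0 mulr0 cos0 sin0 mulr0 mul1r add0r mulr1.
  rewrite /gsin (eq_int (v := fun t => 0 * K t)) => [|t]; last by rewrite mul0r sin0 mulr0 mul0r.
  rewrite intZ ?mul0r //; apply: rapid_ext (rapid_gcos 0) => t.
  by rewrite mul0r cos0 mulr1.
have cs := cos2Dsin2 (th * nu).
have EE : expR ((be ^+ 2 - nu ^+ 2) / (4 * al)) * E nu = expR (be ^+ 2 / (4 * al)).
  by rewrite /E -expRD; congr expR; field.
have En : E nu != 0 by rewrite expR_eq0.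
have gc : E nu * gcos nu = P nu * cos (th * nu) + Q nu * sin (th * nu).
  rewrite /P /Q; transitivity (E nu * gcos nu * (cos (th * nu) ^+ 2 + sin (th * nu) ^+ 2)); last ring.
  by rewrite cs mulr1.
have gs : E nu * gsin nu = Q nu * cos (th * nu) - P nu * sin (th * nu).
  rewrite /P /Q; transitivity (E nu * gsin nu * (cos (th * nu) ^+ 2 + sin (th * nu) ^+ 2)); last ring.
  by rewrite cs mulr1.
split; apply: (mulfI En).
  by rewrite gc P0 Q0 mul0r addr0 -EE; ring.
by rewrite gs P0 Q0 mul0r sub0r -EE; ring.
Qed.

End Transform.
End Gaussian.

(** * The smoothed half-line and the two families of test functions *)

Section GaussianPrimitive.
Context {R : realType}.
Local Notation mu := (@lebesgue_measure R).

Definition gauss (t : R) : R := gaussK pi 0 t.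

Lemma gaussE t : gauss t = expR (- (pi * t ^+ 2)).
Proof. by rewrite /gauss /gaussK mul0r subr0 mulNr. Qed.

Lemma gauss_ge0 t : 0 <= gauss t. Proof. exact: expR_ge0. Qed.

Lemma rapid_gauss : rapid gauss.
Proof.
apply: rapid_ext (rapid_gcos 0 (pi_gt0 R) 0) => t.
by rewrite mul0r cos0 mulr1.
Qed.

Lemma int_gauss : integ gauss = 1.
Proof.
by rewrite (int_gaussK 0 (pi_gt0 R)) mulfV ?gt_eqF ?pi_gt0 // sqrtr1 expr0n mul0r expR0 mulr1.
Qed.

(** The Gaussian distribution function: [gcdf (t / sg)] is a smooth substitute for the indicator of
    t > 0, which it approaches as [sg] tends to 0. *)
Definition gcdf (x : R) : R := Rintegral mu `]-oo, x] gauss.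

Lemma derive_gcdf x : is_derive x (1 : R) gcdf (gauss x).
Proof.
have ig := rapid_integrable rapid_gauss.
have x1 : x < x + 1 by lra.
have iu : mu.-integrable [set` Interval -oo%O (BRight (x + 1))] (EFin \o gauss).
  by apply: integrableS ig.
have [h1 h2] := continuous_FTC1 x1 iu (ltNyr x) (rapid_gauss.1 x).
by apply: DeriveDef; [exact: h1 | rewrite -derive1E h2].
Qed.

Lemma gcdf_le x y : x <= y -> gcdf x <= gcdf y.
Proof.
by move=> xy; apply: (derive_ge0_le xy derive_gcdf) => t _; exact: gauss_ge0.
Qed.

Lemma cvg_gcdfNy : gcdf (- n%:R) @[n --> \oo] --> (0 : R).
Proof.
have <- : Rintegral mu set0 gauss = 0 by rewrite Rintegral_set0.
apply: set_limit_int => //; first exact: rapid_gauss.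
move=> x; exists (Num.truncn `|x|).+1 => n hn; rewrite in_set0.
apply/negbTE; rewrite notin_setE /= in_itv /= => hx.
have : `|x| < n%:R by rewrite (lt_le_trans (truncnS_gt _)) // ler_nat.
by have := ler_norm (- x); rewrite normrN; lra.
Qed.

Lemma cvg_gcdfy : gcdf n%:R @[n --> \oo] --> (1 : R).
Proof.
suff : gcdf n%:R @[n --> \oo] --> integ gauss by rewrite int_gauss.
apply: set_limit_int => //; first exact: rapid_gauss.
move=> x; exists (Num.truncn `|x|).+1 => n hn; rewrite in_setT; apply/mem_set.
rewrite /= in_itv /=.
have : `|x| < n%:R by rewrite (lt_le_trans (truncnS_gt _)) // ler_nat.
by move=> h; exact: le_trans (ler_norm x) (ltW h).
Qed.

Lemma gcdf_ge0 x : 0 <= gcdf x.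
Proof.
by apply: Rintegral_ge0 => t _; exact: gauss_ge0.
Qed.

Lemma gcdf_le1 x : gcdf x <= 1.
Proof.
apply: (cvgr_to_ge cvg_gcdfy); near=> n; apply: gcdf_le.
by near: n; exact: nbhs_infty_ger.
Unshelve. all: by end_near. Qed.

Lemma gauss_le (B t : R) : 0 <= B ->
  gauss t <= expR (B ^+ 2 / (4 * pi)) * expR (- (B * `|t|)).
Proof. by move=> B0; have := gaussK_le 0 B t (pi_gt0 R); rewrite normr0 add0r. Qed.

Lemma derive_exp_linear (A B x : R) : is_derive x (1 : R) (fun t => A * expR (B * t)) (A * B * expR (B * x)).
Proof.
apply: is_derive_eq (deriveZ_fun A (derive_comp_fun (is_derive_expR _) (derive_linear B x))) _.
ring.
Qed.

(** Comparison of derivatives shows that [A * expR (B * t) - gcdf t] increases for t <= 0, and the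
    limit of [gcdf] at minus infinity is 0. Every rate [B] is needed, because the step will be
    multiplied by an exponential that grows on the negative side. *)
Lemma gcdf_tailN (B : R) : 0 < B -> exists2 A : R, 0 <= A &
  forall x, x <= 0 -> gcdf x <= A * expR (B * x).
Proof.
move=> B0; exists (expR (B ^+ 2 / (4 * pi)) / B) => [|x x0].
  by rewrite divr_ge0 ?expR_ge0 // ltW.
set A := _ / B.
have dD t := deriveD_fun (derive_exp_linear A B t) (deriveZ_fun (-1) (derive_gcdf t)).
have A0 : 0 <= A by rewrite divr_ge0 ?expR_ge0 // ltW.
have key t : t <= x -> A * expR (B * t) - gcdf t <= A * expR (B * x) - gcdf x.
  move=> tx; have := derive_ge0_le tx dD; rewrite !mulN1r; apply => s /andP[_ sx].
  have := gauss_le s (ltW B0); rewrite ler0_norm; last by lra.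
  by rewrite /A divfK ?gt_eqF // mulrN opprK mulN1r; lra.
rewrite -subr_ge0.
have h : - gcdf (- n%:R) @[n --> \oo] --> (- 0 : R) by apply: cvgN; exact: cvg_gcdfNy.
rewrite oppr0 in h; apply: (cvgr_to_le h); near=> n.
have nx : - n%:R <= x by rewrite lerNl; near: n; exact: nbhs_infty_ger.
have := key _ nx; have := mulr_ge0 A0 (expR_ge0 (B * - n%:R)); lra.
Unshelve. all: by end_near. Qed.

Lemma gcdf_tailP (B : R) : 0 < B -> exists2 A : R, 0 <= A &
  forall x, 0 <= x -> 1 - gcdf x <= A * expR (- (B * x)).
Proof.
move=> B0; exists (expR (B ^+ 2 / (4 * pi)) / B) => [|x x0].
  by rewrite divr_ge0 ?expR_ge0 // ltW.
set A := _ / B.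
have dD t := deriveD_fun (derive_exp_linear A (- B) t) (derive_gcdf t).
have A0 : 0 <= A by rewrite divr_ge0 ?expR_ge0 // ltW.
have key t : x <= t -> A * expR (- B * t) + gcdf t <= A * expR (- B * x) + gcdf x.
  move=> xt; rewrite -lerN2.
  have dN s := deriveZ_fun (-1) (dD s).
  have := derive_ge0_le xt dN; rewrite !mulN1r; apply => s /andP[sx _].
  have := gauss_le s (ltW B0); rewrite ger0_norm; last by lra.
  by rewrite mulrN mulNr /A divfK ?gt_eqF // !mulNr; lra.
rewrite lerBlDr -mulNr.
apply: (cvgr_to_le cvg_gcdfy); near=> n.
have nx : x <= n%:R by near: n; exact: nbhs_infty_ger.
have := key _ nx; have := mulr_ge0 A0 (expR_ge0 (- B * n%:R)); lra.
Unshelve. all: by end_near. Qed.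

(** [sg] is a width on the spectral side; the transform is a bump of total mass 1 and width of order
    1 / sg around [x]. *)
Definition test_gauss (sg x t : R) : R[i] :=
  ((gaussK (pi / sg ^+ 2) 0 t * cos (2 * pi * x * t)) +i*
   (gaussK (pi / sg ^+ 2) 0 t * sin (2 * pi * x * t)))%C.

Definition step (sg be t : R) : R := gcdf (sg^-1 * t) * expR (- be * t).

Definition test_step (sg x y t : R) : R[i] :=
  ((step sg (2 * pi * y) t * cos (2 * pi * x * t)) +i*
   (step sg (2 * pi * y) t * sin (2 * pi * x * t)))%C.

Lemma test_gauss_schwartz sg x : 0 < sg -> @schwartz R (test_gauss sg x).
Proof.
move=> sg0; have al0 : 0 < pi / sg ^+ 2 by rewrite divr_gt0 ?pi_gt0 // exprn_gt0.
have h p q := wave_schwartz (derive_gaussK (pi / sg ^+ 2) 0) (derive_zero (pi / sg ^+ 2) 0)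
  (gaussK_decay 0 al0) zero_decay (2 * pi * x) p q 0 0.
split; [move: (h 1 0) | move: (h 0 1)]; congr real_schwartz;
  by apply/funext => t; rewrite /wave /= !(hornerC1, horner0); ring.
Qed.

Section Step.
Variables (sg be : R).
Hypotheses (sg0 : 0 < sg) (be0 : 0 < be).
Local Notation K := (gaussK (pi / sg ^+ 2) be).

Let al0 : 0 < pi / sg ^+ 2.
Proof. by rewrite divr_gt0 ?pi_gt0 // exprn_gt0. Qed.

Lemma derive_step t : is_derive t (1 : R) (step sg be) (sg^-1 * K t - be * step sg be t).
Proof.
have he : is_derive t (1 : R) (fun t => expR (- be * t)) (- be * expR (- be * t)).
  have := derive_exp_linear 1 (- be) t; rewrite mul1r.
  by have -> : (fun t => 1 * expR (- be * t)) = (fun t => expR (- be * t))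
    by apply/funext => s; rewrite mul1r.
apply: is_derive_eq (deriveM_fun (derive_comp_fun (derive_gcdf _) (derive_linear sg^-1 t)) he) _.
have -> : K t = gauss (sg^-1 * t) * expR (- be * t).
  rewrite gaussE -expRD /gaussK; congr expR; field; rewrite ?gt_eqF ?pi_gt0 //.
by rewrite /step; ring.
Qed.

Lemma step_decay : expdecay (step sg be).
Proof.
(* With this rate, the tail at t / sg is a multiple of e^(2 be t), which beats e^(- be t) for t < 0
   and leaves e^(be t). *)
have B0 : 0 < 2 * be * sg by rewrite !mulr_gt0.
have [A A0 hA] := gcdf_tailN B0.
exists (A + 1), be; split=> // t.
rewrite ger0_norm; last by rewrite mulr_ge0 ?gcdf_ge0 ?expR_ge0.
rewrite /step; have [t0|t0] := leP 0 t.
  rewrite ger0_norm // mulNr; apply: ler_wpM2r; first exact: expR_ge0.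
  by have := gcdf_le1 (sg^-1 * t); lra.
rewrite ltr0_norm // mulrN opprK.
have st : sg^-1 * t <= 0 by rewrite mulr_ge0_le0 // ?invr_ge0 ltW.
apply: (@le_trans _ _ (A * expR (2 * be * sg * (sg^-1 * t)) * expR (- be * t))).
  by apply: ler_wpM2r; [exact: expR_ge0 | exact: hA].
rewrite -mulrA -expRD.
have -> : 2 * be * sg * (sg^-1 * t) + - be * t = be * t by field; rewrite gt_eqF.
by apply: ler_wpM2r; [exact: expR_ge0 | lra].
Qed.

Definition swave nu p q r s := wave K (step sg be) nu p q r s.

Lemma swave_rapid nu p q r s : rapid (swave nu p q r s).
Proof.
exact: (wave_rapid (derive_gaussK _ be) derive_step (gaussK_decay be al0) step_decay).
Qed.

Lemma int_swave0 nu p q r s : integ (swave nu (wave_p (pi / sg ^+ 2) be sg^-1 nu p q r)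
  (wave_q (pi / sg ^+ 2) be sg^-1 nu p q s) (wave_r be nu r s) (wave_s be nu r s)) = 0.
Proof.
exact: (int_wave0 (derive_gaussK _ be) derive_step (gaussK_decay be al0) step_decay).
Qed.

Lemma rapid_scos nu : rapid (fun t => step sg be t * cos (nu * t)).
Proof.
apply: rapid_ext (swave_rapid nu 0 0 1 0) => t.
by rewrite /swave /wave !(hornerC1, horner0); ring.
Qed.

Lemma rapid_ssin nu : rapid (fun t => step sg be t * sin (nu * t)).
Proof.
apply: rapid_ext (swave_rapid nu 0 0 0 1) => t.
by rewrite /swave /wave !(hornerC1, horner0); ring.
Qed.

Definition scos nu := integ (fun t => step sg be t * cos (nu * t)).
Definition ssin nu := integ (fun t => step sg be t * sin (nu * t)).

(** Together with [step_parts_sin], the real and imaginary parts of (be - i nu) S = G / sg, where S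
    = scos + i ssin and G = gcos + i gsin: the derivative of the step times the oscillation has
    integral zero. *)
Lemma step_parts_cos nu :
  be * scos nu + nu * ssin nu = sg^-1 * gcos (pi / sg ^+ 2) be nu.
Proof.
have := int_swave0 nu 0 0 1 0.
rewrite (@eq_int _ _ (fun t => sg^-1 * (K t * cos (nu * t)) +
  ((- be) * (step sg be t * cos (nu * t)) + (- nu) * (step sg be t * sin (nu * t))))); last first.
  move=> t; rewrite /swave /wave /wave_p /wave_q /wave_r /wave_s.
  rewrite !(hornerD, hornerN, hornerZ, hornerM, hornerX, horner0, deriv0, derivC, hornerC, hornerC1); ring.
have r1 := rapid_gcos be al0 nu; have r2 := rapid_scos nu; have r3 := rapid_ssin nu.
rewrite intD; [|exact: rapidZ|by apply: rapidD; apply: rapidZ].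
rewrite intD; [|exact: rapidZ|exact: rapidZ].
rewrite !intZ // -/(scos nu) -/(ssin nu) -/(gcos _ _ nu); lra.
Qed.

Lemma step_parts_sin nu :
  be * ssin nu - nu * scos nu = sg^-1 * gsin (pi / sg ^+ 2) be nu.
Proof.
have := int_swave0 nu 0 0 0 1.
rewrite (@eq_int _ _ (fun t => sg^-1 * (K t * sin (nu * t)) +
  ((- be) * (step sg be t * sin (nu * t)) + nu * (step sg be t * cos (nu * t))))); last first.
  move=> t; rewrite /swave /wave /wave_p /wave_q /wave_r /wave_s.
  rewrite !(hornerD, hornerN, hornerZ, hornerM, hornerX, horner0, deriv0, derivC, hornerC, hornerC1); ring.
have r1 := rapid_gsin be al0 nu; have r2 := rapid_scos nu; have r3 := rapid_ssin nu.
rewrite intD; [|exact: rapidZ|by apply: rapidD; apply: rapidZ].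
rewrite intD; [|exact: rapidZ|exact: rapidZ].
rewrite !intZ // -/(scos nu) -/(ssin nu) -/(gsin _ _ nu); lra.
Qed.

End Step.

Lemma test_step_schwartz sg x y : 0 < sg -> 0 < y -> @schwartz R (test_step sg x y).
Proof.
move=> sg0 y0; have al0 : 0 < pi / sg ^+ 2 by rewrite divr_gt0 ?pi_gt0 // exprn_gt0.
have be0 : 0 < 2 * pi * y by rewrite !mulr_gt0 ?pi_gt0.
have h r s := wave_schwartz (derive_gaussK (pi / sg ^+ 2) (2 * pi * y)) (derive_step (2 * pi * y) sg0)
  (gaussK_decay (2 * pi * y) al0) (step_decay sg0 be0) (2 * pi * x) 0 0 r s.
split; [move: (h 1 0) | move: (h 0 1)]; congr real_schwartz;
  by apply/funext => t; rewrite /wave /= !(hornerC1, horner0); ring.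
Qed.

Lemma sqrt_pi_sg (sg : R) : 0 < sg -> Num.sqrt (pi / (pi / sg ^+ 2)) = sg.
Proof.
move=> sg0; have -> : pi / (pi / sg ^+ 2) = sg ^+ 2 :> R.
  by move: (@pi R) (pi_gt0 R) => q q0; field; rewrite !gt_eqF.
by rewrite sqrtr_sqr gtr0_norm.
Qed.

Lemma fourier_test_gauss sg x l : 0 < sg ->
  fourier (test_gauss sg x) l = (sg * expR (- (pi * sg ^+ 2 * (x - l) ^+ 2)))%:C%C.
Proof.
move=> sg0; have al0 : 0 < pi / sg ^+ 2 by rewrite divr_gt0 ?pi_gt0 // exprn_gt0.
have [hc hs] := gauss_transform 0 al0 (2 * pi * (x - l)).
have p0 : pi != 0 :> R by rewrite gt_eqF ?pi_gt0.
have s0 : sg != 0 by rewrite gt_eqF.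
rewrite sqrt_pi_sg // mul0r mul0r cos0 mulr1 in hc.
rewrite mul0r mul0r sin0 mulr0 oppr0 in hs.
rewrite /fourier /=; congr (_ +i* _)%C.
  transitivity (gcos (pi / sg ^+ 2) 0 (2 * pi * (x - l))).
    apply: eq_Rintegral => t _; have -> : 2 * pi * (x - l) * t = 2 * pi * x * t - 2 * pi * l * t by ring.
    by rewrite cosB; ring.
  by rewrite hc; congr (_ * expR _); move: (@pi R) p0 => q q0; field; rewrite ?q0 ?s0.
transitivity (gsin (pi / sg ^+ 2) 0 (2 * pi * (x - l))); last by [].
apply: eq_Rintegral => t _; have -> : 2 * pi * (x - l) * t = 2 * pi * x * t - 2 * pi * l * t by ring.
by rewrite sinB; ring.
Qed.

(** For be = 2 pi y and nu = 2 pi (x - l), the factor be - i nu of [step_parts_cos] is - 2 pi i w.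
    The transform is thus the Cauchy kernel in [w], multiplied by a Gaussian that tends to 1 with
    [sg]; keeping [w] on the left avoids a division. *)
Lemma fourier_test_step sg x y l : 0 < sg -> 0 < y ->
  let w : R[i] := ((x +i* y) - l%:C)%C in
  ((fourier (test_step sg x y) l : R[i]) * (- (2 * pi)%:C%C * 'i%C * w) =
    ce (- (pi * sg ^+ 2)%:C%C * w ^+ 2)).
Proof.
move=> sg0 y0 w; have al0 : 0 < pi / sg ^+ 2 by rewrite divr_gt0 ?pi_gt0 // exprn_gt0.
have be0 : 0 < 2 * pi * y by rewrite !mulr_gt0 ?pi_gt0.
have p0 : pi != 0 :> R by rewrite gt_eqF ?pi_gt0.
have s0 : sg != 0 by rewrite gt_eqF.
have [hc hs] := gauss_transform (2 * pi * y) al0 (2 * pi * (x - l)).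
have pc := step_parts_cos sg0 be0 (2 * pi * (x - l)).
have ps := step_parts_sin sg0 be0 (2 * pi * (x - l)).
have wE : w = ((x - l) +i* y)%C by apply/eqP; rewrite eq_complex ReB ImB /= subr0 !eqxx.
have w2 : - (pi * sg ^+ 2)%:C%C * w ^+ 2 =
  ((- (pi * sg ^+ 2) * ((x - l) ^+ 2 - y ^+ 2)) +i* (- (pi * sg ^+ 2) * (2 * (x - l) * y)))%C.
  rewrite wE; apply/eqP; rewrite eq_complex expr2 !ReM !ImM /=.
  by apply/andP; split; apply/eqP; ring.
rewrite w2 ceE /=.
have -> : fourier (test_step sg x y) l =
   (scos sg (2 * pi * y) (2 * pi * (x - l)) +i* ssin sg (2 * pi * y) (2 * pi * (x - l)))%C.
  rewrite /fourier /=; congr (_ +i* _)%C; apply: eq_Rintegral => t _;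
  have -> : 2 * pi * (x - l) * t = 2 * pi * x * t - 2 * pi * l * t by ring.
    by rewrite cosB; ring.
  by rewrite sinB; ring.
have -> : - (pi * sg ^+ 2) * ((x - l) ^+ 2 - y ^+ 2) =
  ((2 * pi * y) ^+ 2 - (2 * pi * (x - l)) ^+ 2) / (4 * (pi / sg ^+ 2)) by move: (@pi R) p0 => q q0; field; rewrite ?q0 ?s0.
have -> : - (pi * sg ^+ 2) * (2 * (x - l) * y) =
  - (2 * pi * y / (2 * (pi / sg ^+ 2)) * (2 * pi * (x - l))) by move: (@pi R) p0 => q q0; field; rewrite ?q0 ?s0.
rewrite cosN sinN.
rewrite sqrt_pi_sg // in hc; rewrite sqrt_pi_sg // in hs.
rewrite hc -[sg * _ * _]mulrA mulKf // in pc.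
rewrite hs -[sg * _ * _]mulrA mulrN mulKf // in ps.
rewrite -pc mulrN -ps wE; apply/eqP; rewrite eq_complex !(ReM, ImM) /=.
by apply/andP; split; apply/eqP; ring.
Qed.

Lemma test_gaussE sg x t : test_gauss sg x t =
  (expR (- (pi / sg ^+ 2 * t ^+ 2)))%:C%C * ce ('i%C * (2 * pi * t)%:C%C * x%:C%C).
Proof.
rewrite ceE !(ReM, ImM) /= !(mul0r, mulr0, mul1r, subr0, add0r, addr0, sub0r, oppr0).
rewrite expR0 !mul1r /test_gauss; apply/eqP; rewrite eq_complex !(ReM, ImM) /=.
have -> : gaussK (pi / sg ^+ 2) 0 t = expR (- (pi / sg ^+ 2 * t ^+ 2)).
  by rewrite /gaussK mul0r subr0 mulNr.
have -> : 2 * pi * t * x = 2 * pi * x * t by ring.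
by apply/andP; split; apply/eqP; ring.
Qed.

Lemma test_stepE sg x y t : test_step sg x y t =
  (gcdf (sg^-1 * t))%:C%C * ce ('i%C * (2 * pi * t)%:C%C * (x +i* y)%C).
Proof.
rewrite ceE !(ReM, ImM) /= !(mul0r, mulr0, mul1r, subr0, add0r, addr0, sub0r, oppr0).
rewrite /test_step /step; apply/eqP; rewrite eq_complex !(ReM, ImM) /=.
have -> : 2 * pi * t * x = 2 * pi * x * t by ring.
have -> : - (2 * pi * t * y) = - (2 * pi * y) * t by ring.
by apply/andP; split; apply/eqP; ring.
Qed.

End GaussianPrimitive.

(** * Unordered sums *)

Section UnorderedSums.
Context {R : realType}.
Local Notation C := (R[i]).
Implicit Types (S A F : set R) (h : R -> C) (w : R -> R) (s : C).

Lemma fsum_cmod A h : finite_set A -> cmod (\sum_(x \in A) h x) <= \sum_(x \in A) cmod (h x).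
Proof. by move=> fA; rewrite !fsbig_finite //; exact: cmod_sum. Qed.

Lemma fsum_le A (f g : R -> R) : finite_set A -> (forall x, A x -> f x <= g x) ->
  \sum_(x \in A) f x <= \sum_(x \in A) g x.
Proof.
move=> fA fg; rewrite !fsbig_finite // big_seq [leRHS]big_seq; apply: ler_sum => x.
by rewrite in_fset_set // inE => /fg.
Qed.

Lemma fsum_split A F (K : nmodType) (f : R -> K) : finite_set A ->
  \sum_(x \in A) f x = \sum_(x \in A `&` F) f x + \sum_(x \in A `\` F) f x.
Proof. by move=> fA; rewrite (fsbigID F). Qed.

(** Any finite set can be enlarged to contain [F0], so an estimate for the partial sums beyond [F0]
    passes to the sum. Bounds and uniqueness both follow from it. *)
Lemma has_sum_approx S h s (F0 : set R) (v : C) (e : R) : finite_set F0 -> F0 `<=` S ->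
  has_sum S h s ->
  (forall F, finite_set F -> F0 `<=` F -> F `<=` S -> cmod (\sum_(x \in F) h x - v) <= e) ->
  cmod (s - v) <= e.
Proof.
move=> fF0 F0S hs hv; apply/ler_addgt0Pl => d d0.
have [F1 [fF1 F1S hF1]] := hs _ d0.
have fU : finite_set (F0 `|` F1) by rewrite finite_setU.
have US : F0 `|` F1 `<=` S by move=> x [/F0S|/F1S].
have h1 : cmod (\sum_(x \in F0 `|` F1) h x - s) < d.
  by apply: hF1 => //; exact: subsetUr.
have h2 := hv _ fU (@subsetUl _ _ _) US.
have := cmod_tri (\sum_(x \in F0 `|` F1) h x) s v.
rewrite (cmod_dist s (\sum_(x \in F0 `|` F1) h x)); lra.
Qed.

Lemma has_sum_uniq S h s1 s2 : has_sum S h s1 -> has_sum S h s2 -> s1 = s2.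
Proof.
move=> h1 h2; apply/eqP; rewrite -subr_eq0; apply/eqP/cmod_eq0/eqP.
rewrite eq_le cmod_ge0 andbT; apply/ler_addgt0Pl => e e0; rewrite addr0.
have [F0 [fF0 F0S hF0]] := h2 _ e0.
by apply: (has_sum_approx fF0 F0S h1) => F fF F0F FS; apply/ltW/hF0.
Qed.

Lemma has_sum_le S h s (B : R) : has_sum S h s ->
  (forall F, finite_set F -> F `<=` S -> cmod (\sum_(x \in F) h x) <= B) -> cmod s <= B.
Proof.
move=> hs hB; rewrite -[s]subr0.
by apply: (has_sum_approx (finite_set0 R) (@sub0set _ _) hs) => F fF _ FS; rewrite subr0 hB.
Qed.

Lemma has_sumD S h k s t : has_sum S h s -> has_sum S k t ->
  has_sum S (fun x => h x + k x) (s + t).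
Proof.
move=> hs ht e e0; have e20 : 0 < e / 2 by rewrite divr_gt0.
have [F0 [fF0 F0S hF0]] := hs _ e20; have [F1 [fF1 F1S hF1]] := ht _ e20.
exists (F0 `|` F1); split=> [||F fF UF FS]; first by rewrite finite_setU.
  by move=> x [/F0S|/F1S].
have h0 : cmod (\sum_(x \in F) h x - s) < e / 2.
  by apply: hF0 => // x Fx; apply: UF; left.
have h1 : cmod (\sum_(x \in F) k x - t) < e / 2.
  by apply: hF1 => // x Fx; apply: UF; right.
change (cmod ((\sum_(x \in F) ((h x : C) + k x) : C) - (s + t)) < e).
rewrite fsbig_split //=.
have -> (a b c d : C) : a + b - (c + d) = (a - c) + (b - d) by ring.
by apply: le_lt_trans (cmodD _ _) _; lra.
Qed.

Lemma has_sumZ S h s (c : C) : has_sum S h s -> has_sum S (fun x => c * h x) (c * s).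
Proof.
move=> hs e e0; have c0 := cmod_ge0 c; have c1 : 0 < cmod c + 1 by lra.
have [F0 [fF0 F0S hF0]] := hs _ (divr_gt0 e0 c1).
exists F0; split=> // F fF F0F FS.
change (cmod ((\sum_(x \in F) (c * h x : C) : C) - c * s) < e).
rewrite -mulr_fsumr -mulrBr cmodM.
have h1 : cmod (\sum_(x \in F) h x - s) < e / (cmod c + 1) by apply: hF0.
rewrite ltr_pdivlMr // in h1; apply: le_lt_trans h1.
by rewrite mulrC; apply: ler_wpM2l; [exact: cmod_ge0|lra].
Qed.

Lemma has_sum_ext S h k s : (forall x, S x -> h x = k x) -> has_sum S h s -> has_sum S k s.
Proof.
move=> hk hs e e0; have [F0 [fF0 F0S hF0]] := hs _ e0.
exists F0; split=> // F fF F0F FS.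
rewrite -(eq_fsbigr (f := h)); first exact: hF0.
by move=> x; rewrite inE => /FS /hk.
Qed.

Lemma has_sum_restrict S S' h s : S' `<=` S -> (forall x, S x -> ~ S' x -> h x = 0) ->
  has_sum S h s -> has_sum S' h s.
Proof.
move=> S'S h0 hs e e0; have [F0 [fF0 F0S hF0]] := hs _ e0.
exists (F0 `&` S'); split=> [||F fF F0F FS]; first exact: finite_setIl.
  by move=> x [].
(* [F] need not contain the part of [F0] outside [S']; adding it changes nothing, because [h]
   vanishes there. *)
have -> : \sum_(x \in F) h x = \sum_(x \in F `|` F0) h x.
  apply: fsbig_widen; first exact: subsetUl.
  move=> x [[//|F0x] Fx]; apply: h0; first exact: F0S.
  by move=> S'x; apply: Fx; apply: F0F.
apply: hF0; first by rewrite finite_setU.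
  exact: subsetUr.
by move=> x [/FS/S'S|/F0S].
Qed.

Definition summ S w := exists B : R, forall F, finite_set F -> F `<=` S -> \sum_(x \in F) w x <= B.

(** [F0] is a finite set whose sum comes within [e] of the supremum: any disjoint set can add at
    most [e]. *)
Lemma summ_tail S w : (forall x, 0 <= w x) -> summ S w -> forall e : R, 0 < e ->
  exists F0, [/\ finite_set F0, F0 `<=` S &
    forall F, finite_set F -> F `<=` S -> F `&` F0 = set0 -> \sum_(x \in F) w x <= e].
Proof.
move=> w0 [B hB] e e0.
pose X := [set y : R | exists F, [/\ finite_set F, F `<=` S & y = \sum_(x \in F) w x]].
have X0 : X !=set0 by exists (\sum_(x \in set0) w x), set0; split.
have Xub : has_ubound X by exists B => _ [F [fF FS ->]]; exact: hB.
have [_ [F0 [fF0 F0S ->]] hF0] := sup_adherent e0 (conj X0 Xub).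
exists F0; split=> // F fF FS FF0.
have hU : X (\sum_(x \in F `|` F0) w x).
  by exists (F `|` F0); split=> //; [rewrite finite_setU | move=> x [/FS|/F0S]].
have := ub_le_sup Xub hU; rewrite fsbigU0 //=; first lra.
by rewrite FF0.
Qed.

Lemma summ_has_sum S w h : (forall x, 0 <= w x) -> summ S w ->
  (forall x, S x -> cmod (h x) <= w x) -> exists s, has_sum S h s.
Proof.
move=> w0 sw hw.
have en n : 0 < (n.+1%:R^-1 : R) by rewrite invr_gt0 ltr0n.
(* Sets with tails at most 1 / (n + 1): their sums form a Cauchy sequence, since each is close to
   the sum over a union. *)
have /choice[T hT] : forall n, exists F0, [/\ finite_set F0, F0 `<=` S &
    forall F, finite_set F -> F `<=` S -> F `&` F0 = set0 -> \sum_(x \in F) w x <= n.+1%:R^-1].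
  by move=> n; exact: summ_tail.
have key n F : finite_set F -> T n `<=` F -> F `<=` S ->
    cmod (\sum_(x \in F) h x - \sum_(x \in T n) h x) <= n.+1%:R^-1.
  move=> fF TF FS; have [fT TS tT] := hT n.
  rewrite (fsum_split (T n) _ fF) (_ : F `&` T n = T n); last first.
    by apply/seteqP; split=> x; [case | move=> Tx; split=> //; exact: TF].
  rewrite addrAC subrr add0r.
  have fD : finite_set (F `\` T n) by exact: finite_setD.
  apply: le_trans (fsum_cmod _ fD) _.
  apply: le_trans (fsum_le fD (g := w) _) _; first by move=> x [/FS/hw].
  apply: tT => //; first by move=> x [/FS].
  by apply/seteqP; split=> x // [[]].
have small (e : R) : 0 < e -> exists N, forall n, (N <= n)%N -> (n.+1%:R^-1 : R) <= e.
  move=> e0; exists (Num.truncn e^-1) => n Nn.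
  rewrite invf_ple ?posrE ?ltr0n // ltW // (lt_le_trans (truncnS_gt _)) //.
  by rewrite ler_nat ltnS.
have [s hs] : exists s, ccvg (fun n => \sum_(x \in T n) h x) s.
  apply: ccauchy_cvg => e e0; have [N hN] := small _ (divr_gt0 e0 (ltr0n R 2)).
  exists N => m n Nm Nn.
  have [fm mS _] := hT m; have [fn nS _] := hT n.
  have fU : finite_set (T m `|` T n) by rewrite finite_setU.
  have US : T m `|` T n `<=` S by move=> x [/mS|/nS].
  have k1 := le_trans (key m _ fU (@subsetUl _ _ _) US) (hN _ Nm).
  have k2 := le_trans (key n _ fU (@subsetUr _ _ _) US) (hN _ Nn).
  apply: le_trans (cmod_tri (\sum_(x \in T m `|` T n) h x) _ _) _.
  rewrite (cmod_dist (\sum_(x \in T m) h x)); lra.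
exists s => e e0; have e40 : 0 < e / 4 by rewrite divr_gt0.
have [N hN] := small _ e40; have [N' hN'] := hs _ e40.
pose n := maxn N N'; have [fn nS _] := hT n.
exists (T n); split=> // F fF TF FS.
have k1 := le_trans (key n _ fF TF FS) (hN _ (leq_maxl _ _)).
have k2 := hN' _ (leq_maxr N N').
change (cmod ((\sum_(x \in F) (h x : C) : C) - s) < e).
by apply: le_lt_trans (cmod_tri (\sum_(x \in T n) h x) _ _) _; rewrite -/n in k2; lra.
Qed.

End UnorderedSums.

(** * Sums over the spectrum *)

Section Spectrum.
Context {R : realType}.
Local Notation C := (R[i]).
Variables (Gam : set R) (b : R -> C).
Hypothesis tb : tempered_discrete Gam (fun g => cabs (b g)).

Lemma spectrum_weight : exists N : nat, summ Gam (fun g => cmod (b g) / (1 + `|g|) ^+ N).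
Proof.
have [N hN] := tb; exists N; set f := fun g => cmod (b g) / (1 + `|g|) ^+ N.
have e0 : (0 <= \esum_(x in Gam) (f x)%:E)%E.
  apply: esum_ge0 => x _; rewrite lee_fin; apply: divr_ge0; first exact: cmod_ge0.
  by rewrite exprn_ge0 // addr_ge0.
have fin : (\esum_(x in Gam) (f x)%:E)%E \is a fin_num by rewrite ge0_fin_numE.
exists (fine (\esum_(x in Gam) (f x)%:E)) => F fF FG.
rewrite -lee_fin fineK //; apply: ereal_sup_ubound.
by exists F => //; rewrite fsumEFin.
Qed.

(** The exponent and the bound are fixed by choice, so that later definitions depend on [Gam] and
    [b] alone; under [tb] the default value is never taken. *)
Definition wN : nat := xget 0%N [set N | summ Gam (fun g => cmod (b g) / (1 + `|g|) ^+ N)].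
Definition wt (g : R) : R := (1 + `|g|) ^+ wN.
Definition wB : R := xget 0 [set B : R | forall F, finite_set F -> F `<=` Gam ->
  \sum_(x \in F) cmod (b x) / wt x <= B].

Lemma wt_gt0 g : 0 < wt g.
Proof. by rewrite exprn_gt0 // ltr_pwDl. Qed.

Lemma summ_wt : summ Gam (fun g => cmod (b g) / wt g).
Proof. exact: (@xgetPex _ 0%N [set N | summ Gam (fun g => cmod (b g) / (1 + `|g|) ^+ N)] spectrum_weight). Qed.

Lemma wBP F : finite_set F -> F `<=` Gam -> \sum_(x \in F) cmod (b x) / wt x <= wB.
Proof.
exact: (@xgetPex _ 0 [set B : R | forall F, finite_set F -> F `<=` Gam ->
  \sum_(x \in F) cmod (b x) / wt x <= B] summ_wt).
Qed.

Lemma wB_ge0 : 0 <= wB.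
Proof. by have := wBP (finite_set0 R) (@sub0set _ _); rewrite fsbig_set0. Qed.

(** Integration of the multiplier [m] against the spectral measure, made total by a default value;
    for [dominated] multipliers it is the true sum. *)
Definition Bsum (m : R -> C) : C := xget 0 [set s | has_sum Gam (fun g => b g * m g) s].

Definition dominated (m : R -> C) := exists K : R, forall g, cmod (m g) * wt g <= K.

Lemma dominated_le m (K g : R) : cmod (m g) * wt g <= K ->
  cmod (b g * m g) <= K * (cmod (b g) / wt g).
Proof.
move=> h; rewrite cmodM mulrCA; apply: ler_wpM2l; first exact: cmod_ge0.
by rewrite ler_pdivlMr // wt_gt0.
Qed.

Lemma Bsum_has_sum m : dominated m -> has_sum Gam (fun g => b g * m g) (Bsum m).
Proof.
move=> [K hK]; apply: (@xgetPex _ 0 [set s | has_sum Gam (fun g => b g * m g) s]).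
have K0 : 0 <= K by apply: le_trans (hK 0); rewrite mulr_ge0 ?cmod_ge0 // ltW // wt_gt0.
apply: (@summ_has_sum _ Gam (fun g => K * (cmod (b g) / wt g))).
- by move=> g; rewrite mulr_ge0 ?divr_ge0 ?cmod_ge0 // ltW // wt_gt0.
- exists (K * wB) => F fF FG; rewrite -mulr_fsumr.
  by apply: ler_wpM2l => //; exact: wBP.
- by move=> g _; exact: dominated_le.
Qed.

Lemma Bsum_eq m s : dominated m -> has_sum Gam (fun g => b g * m g) s -> Bsum m = s.
Proof. by move=> dm hs; exact: has_sum_uniq (Bsum_has_sum dm) hs. Qed.

Lemma BsumD m n : dominated m -> dominated n -> Bsum (fun g => m g + n g) = Bsum m + Bsum n.
Proof.
move=> dm dn; apply: Bsum_eq.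
  have [K hK] := dm; have [L hL] := dn; exists (K + L) => g.
  apply: le_trans (lerD (hK g) (hL g)); rewrite -mulrDl.
  by apply: ler_wpM2r; [rewrite ltW // wt_gt0 | exact: cmodD].
apply: has_sum_ext (has_sumD (Bsum_has_sum dm) (Bsum_has_sum dn)) => g _.
by rewrite [RHS]mulrDr.
Qed.

Lemma BsumZ (c : C) m : dominated m -> Bsum (fun g => c * m g) = c * Bsum m.
Proof.
move=> dm; apply: Bsum_eq.
  have [K hK] := dm; exists (cmod c * K) => g; rewrite cmodM -mulrA.
  by apply: ler_wpM2l; [exact: cmod_ge0|exact: hK].
by apply: has_sum_ext (has_sumZ c (Bsum_has_sum dm)) => g _; rewrite mulrCA.
Qed.

Lemma eq_Bsum m n : m =1 n -> Bsum m = Bsum n.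
Proof. by move=> /funext ->. Qed.

Lemma BsumB m n : dominated m -> dominated n -> Bsum (fun g => m g - n g) = Bsum m - Bsum n.
Proof.
move=> dm dn; rewrite -mulN1r -BsumZ // -BsumD //.
  by apply: eq_Bsum => g; rewrite mulN1r.
by have [K hK] := dn; exists K => g; rewrite mulN1r cmodN.
Qed.

Lemma Bsum_le m (K : R) : (forall g, cmod (m g) * wt g <= K) -> cmod (Bsum m) <= K * wB.
Proof.
move=> hK; have dm : dominated m by exists K.
have K0 : 0 <= K by apply: le_trans (hK 0); rewrite mulr_ge0 ?cmod_ge0 // ltW // wt_gt0.
apply: has_sum_le (Bsum_has_sum dm) _ => F fF FG.
apply: le_trans (fsum_cmod _ fF) _.
apply: (@le_trans _ _ (\sum_(x \in F) K * (cmod (b x) / wt x))).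
  by apply: fsum_le => // g _; exact: dominated_le.
by rewrite -mulr_fsumr; apply: ler_wpM2l => //; exact: wBP.
Qed.

(** The list [r] of frequencies carries all but [e] of the weighted mass and serves all multipliers
    at once. Dominated convergence and almost periodicity are both drawn from this uniformity. *)
Lemma Bsum_tail (e : R) : 0 < e -> exists r : seq R, forall m,
  (forall g, cmod (m g) * wt g <= 1) -> (forall g, g \in r -> cmod (m g) * wt g <= e) ->
  cmod (Bsum m) <= e * (1 + wB).
Proof.
move=> e0.
have w0 g : 0 <= cmod (b g) / wt g by rewrite divr_ge0 ?cmod_ge0 // ltW // wt_gt0.
have [F0 [fF0 F0G hF0]] := summ_tail w0 summ_wt e0.
exists (finmap.enum_fset (fset_set F0)) => m m1 me.
have dm : dominated m by exists 1.
apply: has_sum_le (Bsum_has_sum dm) _ => F fF FG.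
apply: le_trans (fsum_cmod _ fF) _.
rewrite (fsum_split F0 _ fF) mulrDr mulr1 addrC; apply: lerD.
  have fD : finite_set (F `\` F0) by exact: finite_setD.
  apply: le_trans (fsum_le fD (g := fun g => 1 * (cmod (b g) / wt g)) _) _.
    by move=> g _; exact: dominated_le.
  rewrite -mulr_fsumr mul1r; apply: hF0 => //; first by move=> x [/FG].
  by apply/seteqP; split=> x // [[]].
have fI : finite_set (F `&` F0) by exact: finite_setIl.
apply: le_trans (fsum_le fI (g := fun g => e * (cmod (b g) / wt g)) _) _.
  move=> g [_ F0g]; apply: dominated_le; apply: me.
  by rewrite in_fset_set // inE.
rewrite -mulr_fsumr; apply: ler_wpM2l; first exact: ltW.
by apply: wBP => // x [/FG].
Qed.

Lemma Bsum_cvg (m : nat -> R -> C) (l : R -> C) (K : R) :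
  (forall n g, cmod (m n g) * wt g <= K) -> (forall g, ccvg (m^~ g) (l g)) ->
  ccvg (fun n => Bsum (m n)) (Bsum l).
Proof.
move=> hK hl.
have lK g : cmod (l g) * wt g <= K.
  rewrite -ler_pdivlMr ?wt_gt0 //; apply: ccvg_le (hl g) _ => n.
  by rewrite ler_pdivlMr ?wt_gt0.
have K0 : 0 <= K by apply: le_trans (lK 0); rewrite mulr_ge0 ?cmod_ge0 // ltW // wt_gt0.
(* [m n - l] is dominated by [2 * K]; dividing it by [K2] meets the normalisation of [Bsum_tail],
   and the 1 keeps [K2] positive. *)
pose K2 := 2 * K + 1; have K20 : 0 < K2 by rewrite /K2; lra.
move=> e e0; pose d := e / (K2 * (1 + wB)).
have B0 := wB_ge0; have D0 : 0 < K2 * (1 + wB) by rewrite mulr_gt0 //; lra.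
have d0 : 0 < d by rewrite divr_gt0.
have [r hr] := Bsum_tail d0.
have [N hN] : exists N : nat, forall n, (N <= n)%N -> forall g, g \in r ->
    cmod (m n g - l g) * wt g <= K2 * d.
  elim: r {hr} => [|g r [N hN]]; first by exists 0%N.
  have x0 : 0 < K2 * d / wt g by rewrite divr_gt0 ?wt_gt0 // mulr_gt0.
  have [N' hN'] := hl g _ x0; exists (maxn N N') => n; rewrite geq_max => /andP[n1 n2] g'.
  rewrite inE => /orP[/eqP->|g'r]; last exact: hN.
  by rewrite -ler_pdivlMr ?wt_gt0 //; exact: hN'.
exists N => n Nn.
have dm1 : dominated (m n) by exists K.
have dl : dominated l by exists K.
pose k g := (K2^-1)%:C%C * (m n g - l g).
have kE g : cmod (k g) * wt g = (cmod (m n g - l g) * wt g) / K2.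
  by rewrite cmodM cmodR ger0_norm ?invr_ge0 ?(ltW K20) //; ring.
have dk : dominated (fun g => m n g - l g).
  exists (2 * K) => g; apply: (@le_trans _ _ ((cmod (m n g) + cmod (l g)) * wt g)).
    by apply: ler_wpM2r; [rewrite ltW // wt_gt0 | exact: cmodB].
  by rewrite mulrDl; have := hK n g; have := lK g; lra.
have := hr k _ _.
have -> : Bsum k = (K2^-1)%:C%C * (Bsum (m n) - Bsum l) by rewrite -BsumB // -BsumZ.
rewrite cmodM cmodR ger0_norm ?invr_ge0 ?(ltW K20) // => h.
have {}h : K2^-1 * cmod (Bsum (m n) - Bsum l) <= d * (1 + wB).
  apply: h => g => [|gr]; rewrite kE ler_pdivrMr //.
    rewrite mul1r; apply: (@le_trans _ _ ((cmod (m n g) + cmod (l g)) * wt g)).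
      by apply: ler_wpM2r; [rewrite ltW // wt_gt0 | exact: cmodB].
    by rewrite mulrDl /K2; have := hK n g; have := lK g; lra.
  by rewrite [leRHS]mulrC; exact: hN.
move: h; rewrite ler_pdivrMl // => /le_trans; apply.
rewrite /d le_eqVlt; apply/orP; left; apply/eqP; field.
by rewrite !gt_eqF //; lra.
Qed.

End Spectrum.

(** * Symmetric sums and the enumeration of the points *)

Section TwoSidedSums.

(** Listed so that the step from M to M + 1 adds the pair of opposite integers, as in the symmetric
    product. *)
Fixpoint ints (M : nat) : seq int :=
  if M is M'.+1 then M'.+1%:Z :: (- M'.+1%:Z) :: ints M' else [:: 0].

Lemma mem_ints M (n : int) : (n \in ints M) = (`|n| <= M)%N.
Proof.
elim: M => [|M IH]; first by rewrite inE; lia.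
by rewrite /= !inE IH; lia.
Qed.

Lemma ints_uniq M : uniq (ints M).
Proof. by elim: M => [|M IH] //=; rewrite IH !inE !mem_ints; lia. Qed.

Definition ssum (V : nmodType) (u : int -> V) (M : nat) : V :=
  u 0 + \sum_(1 <= n < M.+1) (u n%:Z + u (- n%:Z)).

Lemma ssum_ints (V : nmodType) (u : int -> V) M : ssum u M = \sum_(n <- ints M) u n.
Proof.
elim: M => [|M IH]; first by rewrite /ssum big_geq // addr0 big_seq1.
rewrite /= !big_cons -IH /ssum big_nat_recr //= addrA [in RHS]addrA [RHS]addrC //.
Qed.

Lemma ssumS (V : nmodType) (u : int -> V) M :
  ssum u M.+1 = ssum u M + (u M.+1%:Z + u (- M.+1%:Z)).
Proof. by rewrite /ssum big_nat_recr //= addrA. Qed.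

End TwoSidedSums.

Section Enumeration.
Context {R : realType}.
Local Notation C := (R[i]).
Variables (Lam : set R) (c : R -> nat) (a : int -> R).
Hypothesis locfin : forall r : R, finite_set (Lam `&` `[- r, r]).
Hypothesis cpos : forall l, Lam l -> (0 < c l)%N.
Hypothesis a_nd : forall n : int, a n <= a (n + 1).
Hypothesis a_card : forall x : R, Lam x -> ([set n : int | a n = x] #= `I_(c x))%card.
Hypothesis a_Lam : forall x : R, ~ Lam x -> forall n : int, a n <> x.

Lemma a_in n : Lam (a n).
Proof. by apply: contrapT => h; exact: (a_Lam h (n := n)). Qed.

Lemma a_le (m n : int) : m <= n -> a m <= a n.
Proof.
move=> mn; have -> : n = m + (`|n - m|%N)%:Z by lia.
elim: `|n - m|%N => [|k IH]; first by rewrite addr0.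
apply: le_trans IH _; have -> : m + k.+1%:Z = m + k%:Z + 1 by lia.
exact: a_nd.
Qed.

Lemma int_set_bounded (A : set int) : finite_set A -> exists N : nat, forall n, A n -> n \in ints N.
Proof.
move=> fA; pose s := finmap.enum_fset (fset_set A).
have [N hN] : exists N : nat, forall n, n \in s -> n \in ints N.
  elim: s => [|n s [N IH]]; first by exists 0%N.
  exists (maxn `|n| N) => m; rewrite inE => /orP[/eqP ->|/IH]; rewrite !mem_ints leq_max.
    by rewrite leqnn.
  by move=> ->; rewrite orbT.
by exists N => n An; apply: hN; rewrite in_fset_set // inE.
Qed.

Lemma a_ball_bounded (r : R) : exists N : nat, forall n : int, `|a n| <= r -> n \in ints N.
Proof.
apply: (@int_set_bounded [set n | `|a n| <= r]).
have -> : [set n | `|a n| <= r] = \bigcup_(x in Lam `&` `[- r, r]) [set n | a n = x].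
  apply/seteqP; split=> n /=.
    move=> h; exists (a n) => //; split; first exact: a_in.
    by rewrite /= in_itv /= -ler_norml.
  by move=> [x [_ /=]]; rewrite in_itv /= -ler_norml => xr ->.
apply: bigcup_finite; first exact: locfin.
by move=> x [Lx _]; apply/finite_setP; exists (c x); exact: a_card.
Qed.

Lemma a_infty (r : R) : exists N : nat, forall n, (N <= n)%N ->
  r <= a n%:Z /\ a (- n%:Z) <= - r.
Proof.
(* Adding |a 0| to the radius decides the sign: a value this large in modulus that is at least [a 0]
   cannot be negative, and symmetrically on the left. *)
have [N hN] := a_ball_bounded (`|r| + `|a 0|); exists N.+1 => n Nn.
have h1 : `|r| + `|a 0| < `|a n%:Z|.
  by rewrite ltNge; apply/negP => /hN; rewrite mem_ints; lia.
have h2 : `|r| + `|a 0| < `|a (- n%:Z)|.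
  by rewrite ltNge; apply/negP => /hN; rewrite mem_ints; lia.
have k1 : a 0 <= a n%:Z by apply: a_le; lia.
have k2 : a (- n%:Z) <= a 0 by apply: a_le; lia.
have q1 := ler_norm r; have q2 := ler_norm (a 0).
have q3 : - a 0 <= `|a 0| by rewrite -normrN ler_norm.
have q4 := normr_ge0 r; have q5 := normr_ge0 (a 0).
split.
  have [p|p] := leP 0 (a n%:Z).
    by rewrite (ger0_norm p) in h1; lra.
  by rewrite (ltr0_norm p) in h1; lra.
have [p|p] := leP 0 (a (- n%:Z)).
  by rewrite (ger0_norm p) in h2; lra.
by rewrite (ltr0_norm p) in h2; lra.
Qed.

Lemma fin_bounded (F : set R) : finite_set F -> exists r : R, forall x, F x -> `|x| <= r.
Proof.
move=> fF; exists (\sum_(x \in F) `|x|) => x Fx.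
by rewrite (fsbigD1 x) //= lerDl; apply: fsumr_ge0.
Qed.

Definition vals M := [seq a n | n <- ints M].

Lemma vals_mem (F : set R) : finite_set F -> F `<=` Lam ->
  exists M0, forall M x, (M0 <= M)%N -> F x -> x \in vals M.
Proof.
move=> fF FL; have [r hr] := fin_bounded fF; have [N hN] := a_ball_bounded r.
exists N => M x NM Fx.
have [n an] : exists n, a n = x.
  apply: contrapT => h; have := a_card (FL _ Fx).
  have -> : [set n | a n = x] = set0 by apply/seteqP; split=> n //= an; apply: h; exists n.
  rewrite card_eq_sym card_eq0 => /eqP h0.
  have : `I_(c x) 0%N := cpos (FL _ Fx).
  by rewrite h0.
apply/mapP; exists n => //; rewrite mem_ints (leq_trans _ NM) // -mem_ints; apply: hN.
by rewrite an; exact: hr.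
Qed.

Lemma count_vals_le M x : Lam x -> (count_mem x (vals M) <= c x)%N.
Proof.
move=> Lx; have cx := a_card Lx.
have fx : finite_set [set n | a n = x] by apply/finite_setP; exists (c x).
rewrite -(card_fset_set cx) /vals count_map -size_filter.
apply: uniq_leq_size; first by rewrite filter_uniq // ints_uniq.
by move=> n; rewrite mem_filter in_fset_set // inE => /andP[/eqP].
Qed.

Lemma count_vals M x : Lam x -> a (- M%:Z) < x -> x < a M%:Z ->
  count_mem x (vals M) = c x.
Proof.
move=> Lx x1 x2; apply/eqP; rewrite eqn_leq count_vals_le //=.
have cx := a_card Lx.
have fx : finite_set [set n | a n = x] by apply/finite_setP; exists (c x).
rewrite -(card_fset_set cx) /vals count_map -size_filter.
apply: uniq_leq_size; first exact: finmap.fset_uniq.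
move=> n; rewrite in_fset_set // inE /= mem_filter /= => an; rewrite an eqxx /= mem_ints.
rewrite leqNgt; apply/negP => Mn.
have [n0|n0] := leP 0 n.
  have : a M%:Z <= a n by apply: a_le; lia.
  by rewrite an; lra.
have : a n <= a (- M%:Z) by apply: a_le; lia.
by rewrite an; lra.
Qed.

Lemma sum_pred1_le (s : seq R) (y K : R) : uniq s -> 0 <= K ->
  \sum_(x <- s) (if x == y then K else 0) <= K.
Proof.
move=> us K0; have [ys|ys] := boolP (y \in s).
  by rewrite (bigD1_seq y) //= eqxx big1 ?addr0 // => x /negPf ->.
by rewrite big_seq big1 // => x xs; case: eqVneq => // xy; rewrite xy (negPf ys) in xs.
Qed.

(** The values a_n with |n| <= M contain each point strictly between a_(-M) and a_M with its full
    multiplicity. Only the groups at these two extreme values may be cut, at a cost of at most [Cb]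
    times |h| there, which tends to 0. *)
Lemma reindex_sum (h : R -> C) (s : C) (Cb : nat) :
  has_sum Lam (fun l => (c l)%:R * h l) s -> (forall l, Lam l -> (c l <= Cb)%N) ->
  (forall e : R, 0 < e -> exists N : nat, forall n, (N <= n)%N ->
    cmod (h (a n%:Z)) <= e /\ cmod (h (a (- n%:Z))) <= e) ->
  ccvg (ssum (fun n => h (a n))) s.
Proof.
move=> hs hCb h0 e e0; have e20 : 0 < e / 2 by rewrite divr_gt0.
have C0 : 0 < 4 * Cb.+1%:R :> R by rewrite mulr_gt0 // ltr0n.
have [F0 [fF0 F0L hF0]] := hs _ e20.
have [M0 hM0] := vals_mem fF0 F0L.
have [N hN] := h0 _ (divr_gt0 e0 C0).
exists (maxn M0 N) => M; rewrite geq_max => /andP[M0M NM].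
have hv : ssum (fun n => h (a n)) M =
    \sum_(x <- undup (vals M)) h x *+ count_mem x (vals M).
  rewrite ssum_ints -(big_map a xpredT h) -/(vals M).
  by rewrite -(big_undup_iterop_count +%R (vals M) xpredT h).
have vL x : x \in undup (vals M) -> Lam x.
  by rewrite mem_undup => /mapP[n _ ->]; exact: a_in.
have k1 : cmod (\sum_(x <- undup (vals M)) (c x)%:R * h x - s) < e / 2.
  have -> : \sum_(x <- undup (vals M)) (c x)%:R * h x =
      \sum_(x \in [set` undup (vals M)]) (c x)%:R * h x.
    by rewrite fsbig_seq ?undup_uniq.
  apply: hF0.
  - exact: finite_seq.
  - by move=> x F0x /=; rewrite mem_undup; exact: hM0.
  - by move=> x /= /vL.
have k2 : cmod (ssum (fun n => h (a n)) M - \sum_(x <- undup (vals M)) (c x)%:R * h x) <= e / 2.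
  rewrite hv -sumrB; apply: le_trans (cmod_sum _ _ _) _.
  have [hp hm] := hN _ NM.
  pose K1 : R := Cb%:R * cmod (h (a M%:Z)); pose K2 : R := Cb%:R * cmod (h (a (- M%:Z))).
  have K10 : 0 <= K1 by rewrite mulr_ge0 ?cmod_ge0.
  have K20 : 0 <= K2 by rewrite mulr_ge0 ?cmod_ge0.
  apply: (@le_trans _ _ (\sum_(x <- undup (vals M))
      ((if x == a M%:Z then K1 else 0) + (if x == a (- M%:Z) then K2 else 0)))).
    rewrite big_seq [leRHS]big_seq; apply: ler_sum => x xv.
    have Lx := vL _ xv; have cle := count_vals_le M Lx.
    have dE : cmod (h x *+ count_mem x (vals M) - (c x)%:R * h x) =
        (c x - count_mem x (vals M))%:R * cmod (h x).
      rewrite -[h x *+ _]mulr_natl -mulrBl cmodM cmod_dist -natrB // cmod_nat //.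
    have dle : cmod (h x *+ count_mem x (vals M) - (c x)%:R * h x) <= Cb%:R * cmod (h x).
      rewrite dE; apply: ler_wpM2r; first exact: cmod_ge0.
      by rewrite ler_nat (leq_trans (leq_subr _ _)) // hCb.
    have [x1|x1] := eqVneq x (a M%:Z).
      rewrite x1 in dle *; apply: le_trans dle _; rewrite lerDl.
      by case: ifP.
    have [x2|x2] := eqVneq x (a (- M%:Z)).
      by rewrite x2 in dle *; rewrite add0r.
    rewrite dE count_vals ?subnn ?mul0r ?addr0 //.
      move: xv; rewrite mem_undup => /mapP[n nM xn]; rewrite xn in x2 *.
      rewrite lt_neqAle eq_sym x2 /=; apply: a_le; rewrite mem_ints in nM; lia.
    move: xv; rewrite mem_undup => /mapP[n nM xn]; rewrite xn in x1 *.
    rewrite lt_neqAle x1 /=; apply: a_le; rewrite mem_ints in nM; lia.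
  rewrite big_split /=.
  have s1 := sum_pred1_le (a M%:Z) (undup_uniq (vals M)) K10.
  have s2 := sum_pred1_le (a (- M%:Z)) (undup_uniq (vals M)) K20.
  have q (t : R) : t <= e / (4 * Cb.+1%:R) -> Cb%:R * t <= e / 4.
    move=> ht; apply: (@le_trans _ _ (Cb%:R * (e / (4 * Cb.+1%:R)))).
      by apply: ler_wpM2l.
    rewrite mulrA ler_pdivrMr // mulrA divfK // mulrC; apply: ler_wpM2l; first exact: ltW.
    by rewrite ler_nat.
  have := q _ hp; have := q _ hm; rewrite -/K1 -/K2; lra.
have := cmod_tri (\sum_(x <- undup (vals M)) (c x)%:R * h x) (ssum (fun n => h (a n)) M) s.
lra.
Qed.

End Enumeration.

(** * Density of the points *)

Class quasicrystal {R : realType} (Lam : set R) (c : R -> nat) (Gam : set R)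
    (b : R -> R[i]) (a : int -> R) : Prop := Quasicrystal {
  qc_locfin : forall r : R, finite_set (Lam `&` `[- r, r]);
  qc_pos : forall l, Lam l -> (0 < c l)%N;
  qc_fourier : fourier_transform_is Lam c Gam b;
  qc_tempered : tempered_discrete Gam (fun g => cabs (b g));
  qc_nd : forall n : int, a n <= a (n + 1);
  qc_card : forall x : R, Lam x -> ([set n : int | a n = x] #= `I_(c x))%card;
  qc_mem : forall x : R, ~ Lam x -> forall n : int, a n <> x;
  qc_neq0 : forall n : int, a n <> 0 }.

Section Quasicrystal.
Context {R : realType}.
Local Notation C := (R[i]).
Context {Lam : set R} {c : R -> nat} {Gam : set R} {b : R -> C} {a : int -> R}.
Context {qc : quasicrystal Lam c Gam b a}.

Let locfin := qc_locfin (quasicrystal := qc).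
Let cpos := qc_pos (quasicrystal := qc).
Let ft := qc_fourier (quasicrystal := qc).
Let tb := qc_tempered (quasicrystal := qc).
Let a_nd := qc_nd (quasicrystal := qc).
Let a_card := qc_card (quasicrystal := qc).
Let a_Lam := qc_mem (quasicrystal := qc).

Local Notation wt := (wt Gam b).
Local Notation wB := (wB Gam b).
Local Notation Bsum := (Bsum Gam b).
Local Notation dominated := (dominated Gam b).

Lemma wt_le_exp (d : R) : 0 < d -> exists2 K : R, 0 < K & forall g, wt g <= K * expR (d * `|g|).
Proof.
move=> d0; set N := wN Gam b; exists ((N`!%:R / d ^+ N) * expR d) => [|g].
  by rewrite mulr_gt0 ?expR_gt0 // divr_gt0 ?ltr0n ?fact_gt0 // exprn_gt0.
have x0 : 0 <= d * (1 + `|g|) by rewrite mulr_ge0 ?addr_ge0 // ltW.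
have := exprn_le_expR N x0; rewrite exprMn -/(wt g) mulrDr mulr1 expRD => h.
have -> (u v w t : R) : u / v * w * t = u * (w * t) / v by ring.
by rewrite ler_pdivlMr ?exprn_gt0 // mulrC.
Qed.

Lemma cmod_ce_re (g : R) (z : C) :
  cmod (ce ('i%C * (2 * pi * g)%:C%C * z)) = expR (- (2 * pi * complex.Im z) * g).
Proof.
rewrite cmod_ce !(ReM, ImM) /=; congr expR; ring.
Qed.

(* Multipliers coming from the two families of test functions. *)
Definition mgauss (sg x g : R) : C :=
  (expR (- (pi / sg ^+ 2 * g ^+ 2)))%:C%C * ce ('i%C * (2 * pi * g)%:C%C * x%:C%C).

Definition mstep (sg : R) (z : C) (g : R) : C :=
  (gcdf (sg^-1 * g))%:C%C * ce ('i%C * (2 * pi * g)%:C%C * z).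

Lemma cmod_mgauss sg x g : cmod (mgauss sg x g) = expR (- (pi / sg ^+ 2 * g ^+ 2)).
Proof.
by rewrite /mgauss cmodM cmodR cmod_ce_re /= mulr0 oppr0 mul0r expR0 mulr1 ger0_norm ?expR_ge0.
Qed.

(** For [sg <= 1] the Gaussian factor is at most its value at [sg = 1]. Uniformity in [x] allows the
    centre to vary while [sg] tends to 0. *)
Lemma mgauss_bound : exists K : R, forall sg x g, 0 < sg -> sg <= 1 -> cmod (mgauss sg x g) * wt g <= K.
Proof.
have [K0 K0p hK] := wt_le_exp (ltr0n R 1).
exists (K0 * expR ((4 * pi)^-1)) => sg x g sg0 sg1; rewrite cmod_mgauss.
have h1 : expR (- (pi / sg ^+ 2 * g ^+ 2)) <= gauss g.
  rewrite gaussE ler_expR lerN2; apply: ler_wpM2r; first exact: sqr_ge0.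
  rewrite ler_pdivlMr ?exprn_gt0 // ler_piMr ?pi_ge0 // expr_le1 //; exact: ltW.
have h2 := gauss_le g ler01.
apply: (@le_trans _ _ (expR (1 ^+ 2 / (4 * pi)) * expR (- (1 * `|g|)) * (K0 * expR (1 * `|g|)))).
  apply: ler_pM; rewrite ?expR_ge0 ?hK //; first by rewrite ltW // wt_gt0.
  exact: le_trans h1 h2.
have : expR (- (1 * `|g|)) * expR (1 * `|g|) = 1 by rewrite -expRD addNr expR0.
move=> hE; rewrite expr1n mul1r.
rewrite -mulrA [X in _ * X]mulrCA hE mulr1 mulrC //.
Qed.

Lemma mgauss_dominated sg x : 0 < sg -> dominated (mgauss sg x).
Proof.
move=> sg0; have al0 : 0 < pi / sg ^+ 2 by rewrite divr_gt0 ?pi_gt0 // exprn_gt0.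
have [K0 K0p hK] := wt_le_exp (ltr0n R 1).
exists (expR ((0 + 1) ^+ 2 / (4 * (pi / sg ^+ 2))) * K0) => g; rewrite cmod_mgauss.
have h2 := gaussK_le 0 1 g al0; rewrite /gaussK mul0r subr0 normr0 mulNr in h2.
apply: le_trans (ler_pM (expR_ge0 _) _ h2 (hK g)) _; first by rewrite ltW // wt_gt0.
have hE : expR (- (1 * `|g|)) * expR (1 * `|g|) = 1 by rewrite -expRD addNr expR0.
by rewrite -mulrA [X in _ * X]mulrCA hE mulr1.
Qed.

Lemma gauss_has_sum sg x : 0 < sg ->
  has_sum Lam (fun l => (c l)%:R * (sg * expR (- (pi * sg ^+ 2 * (x - l) ^+ 2)))%:C%C)
    (Bsum (mgauss sg x)).
Proof.
move=> sg0; have [s [h1 h2]] := ft (test_gauss_schwartz x sg0).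
have -> : Bsum (mgauss sg x) = s.
  apply: (Bsum_eq tb (mgauss_dominated x sg0)); apply: has_sum_ext h2 => g _.
  by rewrite test_gaussE.
by apply: has_sum_ext h1 => l _; rewrite fourier_test_gauss.
Qed.

(** The density of the points at scale 1 / sg around [x], read on the spectral side; [gsum_cvg]
    identifies it with the sum of the unit-mass bumps at the points. *)
Definition dens sg x : R := complex.Re (Bsum (mgauss sg x)).

Lemma dens_bound : exists2 B : R, 0 <= B & forall sg x, 0 < sg -> sg <= 1 -> dens sg x <= B.
Proof.
have [K hK] := mgauss_bound; exists (`|K| * wB) => [|sg x sg0 sg1].
  by rewrite mulr_ge0 // (wB_ge0 tb).
apply: le_trans (ler_norm _) _; apply: le_trans (cmod_Re _) _.
apply: (Bsum_le tb) => g; apply: le_trans (hK sg x g sg0 sg1) (ler_norm _).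
Qed.

(** At [x = l] and [sg = 1] the point [l] alone contributes [c l] to the smoothed count, all other
    terms are nonnegative, and [dens_bound] bounds the total. *)
Lemma c_bound : exists Cb : nat, forall l, Lam l -> (c l <= Cb)%N.
Proof.
have [B B0 hB] := dens_bound; exists (Num.truncn B).+1 => l Ll.
rewrite -(ler_nat R); apply: (@le_trans _ _ B); last by rewrite ltW // truncnS_gt.
apply/ler_addgt0Pl => e e0.
have [F0 [fF0 F0L hF0]] := gauss_has_sum l ltr01 e0.
pose F := F0 `|` [set l].
have fF : finite_set F by rewrite finite_setU.
have FL : F `<=` Lam by move=> x [/F0L|->].
have := hF0 F fF (@subsetUl _ _ _) FL.
set f := fun x : R => (c x)%:R * (1 * expR (- (pi * 1 ^+ 2 * (l - x) ^+ 2))) : R.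
have -> : \sum_(x \in F) (c x)%:R * (1 * expR (- (pi * 1 ^+ 2 * (l - x) ^+ 2)))%:C%C =
    (\sum_(x \in F) f x)%:C%C :> CC R.
  rewrite !fsbig_finite // rmorph_sum; apply: eq_bigr => x _ /=.
  by rewrite /f [RHS]rmorphM rmorph_nat.
move=> h; have := le_lt_trans (cmod_Re _) h.
rewrite ReB /= => {}h.
have k1 := hB 1 l ltr01 (lexx _); rewrite /dens in k1.
have k2 : (c l)%:R <= \sum_(x \in F) f x.
  rewrite (fsbigD1 l) //=; last by right.
  have -> : f l = (c l)%:R by rewrite /f subrr expr0n mulr0 oppr0 expR0 !mulr1.
  by rewrite lerDl; apply: fsumr_ge0 => x _; rewrite !mulr_ge0 ?expR_ge0.
have := ler_norm (\sum_(x \in F) f x - complex.Re (Bsum (mgauss 1 l))); lra.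
Qed.

Lemma ssum_real (u : int -> R) M : ssum (fun n => (u n)%:C%C : C) M = (ssum u M)%:C%C.
Proof. by rewrite !ssum_ints rmorph_sum. Qed.

Definition gsum sg x M : R := ssum (fun n => sg * expR (- (pi * sg ^+ 2 * (x - a n) ^+ 2))) M.

Lemma gauss_small (al x e : R) : 0 < al -> 0 < e -> exists r : R, forall t, r <= `|t| ->
  expR (- (al * (x - t) ^+ 2)) <= e.
Proof.
move=> al0 e0; exists (`|x| + 1 + (al * e)^-1) => t ht.
have ae0 : 0 < (al * e)^-1 by rewrite invr_gt0 mulr_gt0.
have h1 : 1 + (al * e)^-1 <= `|x - t|.
  have := ler_normB t x; have := lerB_dist t x; rewrite distrC; lra.
have h2 : (al * e)^-1 <= (x - t) ^+ 2.
  rewrite -[leRHS]real_normK ?num_real // expr2.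
  apply: (@le_trans _ _ (1 * `|x - t|)); first lra.
  by apply: ler_wpM2r => //; lra.
rewrite expRN invf_ple ?posrE ?expR_gt0 //.
apply: (@le_trans _ _ (al * (x - t) ^+ 2)); last first.
  by have := expR_ge1Dx (al * (x - t) ^+ 2); lra.
apply: (@le_trans _ _ (al * (al * e)^-1)); last by apply: ler_wpM2l => //; exact: ltW.
by rewrite invfM mulrA mulfV ?gt_eqF // mul1r.
Qed.

Lemma gsum_ccvg sg x : 0 < sg -> ccvg (fun M => (gsum sg x M)%:C%C) (Bsum (mgauss sg x)).
Proof.
move=> sg0; have [Cb hCb] := c_bound.
have h := reindex_sum locfin cpos a_nd a_card a_Lam (gauss_has_sum x sg0) hCb.
apply: ccvg_ext (fun M => ssum_real _ M) _.
apply: h => e e0.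
have al0 : 0 < pi * sg ^+ 2 by rewrite mulr_gt0 ?pi_gt0 // exprn_gt0.
have [r hr] := gauss_small x al0 (divr_gt0 e0 sg0).
have [N hN] := a_infty locfin a_nd a_card a_Lam r; exists N => n Nn.
have [h1 h2] := hN n Nn; rewrite !cmodR !ger0_norm ?mulr_ge0 ?expR_ge0 ?(ltW sg0) //.
rewrite ![sg * _]mulrC -!ler_pdivlMr //; split; apply: hr.
  exact: le_trans h1 (ler_norm _).
by have := ler_norm (- a (- n%:Z)); rewrite normrN; lra.
Qed.

Lemma rcvg_Re (u : nat -> C) l : ccvg u l -> rcvg (fun n => complex.Re (u n)) (complex.Re l).
Proof.
move=> h e e0; have [N hN] := h e e0; exists N => n Nn.
by rewrite -ReB; exact: le_trans (cmod_Re _) (hN n Nn).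
Qed.

Lemma ccvg_real (u : nat -> R) l : ccvg (fun n => (u n)%:C%C : C) l -> l = (complex.Re l)%:C%C.
Proof.
move=> h; apply/eqP; rewrite eq_complex /= eqxx /= -normr_eq0.
rewrite eq_le normr_ge0 andbT; apply/ler_addgt0Pl => e e0; rewrite addr0.
have [N hN] := h e e0; have := le_trans (cmod_Im _) (hN N (leqnn _)).
by rewrite ImB /= sub0r normrN.
Qed.

Lemma gsum_cvg sg x : 0 < sg -> rcvg (gsum sg x) (dens sg x).
Proof. by move=> sg0; exact: rcvg_Re (gsum_ccvg x sg0). Qed.

Lemma dens_real sg x : 0 < sg -> Bsum (mgauss sg x) = (dens sg x)%:C%C.
Proof. by move=> sg0; exact: ccvg_real (gsum_ccvg x sg0). Qed.

Lemma ssum_le (u v : int -> R) M : (forall n, u n <= v n) -> ssum u M <= ssum v M.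
Proof. by move=> uv; rewrite !ssum_ints; apply: ler_sum => n _. Qed.

Lemma ssum_mono (u : int -> R) M M' : (forall n, 0 <= u n) -> (M <= M')%N -> ssum u M <= ssum u M'.
Proof.
move=> u0; elim: M' => [|M' IH]; first by rewrite leqn0 => /eqP ->.
rewrite leq_eqVlt => /orP[/eqP -> //|]; rewrite ltnS => /IH h.
by apply: le_trans h _; rewrite ssumS lerDl addr_ge0.
Qed.

Lemma gterm_ge0 sg x (n : int) : 0 < sg -> 0 <= sg * expR (- (pi * sg ^+ 2 * (x - a n) ^+ 2)).
Proof. by move=> sg0; rewrite mulr_ge0 ?expR_ge0 // ltW. Qed.

Lemma gsum_le sg x M : 0 < sg -> gsum sg x M <= dens sg x.
Proof.
move=> sg0; apply/ler_addgt0Pl => e e0; have [N hN] := gsum_cvg x sg0 e0.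
have h1 := ssum_mono (fun n => gterm_ge0 x n sg0) (leq_maxl M N).
have := hN _ (leq_maxr M N); rewrite -/(gsum sg x M) -/(gsum sg x (maxn M N)) in h1 *.
have := ler_norm (gsum sg x (maxn M N) - dens sg x); lra.
Qed.

(* The Fourier coefficient at frequency 0, i.e. the mean density of the points. *)
Definition beta0 : C := Bsum (fun g => (g == 0)%:R).
Definition beta : R := complex.Re beta0.

Lemma exp_sq_cvg0 (g : R) : g != 0 ->
  forall e : R, 0 < e -> exists N : nat, forall n, (N <= n)%N ->
    expR (- (pi / (n.+1%:R^-1) ^+ 2 * g ^+ 2)) <= e.
Proof.
move=> g0 e e0; pose al : R := pi * g ^+ 2.
have al0 : 0 < al by rewrite mulr_gt0 ?pi_gt0 // exprn_even_gt0.
have [r hr] := gauss_small 0 al0 e0; exists (Num.truncn `|r|) => n hn.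
have -> : pi / n.+1%:R^-1 ^+ 2 * g ^+ 2 = al * (0 - n.+1%:R) ^+ 2.
  by rewrite /al sub0r sqrrN exprVn invrK; ring.
apply: hr; rewrite ger0_norm //; apply: le_trans (ler_norm _) _.
by rewrite ltW // (lt_le_trans (truncnS_gt _)) // ler_nat ltnS.
Qed.

(** The centres are arbitrary because the phase is 1 at frequency 0, while away from 0 the Gaussian
    factor kills the term whatever the phase. *)
Lemma mgauss_cvg (x : nat -> R) (g : R) :
  ccvg (fun n => mgauss n.+1%:R^-1 (x n) g) ((g == 0)%:R).
Proof.
have [->|g0] := eqVneq g 0.
  apply: ccvg_ext (ccvg_cst _) => n; rewrite /mgauss expr0n mulr0 oppr0 expR0 mul1r.
  by rewrite mulr0 mulr0 mul0r ce0.
move=> e e0; have [N hN] := exp_sq_cvg0 g0 e0; exists N => n Nn.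
by rewrite subr0 cmod_mgauss; exact: hN.
Qed.

Lemma inv_le1 n : (n.+1%:R^-1 : R) <= 1.
Proof. by rewrite invf_le1 ?ltr0n // ler1n. Qed.

Lemma inv_gt0 n : 0 < (n.+1%:R^-1 : R).
Proof. by rewrite invr_gt0 ltr0n. Qed.

Lemma dens_seq_cvg (x : nat -> R) :
  ccvg (fun n => Bsum (mgauss n.+1%:R^-1 (x n))) beta0.
Proof.
have [K hK] := mgauss_bound.
apply: (Bsum_cvg tb (K := K)) => [n g|g]; last exact: mgauss_cvg.
by apply: hK; [exact: inv_gt0 | exact: inv_le1].
Qed.

Lemma beta0E : beta0 = beta%:C%C.
Proof.
apply: (@ccvg_real (fun n => dens n.+1%:R^-1 0)).
apply: ccvg_ext (dens_seq_cvg (fun=> 0)) => n.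
by rewrite dens_real //; exact: inv_gt0.
Qed.

(** By contradiction: bad centres x_n for sg = 1 / (n + 1) would contradict the convergence of
    [dens_seq_cvg] along arbitrary centres. *)
Lemma dens_unif (e : R) : 0 < e -> exists sg : R, [/\ 0 < sg, sg <= 1 &
  forall x, `|dens sg x - beta| <= e].
Proof.
move=> e0; apply: contrapT => H.
have /choice[x hx] : forall n : nat, exists x, e < `|dens n.+1%:R^-1 x - beta|.
  move=> n; apply: contrapT => h; apply: H; exists n.+1%:R^-1; split.
  - exact: inv_gt0.
  - exact: inv_le1.
  - by move=> x; rewrite leNgt; apply/negP => hx; apply: h; exists x.
have [N hN] := rcvg_Re (dens_seq_cvg x) e0.
have := hN N (leqnn _); rewrite -/(dens _ _) -/beta; have := hx N; lra.
Qed.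

Lemma sum_subset (T : eqType) (s t : seq T) (F : T -> R) : uniq s -> uniq t ->
  {subset s <= t} -> (forall x, 0 <= F x) -> \sum_(x <- s) F x <= \sum_(x <- t) F x.
Proof.
move=> us ut st F0; have pe : perm_eq s [seq x <- t | x \in s].
  apply: uniq_perm => //; first exact: filter_uniq.
  by move=> x; rewrite mem_filter; case: (boolP (x \in s)) => // /st ->.
rewrite (perm_big _ pe) /= big_filter big_mkcond; apply: ler_sum => x _.
by case: ifP.
Qed.

(** A primitive of [gsum] in [x]: its increment over an interval counts the points inside, up to
    smoothing at the ends. *)
Definition tsum sg x M : R := ssum (fun n => gcdf (sg * (x - a n))) M.

Lemma derive_tsum sg M x : is_derive x (1 : R) (fun t => tsum sg t M) (gsum sg x M).
Proof.
have h1 (n : int) : is_derive x (1 : R) (fun t => gcdf (sg * (t - a n)))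
    (sg * expR (- (pi * sg ^+ 2 * (x - a n) ^+ 2))).
  have hl : is_derive x (1 : R) (fun t : R => sg * (t - a n)) sg.
    apply: is_derive_eq (deriveZ_fun sg (deriveD_fun (is_derive_id x (1 : R))
      (is_derive_cst (- a n) x (1 : R)))) _.
    by rewrite addr0 mulr1.
  apply: is_derive_eq (derive_comp_fun (derive_gcdf _) hl) _.
  rewrite gaussE mulrC; congr (_ * expR (- _)); ring.
rewrite /tsum /gsum; elim: M => [|M IH].
  have -> : (fun t => ssum (fun n => gcdf (sg * (t - a n))) 0) = (fun t => gcdf (sg * (t - a 0))).
    by apply/funext => t; rewrite /ssum big_geq // addr0.
  by rewrite /ssum big_geq // addr0; exact: h1.
rewrite ssumS.
have -> : (fun t => ssum (fun n => gcdf (sg * (t - a n))) M.+1) = (fun t =>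
    ssum (fun n => gcdf (sg * (t - a n))) M +
    (gcdf (sg * (t - a M.+1%:Z)) + gcdf (sg * (t - a (- M.+1%:Z))))).
  by apply/funext => t; rewrite ssumS.
by apply: deriveD_fun => //; apply: deriveD_fun.
Qed.

Lemma a_mono (m n : int) : m <= n -> a m <= a n.
Proof. exact: a_le. Qed.

Definition intv (k : int) (j : nat) : seq int := [seq k + i%:Z | i <- iota 0 j].

Lemma intv_uniq k j : uniq (intv k j).
Proof. by rewrite map_inj_uniq ?iota_uniq // => x y; lia. Qed.

Lemma mem_intv k j n : (n \in intv k j) = (k <= n < k + j%:Z).
Proof.
apply/mapP/idP => [[i hi ->] | h]; first by rewrite mem_iota in hi; lia.
by exists `|n - k|%N; [rewrite mem_iota; lia | lia].
Qed.

(** Over the interval from a_k - K to a_(k + j) + K, each of the j + 1 points contributes at least 1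
    - 2 eta to the increment of [tsum], and the mean value theorem bounds this increment by [d1]
    times the length. *)
Lemma density_upper (sg d1 eta : R) : 0 < sg -> (forall x, dens sg x <= d1) -> 0 < eta ->
  exists2 K : R, 0 <= K & forall (k : int) (j : nat),
    j.+1%:R * (1 - 2 * eta) <= d1 * (a (k + j%:Z) - a k + 2 * K).
Proof.
move=> sg0 hd eta0.
have /cvgrPdist_le/(_ _ eta0)[N1 _ h1] := @cvg_gcdfNy R.
have /cvgrPdist_le/(_ _ eta0)[N2 _ h2] := @cvg_gcdfy R.
pose N := maxn N1 N2; pose K : R := N%:R / sg.
have K0 : 0 <= K by rewrite divr_ge0 // ltW.
have sK : sg * K = N%:R by rewrite /K mulrC divfK // gt_eqF.
have e1 : gcdf (- N%:R) <= eta.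
  by have := h1 N (leq_maxl _ _); rewrite /= sub0r normrN ger0_norm // gcdf_ge0.
have e2 : 1 - gcdf N%:R <= eta.
  by have := h2 N (leq_maxr _ _); rewrite /= ger0_norm // subr_ge0 gcdf_le1.
exists K => // k j; set m := k + j%:Z.
pose x := a k - K; pose y := a m + K.
have km : a k <= a m by apply: a_mono; lia.
have xy : x <= y by rewrite /x /y; lra.
pose M := maxn `|k| `|m|.
have [ti _ hti] := mean_value xy (derive_tsum sg M).
have u1 : tsum sg y M - tsum sg x M <= d1 * (a m - a k + 2 * K).
  rewrite hti (_ : y - x = a m - a k + 2 * K); last by rewrite /x /y; ring.
  by apply: ler_wpM2r; [lra | exact: le_trans (gsum_le ti M sg0) (hd ti)].
apply: le_trans u1.
have -> : tsum sg y M - tsum sg x M = \sum_(n <- ints M) (gcdf (sg * (y - a n)) - gcdf (sg * (x - a n))).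
  by rewrite /tsum !ssum_ints sumrB.
have u0 n : 0 <= gcdf (sg * (y - a n)) - gcdf (sg * (x - a n)).
  by rewrite subr_ge0; apply: gcdf_le; apply: ler_wpM2l; [exact: ltW | lra].
apply: le_trans (sum_subset (intv_uniq k j.+1) (ints_uniq M) _ u0); last first.
  by move=> n; rewrite mem_intv mem_ints /M /m; lia.
have -> : j.+1%:R * (1 - 2 * eta) = \sum_(n <- intv k j.+1) (1 - 2 * eta).
  by rewrite big_const_seq count_predT size_map size_iota iter_addr addr0 mulr_natl.
rewrite big_seq [leRHS]big_seq; apply: ler_sum => n; rewrite mem_intv => hn.
have an1 : a k <= a n by apply: a_mono; lia.
have an2 : a n <= a m by apply: a_mono; rewrite /m; lia.
have p1 : gcdf N%:R <= gcdf (sg * (y - a n)).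
  by apply: gcdf_le; rewrite -sK; apply: ler_wpM2l; [exact: ltW | rewrite /y; lra].
have p2 : gcdf (sg * (x - a n)) <= gcdf (- N%:R).
  by apply: gcdf_le; rewrite -sK -mulrN; apply: ler_wpM2l; [exact: ltW | rewrite /x; lra].
lra.
Qed.

(** The crude bound of [dens] at [sg = 1], with [eta = 1/4], already spreads the points linearly;
    clusters are absorbed by [C1]. *)
Lemma growth : exists k0 C1 : R, [/\ 0 < k0, 0 <= C1 &
  forall (k : int) (j : nat), k0 * j%:R - C1 <= a (k + j%:Z) - a k].
Proof.
have [B B0 hB] := dens_bound.
have hd x : dens 1 x <= B + 1 by have := hB 1 x ltr01 (lexx _); lra.
have q0 : 0 < (4^-1 : R) by rewrite invr_gt0.
have [K K0 hK] := density_upper ltr01 hd q0.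
have B1 : 0 < B + 1 by lra.
exists (2^-1 / (B + 1)), (2 * K); split; [by rewrite divr_gt0| lra|] => k j.
have h := hK k j; rewrite lerBlDr -(ler_pM2l B1).
have -> : (B + 1) * (2^-1 / (B + 1) * j%:R) = 2^-1 * j%:R by field; rewrite gt_eqF.
have : 0 <= j%:R :> R by [].
move: h; rewrite -natr1; lra.
Qed.

End Quasicrystal.

(** * Simultaneous almost periods of finitely many frequencies *)

Section AlmostPeriods.
Context {R : realType}.
Local Notation C := (R[i]).

Definition phase (u : R) : C := ce ('i%C * (2 * pi * u)%:C%C).

Lemma phaseD u v : phase (u + v) = phase u * phase v.
Proof. by rewrite /phase mulrDr rmorphD mulrDr ceD. Qed.

Lemma phaseE u : phase u = (cos (2 * pi * u) +i* sin (2 * pi * u))%C.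
Proof.
by rewrite /phase ceE !(ReM, ImM) /= !mul0r mulr0 subrr expR0 !mul1r add0r.
Qed.

Lemma phase_int (n : int) : phase n%:~R = 1.
Proof.
have hnat (k : nat) : phase k%:R = 1.
  elim: k => [|k IH]; first by rewrite /phase mulr0 mulr0 ce0.
  by rewrite -natr1 phaseD IH mul1r phaseE mulr1 mulr_natl cos2pi sin2pi.
case: n => k; first exact: hnat.
rewrite NegzE mulrNz -[LHS]mul1r -{1}(hnat k.+1) -phaseD.
by rewrite -pmulrn subrr /phase mulr0 mulr0 ce0.
Qed.

Lemma phase_sub1 u : cmod (phase u - 1) <= 4 * (2 * pi * `|u|) * expR (2 * pi * `|u|).
Proof.
have := cexp_sub1 ('i%C * (2 * pi * u)%:C%C : C).
by rewrite cmodM cmodi mul1r cmodR !normrM (ger0_norm (pi_ge0 R)) (ger0_norm (ler0n R 2)).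
Qed.

(* Pigeonhole: two times whose images in the torus lie in the same cell differ by
   an almost period, and there are finitely many cells. *)
Lemma almost_periods (r : seq R) (d : R) : 0 < d -> exists L : R, forall x : R, exists tau : R,
  x <= tau <= x + L /\ forall g, g \in r -> cmod (phase (g * tau) - 1) <= d.
Proof.
(* The mesh 1 / K of the cells is chosen so that [phase_sub1] at |u| <= 1 / K gives at most [d]. *)
move=> d0; pose K := (Num.truncn (8 * pi * expR (2 * pi) / d)).+1.
have K0 : 0 < K%:R :> R by rewrite ltr0n.
have hK (u : R) : `|u| <= K%:R^-1 -> cmod (phase u - 1) <= d.
  move=> hu; apply: le_trans (phase_sub1 u) _.
  have p0 : 0 < pi :> R := pi_gt0 R.
  have u1 : `|u| <= 1 by apply: le_trans hu _; rewrite invf_le1 // ler1n.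
  apply: (@le_trans _ _ (4 * (2 * pi * K%:R^-1) * expR (2 * pi))).
    apply: ler_pM; rewrite ?expR_ge0 ?ler_expR //.
    - by rewrite !mulr_ge0 // ltW.
    - by rewrite ler_pM2l // ler_pM2l // mulr_gt0.
    - by rewrite -[leRHS]mulr1 ler_pM2l // mulr_gt0.
  have -> : 4 * (2 * pi * K%:R^-1) * expR (2 * pi) = 8 * pi * expR (2 * pi) / K%:R :> R.
    by field; rewrite gt_eqF.
  by rewrite ler_pdivrMr // [leRHS]mulrC -ler_pdivrMr // ltW // /K truncnS_gt.
pose fr (u : R) : R := u - (Num.floor u)%:~R.
have fr0 u : 0 <= fr u by rewrite subr_ge0 floor_le.
have fr1 u : fr u < 1 by rewrite ltrBlDl -[X in _ + X]/((1 : int)%:~R : R) -rmorphD /= floorD1_gt.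
pose cl (u : R) : 'I_K := inord (Num.truncn (fr u * K%:R)).
have clK u : (Num.truncn (fr u * K%:R) < K)%N.
  rewrite -(ltr_nat R); apply: le_lt_trans (_ : fr u * K%:R < _).
    by rewrite truncn_le mulr_ge0 // ltW.
  by rewrite -[ltRHS]mul1r ltr_pM2r.
have cl_eq u v : cl u = cl v -> cmod (phase (u - v) - 1) <= d.
  move=> huv; have {}huv : Num.truncn (fr u * K%:R) = Num.truncn (fr v * K%:R).
    by have := congr1 val huv; rewrite /= !inordK.
  have -> : phase (u - v) = phase (fr u - fr v).
    have -> : u - v = (fr u - fr v) + (Num.floor u - Num.floor v)%:~R.
      by rewrite /fr rmorphB /=; ring.
    by rewrite phaseD phase_int mulr1.
  apply: hK; rewrite -(ler_pM2r K0) mulVf ?gt_eqF //.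
  rewrite -[X in _ * X]ger0_norm ?(ltW K0) // -normrM mulrBl.
  have bu w : (Num.truncn (fr w * K%:R))%:R <= fr w * K%:R < (Num.truncn (fr w * K%:R)).+1%:R.
    by apply: truncn_itv; rewrite mulr_ge0 // ltW.
  have /andP[u1 u2] := bu u; have /andP[v1 v2] := bu v.
  rewrite huv in u1 u2; rewrite -natr1 in u2 v2.
  by rewrite ler_norml; apply/andP; split; lra.
pose n := size r.
pose cell (t : R) : {ffun 'I_n -> 'I_K} := [ffun i : 'I_n => cl (nth 0 r i * t)].
have /choice[rep hrep] : forall k : {ffun 'I_n -> 'I_K}, exists t, forall s, cell s = k -> cell t = k.
  move=> k; have [[t ht]|h] := pselect (exists t, cell t = k); first by exists t.
  by exists 0 => s hs; exfalso; apply: h; exists s.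
(* One representative per cell, all of modulus at most [T]: subtracting from x + T the
   representative of its cell gives a [tau] between x and x + 2 T. *)
pose T := \sum_(k : {ffun 'I_n -> 'I_K}) `|rep k|.
have hT k : `|rep k| <= T by rewrite /T (bigD1 k) //= lerDl sumr_ge0.
exists (2 * T) => x; pose t := x + T; pose t' := rep (cell t).
have ht' : cell t' = cell t by apply: (hrep (cell t) t).
exists (t - t'); split.
  have := hT (cell t); rewrite -/t' ler_norml /t => /andP[h1 h2].
  by apply/andP; split; lra.
move=> g gr; have i0 : (index g r < n)%N by rewrite index_mem.
rewrite mulrBr; apply: cl_eq.
have := congr1 (fun f : {ffun 'I_n -> 'I_K} => f (Ordinal i0)) ht'.
by rewrite !ffunE /= nth_index.
Qed.

End AlmostPeriods.

(** * Bounded gaps and positive mean density *)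

Section Density.
Context {R : realType}.
Local Notation C := (R[i]).
Context {Lam : set R} {c : R -> nat} {Gam : set R} {b : R -> C} {a : int -> R}.
Context {qc : quasicrystal Lam c Gam b a}.

Let tb := qc_tempered (quasicrystal := qc).
Let a_nd := qc_nd (quasicrystal := qc).

Local Notation wt := (wt Gam b).
Local Notation wB := (wB Gam b).
Local Notation Bsum := (Bsum Gam b).
Local Notation dominated := (dominated Gam b).
Local Notation dens := (@dens R Gam b).
Local Notation gsum := (@gsum R a).
Local Notation beta := (@beta R Gam b).

(** Since |phase - 1| <= 2, dividing by 2 K brings the multiplier under [Bsum_tail]. The same
    frequencies serve all [m] bounded by [K], hence all points of a half-plane at once. *)
Lemma Bsum_ap (K e : R) : 0 < K -> 0 < e -> exists (r : seq R) (d : R), 0 < d /\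
  forall (tau : R) (m : R -> C), (forall g, cmod (m g) * wt g <= K) ->
    (forall g, g \in r -> cmod (phase (g * tau) - 1) <= d) ->
    cmod (Bsum (fun g => m g * (phase (g * tau) - 1))) <= e.
Proof.
move=> K0 e0; have B0 : 0 < 1 + wB by have := wB_ge0 tb; lra.
pose e1 := e / (1 + wB) / (2 * K).
have e10 : 0 < e1 by rewrite !divr_gt0 // mulr_gt0.
have [r hr] := Bsum_tail tb e10.
exists r, (2 * e1); split; first by rewrite mulr_gt0.
move=> tau m hm hg; pose k : C := ((2 * K)^-1)%:C%C.
have ph g : cmod (phase (g * tau) - 1) <= 2.
  apply: le_trans (cmodB _ _) _; rewrite cmod1 /phase cmod_ce !(ReM, ImM) /=.
  by rewrite !mul0r mulr0 subrr expR0.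
have K20 : 0 < 2 * K by rewrite mulr_gt0.
have ck : cmod k = (2 * K)^-1 by rewrite cmodR ger0_norm // invr_ge0 ltW.
have dm : dominated (fun g => m g * (phase (g * tau) - 1)).
  exists (K * 2) => g; rewrite cmodM mulrAC; apply: ler_pM; rewrite ?mulr_ge0 ?cmod_ge0 //.
  by rewrite ltW // wt_gt0.
have := hr (fun g => k * (m g * (phase (g * tau) - 1))).
rewrite BsumZ // cmodM ck => h.
have {}h : (2 * K)^-1 * cmod (Bsum (fun g => m g * (phase (g * tau) - 1))) <= e1 * (1 + wB).
  apply: h => g => [|gr]; rewrite !cmodM ck -mulrA ler_pdivrMl //.
    rewrite mulr1 mulrAC [2 * K]mulrC; apply: ler_pM; rewrite ?mulr_ge0 ?cmod_ge0 //.
    by rewrite ltW // wt_gt0.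
  rewrite mulrAC (_ : 2 * K * e1 = K * (2 * e1)); last ring.
  apply: ler_pM; rewrite ?mulr_ge0 ?cmod_ge0 ?hg //.
  by rewrite ltW // wt_gt0.
move: h; rewrite ler_pdivrMl // => /le_trans; apply.
by rewrite /e1 le_eqVlt; apply/orP; left; apply/eqP; field; rewrite !gt_eqF.
Qed.

Lemma ssum_diff_le (u v : int -> R) (K : R) M M' : (forall n, u n <= K * v n) -> (M <= M')%N ->
  ssum u M' - ssum u M <= K * (ssum v M' - ssum v M).
Proof.
move=> uv; elim: M' => [|M' IH]; first by rewrite leqn0 => /eqP ->; rewrite !subrr mulr0.
rewrite leq_eqVlt => /orP[/eqP <-|]; first by rewrite !subrr mulr0.
rewrite ltnS => /IH h; rewrite !ssumS.
have := uv M'.+1%:Z; have := uv (- M'.+1%:Z); lra.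
Qed.

(** Bumps whose centre varies within distance [d] of [t0] are dominated by one bump of twice the
    width at [t0], because (p - q)^2 <= 2 p^2 + 2 q^2. *)
Lemma gauss_shift (sg t t0 y d : R) : 0 < sg -> `|t - t0| <= d ->
  sg * expR (- (pi * sg ^+ 2 * (t - y) ^+ 2)) <=
  2 * expR (pi * sg ^+ 2 * d ^+ 2) * (sg / 2 * expR (- (pi * (sg / 2) ^+ 2 * (t0 - y) ^+ 2))).
Proof.
move=> sg0 hd.
have -> : 2 * expR (pi * sg ^+ 2 * d ^+ 2) * (sg / 2 * expR (- (pi * (sg / 2) ^+ 2 * (t0 - y) ^+ 2))) =
  sg * expR (pi * sg ^+ 2 * d ^+ 2 - (pi * (sg / 2) ^+ 2 * (t0 - y) ^+ 2)).
  by rewrite expRD; field.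
rewrite ler_pM2l // ler_expR.
have -> : pi * (sg / 2) ^+ 2 * (t0 - y) ^+ 2 = pi * sg ^+ 2 * ((t0 - y) ^+ 2 / 4) by field.
rewrite -mulrBr -mulrN; apply: ler_wpM2l; first by rewrite mulr_ge0 ?pi_ge0 // sqr_ge0.
have h1 : (t - t0) ^+ 2 <= d ^+ 2.
  by rewrite -[leLHS]real_normK ?num_real // lerXn2r // nnegrE // (le_trans _ hd).
have := sqr_ge0 ((t - y) + (t - t0)); have := sqr_ge0 (t - y); have := sqr_ge0 (t - t0).
have -> : t0 - y = (t - y) - (t - t0) by ring.
move: h1; move: (t - y) (t - t0) => p q; nra.
Qed.

(* By almost periodicity of the smoothed measure. *)
Lemma a_gaps : exists2 G : R, 0 < G & forall x : R, exists n : int, `|a n - x| <= G.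
Proof.
have [K hK] := @mgauss_bound R Gam b.
have K0 : 0 < `|K| + 1 by rewrite ltr_wpDl.
have e0 : 0 < (2^-1 : R) by rewrite invr_gt0.
have [r [d [d0 hr]]] := Bsum_ap K0 e0.
have [L hL] := almost_periods r d0.
have [B B0 hB] := @dens_bound R Lam c Gam b a qc.
(* 3 pi / 4 is the gap between the exponents pi and pi / 4 of the parameters 1 and 1/2. If all
   points are far from y, the narrow sum is a tiny multiple of the wide one, which [B] bounds. *)
have al0 : 0 < (3 / 4 * pi : R) by rewrite mulr_gt0 ?pi_gt0 // divr_gt0.
have q0 : 0 < (8 * (B + 1))^-1 by rewrite invr_gt0 mulr_gt0 //; lra.
have [K1 hK1] := gauss_small 0 al0 q0.
exists (`|K1| + 1 + `|L|) => [|x]; first by rewrite ltr_wpDr // ltr_wpDl.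
have [tau [/andP[t1 t2] ht]] := hL (x - a 0).
(* The point [a 0] alone makes [dens 1] at least 1 there; the almost period [tau], taken near
   [x - a 0], carries at least half of this to [y], at most [L] to the right of [x]. *)
pose y := a 0 + tau.
have dy : 2^-1 <= dens 1 y.
  have d1 : 1 <= dens 1 (a 0).
    apply: le_trans (gsum_le (a 0) 0 ltr01); rewrite /gsum /ssum big_geq // addr0.
    by rewrite subrr expr0n mulr0 oppr0 expR0 mulr1.
  have hm g : cmod (mgauss 1 (a 0) g) * wt g <= `|K| + 1.
    by have := hK 1 (a 0) g ltr01 (lexx _); have := ler_norm K; lra.
  have := hr tau _ hm ht.
  have -> : Bsum (fun g => mgauss 1 (a 0) g * (phase (g * tau) - 1)) =
      Bsum (mgauss 1 y) - Bsum (mgauss 1 (a 0)).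
    rewrite -BsumB //; try exact: mgauss_dominated.
    apply: eq_Bsum => g; rewrite mulrBr mulr1 /mgauss; congr (_ - _).
    rewrite /phase -[_ * _ * ce _]mulrA -ceD; congr (_ * ce _).
    by rewrite /y !rmorphM rmorphD; ring.
  move=> h; have := le_trans (cmod_Re _) h; rewrite ReB -!/(dens _ _) => {}h.
  have := ler_norm (- (dens 1 y - dens 1 (a 0))); rewrite normrN; lra.
apply: contrapT => hn.
have far n : `|K1| + 1 <= `|y - a n|.
  rewrite leNgt; apply/negP => hy; apply: hn; exists n.
  have -> : a n - x = - (y - a n) + (y - x) by ring.
  apply: le_trans (ler_normD _ _) _; rewrite normrN.
  have : `|y - x| <= `|L|; last by lra.
  rewrite ger0_norm /y; last by lra.
  by apply: le_trans (ler_norm _); lra.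
have hM M : gsum 1 y M <= 4^-1.
  apply: (@le_trans _ _ ((8 * (B + 1))^-1 * 2 * gsum 2^-1 y M)).
    have := @ssum_le R (fun n => 1 * expR (- (pi * 1 ^+ 2 * (y - a n) ^+ 2)))
      (fun n => (8 * (B + 1))^-1 * 2 * (2^-1 * expR (- (pi * 2^-1 ^+ 2 * (y - a n) ^+ 2)))) M.
    rewrite -/(gsum 1 y M) => h; apply: le_trans (h _) _.
      move=> n; rewrite mul1r.
      have -> : - (pi * 1 ^+ 2 * (y - a n) ^+ 2) =
        - (3 / 4 * pi * (0 - (y - a n)) ^+ 2) + - (pi * 2^-1 ^+ 2 * (y - a n) ^+ 2) by field.
      rewrite expRD mulrA -[_ * 2 * _]mulrA mulfV // mulr1.
      apply: ler_wpM2r; first exact: expR_ge0.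
      by apply: hK1; apply: le_trans (ler_norm _) _; have := far n; lra.
    by rewrite /gsum !ssum_ints mulr_sumr.
  have h1 : gsum 2^-1 y M <= B.
    apply: le_trans (gsum_le _ _ _) (hB _ _ _ _); rewrite ?invr_gt0 //.
    by rewrite invf_le1 // ler1n.
  rewrite -mulrA ler_pdivrMl ?mulr_gt0 //; lra.
have e8 : 0 < (8^-1 : R) by rewrite invr_gt0.
have [N hN] := gsum_cvg y ltr01 e8.
have := hN N (leqnn _); have := hM N.
have := ler_norm (- (gsum 1 y N - dens 1 y)); rewrite normrN.
by rewrite (_ : (8^-1 : R) = 4^-1 / 2); [lra | field].
Qed.

(** The midpoint of two consecutive points lies within [G] of some point, and every point is on one
    side or the other of the pair. *)
Lemma a_step : exists2 G : R, 0 < G & forall (k : int) (j : nat), a (k + j%:Z) - a k <= G * j%:R.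
Proof.
have [G G0 hG] := a_gaps; exists (2 * G) => [|k]; first by rewrite mulr_gt0.
have step (n : int) : a (n + 1) - a n <= 2 * G.
  have [m hm] := hG ((a n + a (n + 1)) / 2).
  have [mn|mn] := leP m n.
    have := a_le (a := a) a_nd mn; move: hm; rewrite ler_norml => /andP[]; lra.
  have h1 : n + 1 <= m by lia.
  have := a_le (a := a) a_nd h1; move: hm; rewrite ler_norml => /andP[]; lra.
elim=> [|j IH]; first by rewrite addr0 subrr mulr0.
have := step (k + j%:Z); have -> : k + j%:Z + 1 = k + j.+1%:Z by lia.
move: IH; rewrite -[j.+1%:R]natr1; lra.
Qed.

(** Otherwise the density at some scale would stay below 1 / (4 G); by [density_upper] with 1 - 2
    eta = 3/4, j + 1 consecutive points would then span at least 3 G (j + 1) - 2 K, against the G j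
    of [a_step]. *)
Lemma beta_gt0 : 0 < beta.
Proof.
rewrite ltNge; apply/negP => b0.
have [G G0 hG] := a_step.
have e0 : 0 < (4 * G)^-1 by rewrite invr_gt0 mulr_gt0.
have [sg [sg0 sg1 hsg]] := dens_unif e0.
have hd x : dens sg x <= (4 * G)^-1.
  by have := hsg x; have := ler_norm (dens sg x - beta); lra.
have q0 : 0 < (8^-1 : R) by rewrite invr_gt0.
have [K K0 hK] := density_upper sg0 hd q0.
pose j := Num.truncn (K / G).
have := hK 0 j; have := hG 0 j.
have hj : K / G < j.+1%:R by exact: truncnS_gt.
rewrite ltr_pdivrMr // in hj.
move=> h1 h2; have {}h2 : G * (j.+1%:R * (1 - 2 * 8^-1)) <= G * ((4 * G)^-1 * (a (0 + j%:Z) - a 0 + 2 * K)).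
  by apply: ler_wpM2l => //; exact: ltW.
have hE : G * ((4 * G)^-1 * (a (0 + j%:Z) - a 0 + 2 * K)) = (a (0 + j%:Z) - a 0 + 2 * K) / 4.
  by field; rewrite gt_eqF.
rewrite hE in h2; rewrite -natr1 in h2 hj.
have : G * (1 - 2 * 8^-1) = G * (3 / 4) by congr (_ * _); field.
lra.
Qed.

End Density.

(** * Balance of the two halves of the enumeration *)

Section Pairing.
Context {R : realType}.
Local Notation C := (R[i]).
Context {Lam : set R} {c : R -> nat} {Gam : set R} {b : R -> C} {a : int -> R}.
Context {qc : quasicrystal Lam c Gam b a}.

Let a_nd := qc_nd (quasicrystal := qc).

Local Notation dens := (@dens R Gam b).
Local Notation gsum := (@gsum R a).
Local Notation tsum := (@tsum R a).
Local Notation beta := (@beta R Gam b).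

Lemma nat_geom (q : R) (s : seq nat) J : 0 < q < 1 -> uniq s -> (forall i, i \in s -> (i < J)%N) ->
  \sum_(i <- s) q ^+ i <= (1 - q)^-1.
Proof.
move=> /andP[q0 q1] us sJ; have q2 : 0 < 1 - q by lra.
have hi i : 0 <= q ^+ i by rewrite exprn_ge0 // ltW.
apply: le_trans (sum_subset us (iota_uniq 0 J) _ hi) _.
  by move=> i /sJ; rewrite mem_iota.
have h : \sum_(i <- iota 0 J) q ^+ i = (1 - q ^+ J) / (1 - q).
  have -> : iota 0 J = index_iota 0 J by rewrite /index_iota subn0.
  elim: J {sJ} => [|J IH]; first by rewrite big_geq // expr0 subrr mul0r.
  by rewrite big_nat_recr //= IH exprSr; field; rewrite gt_eqF.
by rewrite h -[leRHS]mul1r ler_pM2r ?invr_gt0 // gerBl.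
Qed.

Lemma int_geom (q : R) (m : int) M : 0 < q < 1 ->
  \sum_(n <- ints M) q ^+ `|n - m|%N <= 2 * (1 - q)^-1.
Proof.
move=> hq; rewrite (bigID (fun n : int => m <= n)) /= mulr_natl mulr2n.
have bnd (n : int) : n \in ints M -> (`|n - m| < M + `|m| + 1)%N by rewrite mem_ints; lia.
apply: lerD.
  rewrite -big_filter -(big_map (fun n : int => `|n - m|%N) xpredT (fun i => q ^+ i)).
  apply: (@nat_geom _ _ (M + `|m| + 1)) => // [|i].
    rewrite map_inj_in_uniq ?filter_uniq ?ints_uniq // => x y.
    by rewrite !mem_filter => /andP[? _] /andP[? _]; lia.
  by case/mapP => n; rewrite mem_filter => /andP[_ /bnd h] ->.
rewrite -big_filter -(big_map (fun n : int => `|n - m|%N) xpredT (fun i => q ^+ i)).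
apply: (@nat_geom _ _ (M + `|m| + 1)) => // [|i].
  rewrite map_inj_in_uniq ?filter_uniq ?ints_uniq // => x y.
  by rewrite !mem_filter => /andP[? _] /andP[? _]; lia.
by case/mapP => n; rewrite mem_filter => /andP[_ /bnd h] ->.
Qed.

(** Uniformity in [t] is needed because the mean value theorem evaluates [gsum] at a point that is
    not controlled. [gauss_shift] reduces it to the convergence of a wider sum at the single centre
    [x]. *)
Lemma gsum_unif (sg x y e : R) : 0 < sg -> 0 < e -> exists M0 : nat, forall M t, (M0 <= M)%N ->
  x <= t <= y -> dens sg t - e <= gsum sg t M.
Proof.
move=> sg0 e0; have s20 : 0 < sg / 2 by rewrite divr_gt0.
set d := y - x; pose K := 2 * expR (pi * sg ^+ 2 * d ^+ 2).
have K0 : 0 < K by rewrite mulr_gt0 ?expR_gt0.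
have [M0 hM0] := gsum_cvg x s20 (divr_gt0 e0 K0).
exists M0 => M t MM /andP[xt ty]; have td : `|t - x| <= d by rewrite ger0_norm /d; lra.
apply/ler_addgt0Pl => e1 e10.
have [N hN] := gsum_cvg t sg0 e10.
have h1 : gsum sg t (maxn M N) - gsum sg t M <= K * (gsum (sg / 2) x (maxn M N) - gsum (sg / 2) x M).
  by apply: ssum_diff_le; [move=> n; apply: gauss_shift | exact: leq_maxl].
have h2 : gsum (sg / 2) x (maxn M N) - gsum (sg / 2) x M <= e / K.
  have k1 : gsum (sg / 2) x (maxn M N) <= dens (sg / 2) x := gsum_le _ _ s20; have k2 := hM0 M MM.
  apply: le_trans (_ : dens (sg / 2) x - gsum (sg / 2) x M <= _); first by rewrite lerD2r; exact: k1.
  apply: le_trans (ler_norm _) _.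
  by rewrite distrC.
have h3 : K * (gsum (sg / 2) x (maxn M N) - gsum (sg / 2) x M) <= e.
  by rewrite mulrC -ler_pdivlMr.
have := hN _ (leq_maxr M N).
have := ler_norm (- (gsum sg t (maxn M N) - dens sg t)); rewrite normrN; lra.
Qed.

Lemma int_addK (n k : int) : n <= k -> n + `|(n - k)%R|%N%:Z = k.
Proof. lia. Qed.

(** The j + 1 indices from k to k + j contribute at most 1 each to the increment of [tsum]. By
    [growth], the others decay geometrically with their distance to the end indices, so [C0] depends
    on neither [k] nor [j]. *)
Lemma density_lower (sg d0 : R) : 0 < sg -> (forall x, d0 <= dens sg x) ->
  exists2 C0 : R, 0 <= C0 & forall (k : int) (j : nat), d0 * (a (k + j%:Z) - a k) <= j%:R + C0.
Proof.
move=> sg0 hd; have [k0 [C1 [k00 C10 hg]]] := @growth R Lam c Gam b a qc.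
have [A1 A10 hA1] := @gcdf_tailN R 1 ltr01; have [A2 A20 hA2] := @gcdf_tailP R 1 ltr01.
pose q := expR (- (sg * k0)); pose A := (A1 + A2) * expR (sg * C1).
have hq : 0 < q < 1 by rewrite expR_gt0 expR_lt1 oppr_lt0 mulr_gt0.
have A0 : 0 <= A by rewrite mulr_ge0 ?expR_ge0 // addr_ge0.
have q1 : 0 < (1 - q)^-1 by rewrite invr_gt0; move: hq => /andP[_]; lra.
exists (1 + A * (2 * (1 - q)^-1 + 2 * (1 - q)^-1)) => [|k j].
  by rewrite addr_ge0 // mulr_ge0 // addr_ge0 // mulr_ge0 // ltW.
set m := k + j%:Z.
have km : a k <= a m by apply: (a_le (a := a) a_nd); rewrite lerDl.
have upper M : tsum sg (a m) M - tsum sg (a k) M <=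
    j%:R + (1 + A * (2 * (1 - q)^-1 + 2 * (1 - q)^-1)).
  have -> : tsum sg (a m) M - tsum sg (a k) M =
    \sum_(n <- ints M) (gcdf (sg * (a m - a n)) - gcdf (sg * (a k - a n))).
    by rewrite /tsum !ssum_ints sumrB.
  apply: (@le_trans _ _ (\sum_(n <- ints M) ((n \in intv k j.+1)%:R +
      A * (q ^+ `|n - m|%N + q ^+ `|n - k|%N)))).
    apply: ler_sum => n _; rewrite mem_intv.
    have g1 := gcdf_le1 (sg * (a m - a n)); have g2 := gcdf_ge0 (sg * (a k - a n)).
    have qn i : 0 <= q ^+ i by rewrite exprn_ge0 // ltW; case/andP: hq.
    have Aq : 0 <= A * (q ^+ `|n - m|%N + q ^+ `|n - k|%N) by rewrite mulr_ge0 // addr_ge0.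
    have [nk|nk] := leP k n; last first.
      rewrite add0r.
      have := hg n `|(n - k)%R|%N; rewrite int_addK; last exact: ltW.
      move=> h; have akn : a n <= a k by apply: (a_le (a := a) a_nd); exact: ltW.
      have s0 : 0 <= sg * (a k - a n) by rewrite mulr_ge0 ?subr_ge0 // ltW.
      have := hA2 _ s0; rewrite mul1r => h2.
      have h3 : A2 * expR (- (sg * (a k - a n))) <= A * q ^+ `|n - k|%N.
        rewrite /A /q -expRM_natl -mulrA -expRD.
        apply: ler_pM; rewrite ?expR_ge0 //; first lra.
        rewrite ler_expR; have := ler_wpM2l (ltW sg0) h; lra.
      apply: (@le_trans _ _ (A * q ^+ `|n - k|%N)); last by apply: ler_wpM2l => //; rewrite lerDr.
      by apply: le_trans h3; apply: le_trans h2; rewrite lerD2r.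
    have [nm|nm] := ltP n (k + j.+1%:Z); first by rewrite /= -[leLHS]addr0; apply: lerD => //; rewrite lerBlDr (le_trans g1) // lerDl.
    rewrite add0r.
    have mn : m <= n by apply: le_trans nm; rewrite /m lerD2l lez_nat.
    have := hg m `|(n - m)%R|%N; rewrite distnC int_addK // distnC.
    move=> h; have amn : a m <= a n by apply: (a_le (a := a) a_nd).
    have s0 : sg * (a m - a n) <= 0 by rewrite mulr_ge0_le0 ?subr_le0 // ltW.
    have := hA1 _ s0; rewrite mul1r => h2.
    have h3 : A1 * expR (sg * (a m - a n)) <= A * q ^+ `|n - m|%N.
      rewrite /A /q -expRM_natl -mulrA -expRD.
      apply: ler_pM; rewrite ?expR_ge0 //; first lra.
      rewrite ler_expR; have := ler_wpM2l (ltW sg0) h; lra.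
    apply: (@le_trans _ _ (A * q ^+ `|n - m|%N)); last by apply: ler_wpM2l => //; rewrite lerDl.
    by apply: le_trans h3; apply: le_trans h2; rewrite lerBlDr lerDl.
  rewrite big_split /= -mulr_sumr big_split /=.
  have h1 : \sum_(n <- ints M) (n \in intv k j.+1)%:R <= j%:R + 1 :> R.
    have -> : \sum_(n <- ints M) (n \in intv k j.+1)%:R = \sum_(n <- [seq n <- ints M | n \in intv k j.+1]) (1 : R).
      by rewrite big_filter [RHS]big_mkcond; apply: eq_bigr => n _; case: ifP.
    rewrite big_const_seq count_predT iter_addr addr0 natr1 ler_nat.
    apply: (@leq_trans (size (intv k j.+1))); last by rewrite size_map size_iota.
    apply: uniq_leq_size; first by rewrite filter_uniq // ints_uniq.
    by move=> n; rewrite mem_filter; case/andP.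
  have h2 := int_geom m M hq; have h3 := int_geom k M hq.
  by rewrite addrA; apply: lerD => //; apply: ler_wpM2l => //; apply: lerD.
apply/ler_addgt0Pl => e e0.
have D1 : 0 < a m - a k + 1 by lra.
have [M0 hM0] := gsum_unif (a k) (a m) sg0 (divr_gt0 e0 D1).
have [ti hti hE] := mean_value km (derive_tsum (a := a) sg M0).
apply: le_trans (_ : e + (tsum sg (a m) M0 - tsum sg (a k) M0) <= _); last by rewrite lerD2l.
rewrite hE; have h := hM0 M0 ti (leqnn _) hti; have h' := hd ti.
have h2 : (d0 - e / (a m - a k + 1)) * (a m - a k) <= gsum sg ti M0 * (a m - a k).
  by apply: ler_wpM2r; lra.
have h3 : e / (a m - a k + 1) * (a m - a k) <= e.
  rewrite -[leRHS](divfK (x := a m - a k + 1)) ?gt_eqF //.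
  by apply: ler_wpM2l; [rewrite divr_ge0 // ltW | lra].
lra.
Qed.

(** [X] and [Y] are both n / be up to relative errors of order [e]; the smallness of [e] says that 1
    / (be - e) exceeds (1 - 2 e) / (be + e) by at most [d]. *)
Lemma pairing_aux (be e d n X Y C1 K : R) : 0 < be -> 0 < d -> 0 < e -> e <= be / 2 ->
  e * (4 * (1 + be)) <= d * be ^+ 2 -> 0 <= n ->
  (be - e) * X <= n + C1 -> n * (1 - 2 * e) <= (be + e) * (Y + K) ->
  X - Y <= d * n + (C1 / (be - e) + K).
Proof.
move=> be0 d0 e0 e1 e2 n0 hX hY.
have m0 : 0 < be - e by lra.
have p0 : 0 < be + e by lra.
have {}hX : X <= (n + C1) / (be - e) by rewrite ler_pdivlMr // mulrC.
have {}hY : n * (1 - 2 * e) / (be + e) <= Y + K by rewrite ler_pdivrMr // mulrC [leRHS]mulrC mulrC.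
have key : (be - e)^-1 <= (1 - 2 * e) / (be + e) + d.
  rewrite -subr_ge0.
  have -> : (1 - 2 * e) / (be + e) + d - (be - e)^-1 =
    ((1 - 2 * e) * (be - e) + d * (be ^+ 2 - e ^+ 2) - (be + e)) / ((be + e) * (be - e)).
    by field; rewrite !gt_eqF.
  apply: divr_ge0; last by rewrite mulr_ge0 // ltW.
  have h1 : e ^+ 2 <= be ^+ 2 / 4.
    have -> : be ^+ 2 / 4 = (be / 2) ^+ 2 by field.
    by rewrite lerXn2r // nnegrE ltW // divr_gt0.
  have h2 : d * (be ^+ 2 - be ^+ 2 / 4) <= d * (be ^+ 2 - e ^+ 2).
    by apply: ler_wpM2l; [exact: ltW | lra].
  have h3 : 0 <= d * be ^+ 2 by rewrite mulr_ge0 ?sqr_ge0 // ltW.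
  have h4 := sqr_ge0 e.
  have -> : (1 - 2 * e) * (be - e) = be - e - 2 * e * be + 2 * e ^+ 2 by ring.
  lra.
have := ler_wpM2l n0 key.
rewrite mulrDl in hX; rewrite -mulrA in hY.
move: hX hY; rewrite mulrDr [n * d]mulrC.
move: (C1 / (be - e)) (n / (be - e)) (n * ((1 - 2 * e) / (be + e))) (d * n) => u v w p.
lra.
Qed.

Lemma pairing (d : R) : 0 < d -> exists2 C0 : R, 0 <= C0 &
  forall n : nat, `|a n%:Z + a (- n%:Z)| <= d * n%:R + C0.
Proof.
move=> d0; have be0 : 0 < beta by exact: beta_gt0.
pose e := Num.min 4^-1 (Num.min (beta / 2) (d * beta ^+ 2 / (4 * (1 + beta)))).
have b1 : 0 < 4 * (1 + beta) by lra.
have e0 : 0 < e.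
  by rewrite !lt_min invr_gt0 ltr0n divr_gt0 //= divr_gt0 // mulr_gt0 // exprn_gt0.
have [e1 e2 e3] : [/\ e <= 4^-1, e <= beta / 2 & e <= d * beta ^+ 2 / (4 * (1 + beta))].
  by rewrite /e; split; rewrite !ge_min lexx ?orbT.
rewrite ler_pdivlMr // in e3.
have [sg [sg0 sg1 hsg]] := dens_unif e0.
have hd1 x : dens sg x <= beta + e.
  by have := hsg x; have := ler_norm (dens sg x - beta); lra.
have hd2 x : beta - e <= dens sg x.
  by have := hsg x; have := ler_norm (- (dens sg x - beta)); rewrite normrN; lra.
have [K K0 hU] := density_upper sg0 hd1 e0.
have [C1 C10 hL] := density_lower sg0 hd2.
have m0 : 0 < beta - e by lra.
exists (C1 / (beta - e) + 2 * K + 2 * `|a 0|) => [|n].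
  by rewrite !addr_ge0 // mulr_ge0 // invr_ge0 ltW.
pose X := a n%:Z - a 0; pose Y := a 0 - a (- n%:Z).
have n0 : 0 <= n%:R :> R by [].
have L1 := hL 0 n; have L2 := hL (- n%:Z) n.
have U1 := hU 0 n; have U2 := hU (- n%:Z) n.
rewrite add0r -/X in L1 U1; rewrite addNr -/Y in L2 U2.
have s1 : n%:R * (1 - 2 * e) <= n.+1%:R * (1 - 2 * e).
  by apply: ler_wpM2r; [lra | rewrite ler_nat].
have h1 := pairing_aux be0 d0 e0 e2 e3 n0 L1 (le_trans s1 U2).
have h2 := pairing_aux be0 d0 e0 e2 e3 n0 L2 (le_trans s1 U1).
have -> : a n%:Z + a (- n%:Z) = (X - Y) + 2 * a 0 by rewrite /X /Y; ring.
apply: le_trans (ler_normD _ _) _; rewrite normrM ger0_norm //.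
have : `|X - Y| <= d * n%:R + (C1 / (beta - e) + 2 * K) by rewrite ler_norml; lra.
lra.
Qed.

End Pairing.

(** * From Gaussian to symmetric summation *)

Section TauberEstimates.
Context {R : realType}.
Local Notation C := (R[i]).

Lemma expRN_inv (x : R) : 0 < x -> expR (- x) <= x^-1.
Proof.
by move=> x0; rewrite expRN lef_pV2 ?posrE ?expR_gt0 //; have := expR_ge1Dx x; lra.
Qed.

Lemma expRN_inv2 (x : R) : 0 < x -> expR (- x) <= 2 / x ^+ 2.
Proof.
move=> x0; rewrite expRN -[leRHS]invf_div lef_pV2 ?posrE ?expR_gt0 ?divr_gt0 ?exprn_gt0 //.
by rewrite ler_pdivrMr // mulrC; exact: exprn_le_expR 2 (ltW x0).
Qed.

Lemma expRN_dist (x y B : R) : expR (- x) <= B -> expR (- y) <= B ->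
  `|expR (- x) - expR (- y)| <= `|x - y| * B.
Proof.
wlog xy : x y / x <= y => [H|] hx hy.
  by case/orP: (le_total x y) => h; [|rewrite distrC [X in _ <= X * _]distrC]; apply: H.
have e0 := expR_ge0 (- x).
have -> : expR (- y) = expR (- x) * expR (- (y - x)) by rewrite -expRD; congr expR; ring.
have h1 := expR_ge1Dx (- (y - x)).
have h2 : expR (- (y - x)) <= 1 by rewrite -[leRHS]expR0 ler_expR; lra.
rewrite -[X in `|X - _|]mulr1 -mulrBr normrM ger0_norm // mulrC [`|1 - _|]ger0_norm ?subr_ge0 //.
rewrite [`|x - y|]distrC [`|y - x|]ger0_norm ?subr_ge0 //.
by apply: ler_pM => //; lra.
Qed.

Variable z : C.
Hypothesis z0 : 0 < complex.Im z.

Let K1 := 1 + cmod z / complex.Im z.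

Lemma zsub_Im (p : R) : complex.Im z <= cmod (z - p%:C%C).
Proof. by apply: le_trans (cmod_Im _); rewrite ImB subr0 ler_norm. Qed.

Lemma zsub_neq0 (p : R) : z - p%:C%C != 0.
Proof.
apply/eqP => h; have := zsub_Im p; rewrite h cmod0 => /(lt_le_trans z0).
by rewrite ltxx.
Qed.

Lemma zsub_cmod_gt0 (p : R) : 0 < cmod (z - p%:C%C).
Proof. exact: lt_le_trans z0 (zsub_Im p). Qed.

Lemma zsub_ge (p : R) : `|p| <= K1 * cmod (z - p%:C%C).
Proof.
rewrite /K1 mulrDl mul1r -cmodR; apply: le_trans (cmod_rtri _ z) _.
rewrite addrC cmod_dist; apply: lerD => //.
rewrite mulrAC -mulrA ler_peMr ?cmod_ge0 //.
by rewrite ler_pdivlMr // mul1r zsub_Im.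
Qed.

Lemma K1_ge0 : 0 <= K1. Proof. by rewrite addr_ge0 // divr_ge0 ?cmod_ge0 // ltW. Qed.

Let Q (s p : R) : C := ce (- s%:C%C * (z - p%:C%C) ^+ 2).
Let q (s p : R) : R := expR (- (s * p ^+ 2)).

(** Q = q e^w with w = - s (z^2 - 2 p z) only linear in [p]: so |w| / |z - p| is O(s) although [p]
    is unbounded, and e^|w| consumes at most half of the Gaussian exponent, up to a constant since s
    <= pi. *)
Lemma gauss_kernel_dist : exists2 K : R, 0 <= K & forall s p : R, 0 < s -> s <= pi ->
  cmod ((Q s p - (q s p)%:C%C) / (z - p%:C%C)) <= K * s * expR (- (s * p ^+ 2 / 2)).
Proof.
have c0 := cmod_ge0 z.
pose A := cmod z ^+ 2 / complex.Im z + 2 * cmod z * K1.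
have A0 : 0 <= A.
  by rewrite addr_ge0 // ?mulr_ge0 ?K1_ge0 ?sqr_ge0 // invr_ge0 ltW.
exists (4 * A * expR (pi * (3 * cmod z ^+ 2))) => [|s p s0 s1].
  by rewrite !mulr_ge0 ?expR_ge0.
pose w : C := - s%:C%C * (z ^+ 2 - (2 * p)%:C%C * z).
have -> : Q s p = (q s p)%:C%C * ce w.
  have -> : (q s p)%:C%C = ce (- (s * p ^+ 2))%:C%C by rewrite ceE /= cos0 sin0 mulr1 mulr0.
  rewrite /Q -ceD; congr ce; rewrite /w !(rmorphN, rmorphM, rmorphXn) /= rmorph_nat; ring.
have -> : cmod (((q s p)%:C%C * ce w - (q s p)%:C%C) / (z - p%:C%C)) =
    q s p * (cmod (ce w - 1) / cmod (z - p%:C%C)).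
  rewrite -{2}[(q s p)%:C%C]mulr1 -mulrBr !cmodM cmodV cmodR ger0_norm ?expR_ge0 //.
  by rewrite mulrA.
have cw : cmod w <= s * (cmod z ^+ 2 + 2 * `|p| * cmod z).
  rewrite /w cmodM cmodN cmodR ger0_norm ?(ltW s0) // ler_pM2l //.
  apply: le_trans (cmodB _ _) _; rewrite cmodX cmodM cmodR normrM ger0_norm //.
have hw : cmod w / cmod (z - p%:C%C) <= s * A.
  rewrite ler_pdivrMr ?zsub_cmod_gt0 //; apply: le_trans cw _.
  rewrite -[s * A * _]mulrA ler_pM2l // /A [leRHS]mulrDl; apply: lerD.
    by rewrite mulrAC -mulrA ler_peMr ?sqr_ge0 // ler_pdivlMr // mul1r zsub_Im.
  by rewrite mulrAC -[leRHS]mulrA; apply: ler_wpM2l; [rewrite mulr_ge0 | exact: zsub_ge].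
have he : q s p * expR (cmod w) <= expR (pi * (3 * cmod z ^+ 2)) * expR (- (s * p ^+ 2 / 2)).
  rewrite /q -!expRD ler_expR.
  have h1 : 2 * `|p| * cmod z <= p ^+ 2 / 2 + 2 * cmod z ^+ 2.
    have := sqr_ge0 (`|p| - 2 * cmod z).
    by rewrite sqrrB real_normK ?num_real //; move: (`|p|) (p ^+ 2) (cmod z) => u v t; lra.
  have h2 := ler_wpM2l (ltW s0) h1.
  have h3 : s * (3 * cmod z ^+ 2) <= pi * (3 * cmod z ^+ 2).
    by apply: ler_wpM2r => //; rewrite mulr_ge0 // sqr_ge0.
  by move: cw h2 h3; clear; move: (`|p|) (cmod w) (cmod z) => u v t; lra.
have := cexp_sub1 w => h.
apply: (@le_trans _ _ (q s p * (4 * cmod w * expR (cmod w) / cmod (z - p%:C%C)))).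
  by rewrite ler_wpM2l ?expR_ge0 // ler_wpM2r // invr_ge0 cmod_ge0.
have -> : q s p * (4 * cmod w * expR (cmod w) / cmod (z - p%:C%C)) =
  4 * (cmod w / cmod (z - p%:C%C)) * (q s p * expR (cmod w)) by ring.
have -> : 4 * A * expR (pi * (3 * cmod z ^+ 2)) * s * expR (- (s * p ^+ 2 / 2)) =
  4 * (s * A) * (expR (pi * (3 * cmod z ^+ 2)) * expR (- (s * p ^+ 2 / 2))) by ring.
apply: ler_pM => //.
- by rewrite mulr_ge0 // divr_ge0 ?cmod_ge0.
- by rewrite mulr_ge0 ?expR_ge0.
- by rewrite ler_pM2l.
Qed.

(* [1 / (z - p) = - 1 / p + z / (p (z - p))], whose second term is summable. *)
Lemma cauchy_kernel_real : exists2 K : R, 0 <= K & forall s p : R, 0 < s -> s <= pi -> p != 0 ->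
  cmod ((1 - Q s p) / (z - p%:C%C) + ((1 - q s p) / p)%:C%C) <= K * s /\
  cmod (Q s p / (z - p%:C%C) + (q s p / p)%:C%C) <= K / (s * p ^+ 4).
Proof.
have [K K0 hK] := gauss_kernel_dist; have c0 := cmod_ge0 z.
have A0 : 0 <= cmod z * K1 by rewrite mulr_ge0 // K1_ge0.
exists (8 * K + cmod z * K1) => [|s p s0 s1 p0]; first by rewrite addr_ge0 // mulr_ge0.
have zp := zsub_neq0 p; have zp0 := zsub_cmod_gt0 p.
have hk := hK s p s0 s1.
have p2 : 0 < p ^+ 2 by rewrite exprn_even_gt0.
have sp : 0 < s * p ^+ 2 by rewrite mulr_gt0.
have pc : p%:C%C != 0 :> C by rewrite -(rmorph0 (real_complex R)) (inj_eq (@complexI R)).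
have np : 0 < `|p| by rewrite normr_gt0.
have K1p : 0 < K1 by rewrite /K1 ltr_pwDl // divr_ge0 // ltW.
have core : cmod (z / (p%:C%C * (z - p%:C%C))) <= cmod z * K1 / p ^+ 2.
  rewrite cmodM cmodV cmodM cmodR -mulrA ler_wpM2l // -[p ^+ 2]real_normK ?num_real //.
  rewrite -[leRHS]invf_div lef_pV2 ?posrE ?mulr_gt0 ?invr_gt0 ?exprn_gt0 //.
  rewrite ler_pdivrMr //.
  by rewrite expr2 -mulrA ler_pM2l // mulrC zsub_ge.
have e1 : expR (- (s * p ^+ 2 / 2)) <= 1 by rewrite -[leRHS]expR0 ler_expR oppr_le0 divr_ge0 // ltW.
have e2 : expR (- (s * p ^+ 2 / 2)) <= 2 / (s * p ^+ 2 / 2) ^+ 2 by apply: expRN_inv2; rewrite divr_gt0.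
have q2 : q s p <= (s * p ^+ 2)^-1 by exact: expRN_inv.
split.
  have -> : (1 - Q s p) / (z - p%:C%C) + ((1 - q s p) / p)%:C%C =
    (1 - q s p)%:C%C * (z / (p%:C%C * (z - p%:C%C))) - (Q s p - (q s p)%:C%C) / (z - p%:C%C).
    by rewrite !(rmorphB, rmorphM, fmorphV, rmorph1) /=; field; rewrite pc zp.
  apply: le_trans (cmodB _ _) _; rewrite addrC [leRHS]mulrDl; apply: lerD.
    apply: le_trans hk _; rewrite -[leRHS]mulr1; apply: ler_pM; rewrite ?expR_ge0 //.
      by rewrite mulr_ge0 // ltW.
    by rewrite ler_pM2r //; lra.
  rewrite cmodM cmodR ger0_norm; last by rewrite subr_ge0 -[leRHS]expR0 ler_expR oppr_le0 ltW.
  apply: (@le_trans _ _ ((s * p ^+ 2) * (cmod z * K1 / p ^+ 2))).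
    apply: ler_pM => //; rewrite ?cmod_ge0 //.
      by rewrite subr_ge0 -[leRHS]expR0 ler_expR oppr_le0 ltW.
    by have := expR_ge1Dx (- (s * p ^+ 2)); rewrite /q; lra.
  by rewrite le_eqVlt; apply/orP; left; apply/eqP; field; rewrite p0.
have -> : Q s p / (z - p%:C%C) + (q s p / p)%:C%C =
  (q s p)%:C%C * (z / (p%:C%C * (z - p%:C%C))) + (Q s p - (q s p)%:C%C) / (z - p%:C%C).
  by rewrite !(rmorphM, fmorphV) /=; field; rewrite pc zp.
apply: le_trans (cmodD _ _) _; rewrite addrC [leRHS]mulrDl; apply: lerD.
  apply: le_trans hk _; apply: (@le_trans _ _ (K * s * (2 / (s * p ^+ 2 / 2) ^+ 2))).
    by rewrite ler_wpM2l // mulr_ge0 // ltW.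
  by rewrite le_eqVlt; apply/orP; left; apply/eqP; field; rewrite p0 gt_eqF.
rewrite cmodM cmodR ger0_norm ?expR_ge0 //.
apply: (@le_trans _ _ ((s * p ^+ 2)^-1 * (cmod z * K1 / p ^+ 2))).
  by apply: ler_pM; rewrite ?cmod_ge0 ?expR_ge0.
by rewrite le_eqVlt; apply/orP; left; apply/eqP; field; rewrite p0 gt_eqF.
Qed.

(** The real terms of [cauchy_kernel_real] are odd in [p], so those of a_n and a_(-n) combine into a
    difference between p = a_n and p' = - a_(-n), small when |p - p'| = |a_n + a_(-n)| is. The first
    bound will serve up to the truncation, the second beyond it. *)
Lemma pair_real (s p p' m r : R) : 0 < s -> 0 < m -> m <= p -> m <= p' -> p <= r * p' ->
  `|(1 - q s p) / p - (1 - q s p') / p'| <= s * `|p - p'| * (1 + 2 * r) /\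
  `|q s p / p - q s p' / p'| <= `|p - p'| * (3 + 2 * r) / (s * m ^+ 4).
Proof.
move=> s0 m0 mp mp' pr.
have p0 : 0 < p := lt_le_trans m0 mp; have p'0 : 0 < p' := lt_le_trans m0 mp'.
have pp : p / p' <= r by rewrite ler_pdivrMr.
have sq (x : R) : 0 < x -> 0 < s * x ^+ 2 by move=> x0; rewrite mulr_gt0 // exprn_gt0.
have d0 := normr_ge0 (p - p').
have e1 x : 0 < x -> q s x <= 1 by move=> x0; rewrite -[leRHS]expR0 ler_expR oppr_le0 ltW // sq.
have e2 : `|q s p - q s p'| <= s * `|p - p'| * (p + p').
  apply: le_trans (expRN_dist (e1 p p0) (e1 p' p'0)) _.
  rewrite -mulrBr mulr1 subr_sqr !normrM (gtr0_norm s0) (gtr0_norm (x := p + p')) ?addr_gt0 //.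
  by rewrite mulrA.
have pp1 : (p + p') / p' = 1 + p / p' by field; rewrite gt_eqF.
split.
  have -> : (1 - q s p) / p - (1 - q s p') / p' =
    - ((1 - q s p) / p * ((p - p') / p')) - (q s p - q s p') / p'.
    by field; rewrite !gt_eqF.
  apply: le_trans (ler_normB _ _) _; rewrite normrN.
  have -> : s * `|p - p'| * (1 + 2 * r) = s * `|p - p'| * r + s * `|p - p'| * (1 + r) by ring.
  apply: lerD.
    rewrite !normrM (ger0_norm (x := 1 - _)) ?subr_ge0 ?e1 //.
    rewrite (gtr0_norm (x := p^-1)) ?(gtr0_norm (x := p'^-1)) ?invr_gt0 //.
    apply: (@le_trans _ _ (s * p ^+ 2 / p * (`|p - p'| / p'))).
      apply: ler_wpM2r; first by rewrite divr_ge0 // ltW.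
      apply: ler_wpM2r; first by rewrite invr_ge0 ltW.
      by have := expR_ge1Dx (- (s * p ^+ 2)); rewrite /q; lra.
    have -> : s * p ^+ 2 / p * (`|p - p'| / p') = s * `|p - p'| * (p / p') by field; rewrite !gt_eqF.
    by apply: ler_wpM2l => //; rewrite mulr_ge0 // ltW.
  rewrite normrM [`|p'^-1|]gtr0_norm ?invr_gt0 //.
  apply: (@le_trans _ _ (s * `|p - p'| * (p + p') / p')).
    by apply: ler_wpM2r => //; rewrite invr_ge0 ltW.
  by rewrite -mulrA pp1; apply: ler_wpM2l; [rewrite mulr_ge0 // ltW | lra].
have sm := sq m m0.
have mm x : m <= x -> s * m ^+ 2 <= s * x ^+ 2.
  by move=> mx; rewrite ler_pM2l // lerXn2r // nnegrE ?(ltW m0) // (le_trans (ltW m0) mx).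
have e3 x : m <= x -> q s x <= 2 / (s * m ^+ 2) ^+ 2.
  move=> mx; apply: le_trans (expRN_inv2 (x := s * m ^+ 2) sm).
  by rewrite /q ler_expR lerN2 mm.
have e4 : `|q s p - q s p'| <= s * `|p - p'| * (p + p') * (2 / (s * m ^+ 2) ^+ 2).
  apply: le_trans (expRN_dist (e3 p mp) (e3 p' mp')) _.
  by rewrite -mulrBr subr_sqr !normrM (gtr0_norm s0) (gtr0_norm (x := p + p')) ?addr_gt0 // mulrA.
have -> : q s p / p - q s p' / p' = - (q s p * ((p - p') / (p * p'))) + (q s p - q s p') / p'.
  by field; rewrite !gt_eqF.
apply: le_trans (ler_normD _ _) _; rewrite normrN.
have -> : `|p - p'| * (3 + 2 * r) / (s * m ^+ 4) = (s * m ^+ 2)^-1 * (`|p - p'| / m ^+ 2) +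
   s * `|p - p'| * (1 + r) * (2 / (s * m ^+ 2) ^+ 2).
  by field; rewrite !gt_eqF.
apply: lerD.
  rewrite !normrM (ger0_norm (x := q s p)) ?expR_ge0 //.
  rewrite (gtr0_norm (x := (p * p')^-1)) ?invr_gt0 ?mulr_gt0 //.
  apply: ler_pM; rewrite ?expR_ge0 //.
  - by rewrite divr_ge0 // ltW // mulr_gt0.
  - apply: le_trans (_ : q s m <= _); last exact: expRN_inv.
    by rewrite /q ler_expR lerN2 mm.
  - rewrite ler_wpM2l // lef_pV2 ?posrE ?mulr_gt0 ?exprn_gt0 // expr2.
    by apply: ler_pM => //; exact: ltW.
rewrite normrM [`|p'^-1|]gtr0_norm ?invr_gt0 //.
apply: (@le_trans _ _ (s * `|p - p'| * (p + p') * (2 / (s * m ^+ 2) ^+ 2) / p')).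
  by apply: ler_wpM2r => //; rewrite invr_ge0 ltW.
have -> : s * `|p - p'| * (p + p') * (2 / (s * m ^+ 2) ^+ 2) / p' =
  s * `|p - p'| * ((p + p') / p') * (2 / (s * m ^+ 2) ^+ 2) by ring.
apply: ler_wpM2r; first by rewrite divr_ge0 // sqr_ge0.
by rewrite pp1; apply: ler_wpM2l; [rewrite mulr_ge0 // ltW | lra].
Qed.

End TauberEstimates.

Section Tauber.
Context {R : realType}.
Local Notation C := (R[i]).
Context {Lam : set R} {c : R -> nat} {Gam : set R} {b : R -> C} {a : int -> R}.
Context {qc : quasicrystal Lam c Gam b a}.

Let locfin := qc_locfin (quasicrystal := qc).
Let cpos := qc_pos (quasicrystal := qc).
Let ft := qc_fourier (quasicrystal := qc).
Let tb := qc_tempered (quasicrystal := qc).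
Let a_nd := qc_nd (quasicrystal := qc).
Let a_card := qc_card (quasicrystal := qc).
Let a_Lam := qc_mem (quasicrystal := qc).

Local Notation wt := (wt Gam b).
Local Notation Bsum := (Bsum Gam b).
Local Notation dominated := (dominated Gam b).

Variable z : C.
Hypothesis z0 : 0 < complex.Im z.

Let Q (s p : R) : C := ce (- s%:C%C * (z - p%:C%C) ^+ 2).
Let q (s p : R) : R := expR (- (s * p ^+ 2)).

Lemma step_kernel_cvg (sg : R) : 0 < sg ->
  dominated (mstep sg z) ->
  ccvg (ssum (fun n => Q (pi * sg ^+ 2) (a n) / (z - (a n)%:C%C)))
    (- (2 * pi)%:C%C * 'i%C * Bsum (mstep sg z)).
Proof.
move=> sg0 dm; set x := complex.Re z; set y := complex.Im z.
have zE : z = (x +i* y)%C by rewrite /x /y; case: z.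
have [s [h1 h2]] := ft (test_step_schwartz x sg0 z0).
have sE : Bsum (mstep sg z) = s.
  apply: (Bsum_eq tb dm); apply: has_sum_ext h2 => g _.
  by rewrite test_stepE -zE.
rewrite sE; set k : C := - (2 * pi)%:C%C * 'i%C.
have [Cb hCb] := @c_bound R Lam c Gam b a qc.
have {}h1 : has_sum Lam (fun l => (c l)%:R * (Q (pi * sg ^+ 2) l / (z - l%:C%C))) (k * s).
  apply: has_sum_ext (has_sumZ k h1) => l _.
  have := fourier_test_step x l sg0 z0; rewrite -/y -zE -/k /= /Q => <-.
  by rewrite mulrCA; congr (_ * _); rewrite mulrA mulfK ?zsub_neq0 // mulrC.
have := reindex_sum locfin cpos a_nd a_card a_Lam h1 hCb; apply => e e0.
have al0 : 0 < pi * sg ^+ 2 by rewrite mulr_gt0 ?pi_gt0 // exprn_gt0.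
pose e' := e * y / expR (pi * sg ^+ 2 * y ^+ 2).
have e'0 : 0 < e' by rewrite divr_gt0 ?expR_gt0 // mulr_gt0.
have hb (l : R) : expR (- (pi * sg ^+ 2 * (x - l) ^+ 2)) <= e' ->
    cmod (Q (pi * sg ^+ 2) l / (z - l%:C%C)) <= e.
  move=> hl; rewrite cmodM cmodV ler_pdivrMr ?zsub_cmod_gt0 //.
  apply: (@le_trans _ _ (e * y)); last by rewrite ler_pM2l // zsub_Im.
  rewrite /Q cmod_ce (_ : complex.Re _ = - (pi * sg ^+ 2 * (x - l) ^+ 2) + pi * sg ^+ 2 * y ^+ 2).
    by rewrite expRD -ler_pdivlMr ?expR_gt0.
  by rewrite zE expr2 !(ReM, ImM, ReB, ImB) /=; ring.
have [r hr] := gauss_small x al0 e'0.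
have [N hN] := a_infty locfin a_nd a_card a_Lam r; exists N => n Nn.
have [k1 k2] := hN n Nn; split; apply: hb; apply: hr.
  exact: le_trans k1 (ler_norm _).
by have := ler_norm (- a (- n%:Z)); rewrite normrN; lra.
Qed.

Lemma mstep_bound : exists K : R, forall sg g, 0 < sg -> sg <= 1 -> cmod (mstep sg z g) * wt g <= K.
Proof.
set y := complex.Im z; have y0 : 0 < 2 * pi * y by rewrite !mulr_gt0 ?pi_gt0.
have [K0 K0p hK] := @wt_le_exp R Gam b _ y0.
(* For g < 0, the exponential in the multiplier and the weight together grow at most like e^(4 pi y
   |g|), and [gcdf] has to decay at that rate. *)
have B0 : 0 < 4 * pi * y by rewrite !mulr_gt0 ?pi_gt0.
have [A A0 hA] := gcdf_tailN B0.
exists (K0 + A * K0) => sg g sg0 sg1.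
rewrite /mstep cmodM cmodR ger0_norm ?gcdf_ge0 // cmod_ce_re -/y.
have e0 := expR_ge0 (- (2 * pi * y) * g); have w0 : 0 <= wt g by rewrite ltW // wt_gt0.
have [g0|g0] := leP 0 g.
  apply: (@le_trans _ _ (1 * expR (- (2 * pi * y) * g) * (K0 * expR (2 * pi * y * `|g|)))).
    apply: ler_pM => //; first by rewrite mulr_ge0 // gcdf_ge0.
    by apply: ler_wpM2r => //; exact: gcdf_le1.
  rewrite mul1r mulrCA -expRD ger0_norm // mulNr addNr expR0 mulr1 lerDl.
  by rewrite mulr_ge0 // ltW.
have hg : gcdf (sg^-1 * g) <= A * expR (4 * pi * y * g).
  apply: le_trans (hA g (ltW g0)); apply: gcdf_le.
  by rewrite -[leRHS]mul1r; apply: ler_wnM2r; [exact: ltW | rewrite invf_ge1].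
apply: (@le_trans _ _ (A * expR (4 * pi * y * g) * expR (- (2 * pi * y) * g) * (K0 * expR (2 * pi * y * `|g|)))).
  apply: ler_pM => //; first by rewrite mulr_ge0 // gcdf_ge0.
  by apply: ler_wpM2r.
rewrite ltr0_norm //.
have eE : expR (4 * pi * y * g) * expR (- (2 * pi * y) * g) * expR (2 * pi * y * - g) = 1.
  by rewrite -!expRD -[RHS]expR0; congr expR; ring.
rewrite -(mulrA A) mulrACA eE mulr1 lerDr ltW //.
Qed.

(** The pointwise limit of [mstep] as [sg] tends to 0; at frequency 0 the cutoff does not depend on
    [sg]. *)
Definition hstep (g : R) : C :=
  (if 0 < g then 1 else if g == 0 then (gcdf 0)%:C%C else 0) * ce ('i%C * (2 * pi * g)%:C%C * z).

Lemma mstep_cvg g : ccvg (fun n => mstep n.+1%:R^-1 z g) (hstep g).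
Proof.
have scale (u : nat -> R) (l : R) : rcvg u l ->
    ccvg (fun n => (u n)%:C%C * ce ('i%C * (2 * pi * g)%:C%C * z)) (l%:C%C * ce ('i%C * (2 * pi * g)%:C%C * z)).
  move=> h; apply: ccvgM; last exact: ccvg_cst.
  move=> e e0; have [N hN] := h e e0; exists N => n Nn.
  by rewrite -rmorphB cmodR; exact: hN.
rewrite /hstep /mstep; under eq_fun do rewrite invrK.
have [g0|g0] := ltP 0 g.
  rewrite -(rmorph1 (real_complex R)); apply: scale => e e0.
  have /cvgrPdist_le/(_ _ e0)[N1 _ h1] := @cvg_gcdfy R.
  exists (Num.truncn (N1%:R / g)).+1 => n Nn.
  have := h1 N1 (leqnn _); rewrite /= ger0_norm ?subr_ge0 ?gcdf_le1 // => h.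
  rewrite distrC ger0_norm ?subr_ge0 ?gcdf_le1 //.
  apply: le_trans h; rewrite lerD2l lerN2; apply: gcdf_le.
  rewrite -ler_pdivrMr //; apply/ltW/(lt_le_trans (truncnS_gt _)).
  by rewrite ler_nat leqW.
have [->|gn] := eqVneq g 0.
  by apply: ccvg_ext (ccvg_cst _) => n; rewrite !mulr0.
rewrite -(rmorph0 (real_complex R)); apply: scale => e e0.
have {}g0 : g < 0 by rewrite lt_neqAle gn.
have /cvgrPdist_le/(_ _ e0)[N1 _ h1] := @cvg_gcdfNy R.
exists (Num.truncn (N1%:R / - g)).+1 => n Nn.
have := h1 N1 (leqnn _); rewrite /= sub0r normrN ger0_norm ?gcdf_ge0 // => h.
rewrite subr0 ger0_norm ?gcdf_ge0 //.
apply: le_trans h; apply: gcdf_le.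
have : N1%:R / - g <= n.+1%:R.
  by apply/ltW/(lt_le_trans (truncnS_gt _)); rewrite ler_nat leqW.
rewrite ler_pdivrMr ?oppr_gt0 //; lra.
Qed.

Lemma Bsum_mstep_cvg : ccvg (fun n => Bsum (mstep n.+1%:R^-1 z)) (Bsum hstep).
Proof.
have [K hK] := mstep_bound; apply: (Bsum_cvg tb (K := K)) => [n g|g]; last exact: mstep_cvg.
by apply: hK; [exact: inv_gt0 | exact: inv_le1].
Qed.

Definition cauchyL : C := - (2 * pi)%:C%C * 'i%C * Bsum hstep.

End Tauber.

Section TauberLimit.
Context {R : realType}.
Local Notation C := (R[i]).
Context {Lam : set R} {c : R -> nat} {Gam : set R} {b : R -> C} {a : int -> R}.
Context {qc : quasicrystal Lam c Gam b a}.

Local Notation Bsum := (Bsum Gam b).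
Local Notation dominated := (dominated Gam b).

Variable z : C.
Hypothesis z0 : 0 < complex.Im z.

Let Q (s p : R) : C := ce (- s%:C%C * (z - p%:C%C) ^+ 2).
Let q (s p : R) : R := expR (- (s * p ^+ 2)).
Let D1 (s : R) (n : int) : C := (1 - Q s (a n)) / (z - (a n)%:C%C).
Let D0 (s : R) (n : int) : C := Q s (a n) / (z - (a n)%:C%C).

Lemma linear_growth : exists k0 G : R, exists n1 : nat, [/\ 0 < k0, 0 < G, (0 < n1)%N &
  forall n, (n1 <= n)%N -> [/\ k0 * n%:R <= a n%:Z, k0 * n%:R <= - a (- n%:Z) & a n%:Z <= G * n%:R]].
Proof.
have [k [C1 [k00 C10 hk]]] := @growth R Lam c Gam b a qc.
have [G G0 hG] := @a_step R Lam c Gam b a qc.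
exists (k / 2), (G + `|a 0|), (Num.truncn ((C1 + `|a 0|) / (k / 2))).+1.
split=> // [||n nn]; [by rewrite divr_gt0 | by rewrite ltr_pwDl |].
have n1 : 1 <= n%:R :> R by rewrite ler1n; apply: leq_trans nn.
have h : C1 + `|a 0| <= n%:R * (k / 2).
  rewrite -ler_pdivrMr ?divr_gt0 //; apply/ltW/(lt_le_trans (truncnS_gt _)).
  by rewrite ler_nat.
have := hk 0 n; have := hk (- n%:Z) n; have := hG 0 n; rewrite add0r addNr.
have := ler_norm (a 0); have := ler_norm (- a 0); rewrite normrN => h1 h2 h3 h4 h5.
have h6 : `|a 0| <= `|a 0| * n%:R by rewrite ler_peMr.
by split; lra.
Qed.

(** For s = pi / N^2, [D1] is the part of the Cauchy kernel that the Gaussian removes and [D0] the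
    part that it keeps. The first is small up to [N], the second beyond; in both, pairing cancels
    the real term of order 1 / a_n up to |a_n + a_(-n)|. *)
Lemma tauber_pair : exists2 A : R, 0 <= A & exists n1 : nat, forall N n : nat, (n1 <= N)%N -> (0 < N)%N ->
  let s := pi / N%:R ^+ 2 in
  ((n <= N)%N -> cmod (D1 s n%:Z + D1 s (- n%:Z)) <= A * (1 + `|a n%:Z + a (- n%:Z)|) / N%:R ^+ 2) /\
  ((N < n)%N -> cmod (D0 s n%:Z + D0 s (- n%:Z)) <=
     A * (1 + `|a n%:Z + a (- n%:Z)|) * (N%:R ^+ 2 / n%:R ^+ 4)).
Proof.
have [k0 [G [n1 [k00 G0 n10 hn1]]]] := linear_growth.
have [K K0 hK] := cauchy_kernel_real z0.
pose r := G / k0; have r0 : 0 < r by rewrite divr_gt0.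
pose T := \sum_(n <- ints n1) `|a n|.
have T0 : 0 <= T by apply: sumr_ge0.
have hT n : n \in ints n1 -> `|a n| <= T.
  by move=> hn; rewrite /T (big_rem n) //= lerDl sumr_ge0.
have p0 : 0 < pi :> R := pi_gt0 R.
pose A1 := pi * (2 * K + 1 + 2 * r); pose A2 := (2 * K + 3 + 2 * r) / (pi * k0 ^+ 4).
pose A3 := 2 * pi * (K + T).
have r0' := ltW r0; have p0' := ltW p0; have k0' := ltW k00.
have A10 : 0 <= A1.
  by apply: mulr_ge0 => //; apply: addr_ge0; [apply: addr_ge0 => // |]; apply: mulr_ge0.
have A20 : 0 <= A2.
  apply: divr_ge0; last by apply: mulr_ge0 => //; exact: exprn_ge0.
  by apply: addr_ge0; [apply: addr_ge0 => // |]; apply: mulr_ge0.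
have A30 : 0 <= A3 by rewrite !mulr_ge0 ?(ltW p0) // addr_ge0.
exists (A1 + A2 + A3); first by rewrite !addr_ge0.
exists n1.+1 => N n nN N0 s.
have NR : 0 < N%:R :> R by rewrite ltr0n.
have N1 : 1 <= N%:R :> R by rewrite ler1n.
have s0 : 0 < s by rewrite divr_gt0 // exprn_gt0.
have s1 : s <= pi by rewrite ler_pdivrMr ?exprn_gt0 // ler_peMr ?(ltW p0) // exprn_ege1.
have an0 (m : int) : a m != 0 by apply/eqP; exact: (qc_neq0 (quasicrystal := qc)).
have d0 := normr_ge0 (a n%:Z + a (- n%:Z)); set d := `|_ + _| in d0 *.
(* Below [n1] the signs of the two points are unknown, so there is no cancellation to use: these
   finitely many points are bounded by [T]. *)
have [nn|nn] := leqP n1 n; last first.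
  split=> [_|Nn]; last by exfalso; move: (leq_trans nN (ltnW (ltn_trans Nn nn))); rewrite ltnn.
  have hD (m : int) : m \in ints n1 -> cmod (D1 s m) <= s * (K + T).
    move=> hm; have [h1 _] := hK s (a m) s0 s1 (an0 m).
    have -> : D1 s m = (D1 s m + ((1 - q s (a m)) / a m)%:C%C) - ((1 - q s (a m)) / a m)%:C%C by ring.
    apply: le_trans (cmodB _ _) _; rewrite mulrDr; apply: lerD; first by rewrite [s * K]mulrC.
    rewrite cmodR normrM normfV ler_pdivrMr ?normr_gt0 //.
    have q1 : q s (a m) <= 1 by rewrite -[leRHS]expR0 ler_expR oppr_le0 mulr_ge0 ?sqr_ge0 // ltW.
    rewrite ger0_norm ?subr_ge0 //.
    apply: (@le_trans _ _ (s * a m ^+ 2)).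
      by have := expR_ge1Dx (- (s * a m ^+ 2)); rewrite /q; lra.
    rewrite -[a m ^+ 2]real_normK ?num_real // expr2 -[s * T * _]mulrA ler_pM2l //.
    by apply: ler_wpM2r => //; exact: hT.
  apply: le_trans (cmodD _ _) _.
  apply: (@le_trans _ _ (A3 / N%:R ^+ 2)).
    have -> : A3 / N%:R ^+ 2 = s * (K + T) + s * (K + T) by rewrite /A3 /s; ring.
    by apply: lerD; apply: hD; rewrite mem_ints ?abszN; exact: ltnW.
  apply: ler_wpM2r; first by rewrite invr_ge0 exprn_ge0 // ltW.
  apply: (@le_trans _ _ (A1 + A2 + A3)); first by rewrite lerDr addr_ge0.
  by rewrite ler_peMr ?addr_ge0 // lerDl.
have [g1 g2 g3] := hn1 n nn.
pose p := a n%:Z; pose p' := - a (- n%:Z); pose m := k0 * n%:R.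
have dE : d = `|p - p'| by rewrite /p /p' opprK.
have qE : q s (a (- n%:Z)) = q s p' by rewrite /q /p' sqrrN.
have m0 : 0 < m by rewrite mulr_gt0 // ltr0n; exact: leq_trans nn.
have pr : p <= r * p'.
  apply: le_trans g3 _; rewrite /r mulrAC ler_pdivlMr // -mulrA ler_pM2l //.
  by rewrite mulrC.
have [k1 l1] := hK s (a n%:Z) s0 s1 (an0 _); have [k2 l2] := hK s (a (- n%:Z)) s0 s1 (an0 _).
rewrite -!/(Q _ _) -!/(q _ _) -!/(D1 _ _) -!/(D0 _ _) qE in k1 k2 l1 l2.
have aE : a (- n%:Z) = - p' by rewrite /p' opprK.
rewrite aE invrN mulrN rmorphN /= -/p in k2 l2; rewrite -/p in k1 l1.
have le2 (x y : R) : 0 <= x -> 0 <= y -> x + y * d <= (x + y) * (1 + d).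
  by move=> x0 y0; have := mulr_ge0 x0 d0; lra.
have [j1 j2] := pair_real s0 m0 g1 g2 pr; rewrite -!/(q _ _) in j1 j2.
split=> nN'.
  set u := (1 - q s p) / p; set u' := (1 - q s p') / p'.
  have -> : D1 s n%:Z + D1 s (- n%:Z) =
      (D1 s n%:Z + u%:C%C) + (D1 s (- n%:Z) - u'%:C%C) - (u - u')%:C%C.
    rewrite rmorphB /=; move: (D1 s n%:Z) (D1 s (- n%:Z)) (u%:C%C) (u'%:C%C) => c1 c2 c3 c4; ring.
  apply: le_trans (cmodB _ _) _; rewrite cmodR.
  apply: le_trans (lerD (le_trans (cmodD _ _) (lerD k1 k2)) j1) _.
  rewrite -dE.
  have -> : K * s + K * s + s * d * (1 + 2 * r) = (2 * K + (1 + 2 * r) * d) * s by ring.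
  have -> : (A1 + A2 + A3) * (1 + d) / N%:R ^+ 2 = (A1 + A2 + A3) / pi * (1 + d) * s.
    have fE (X Y P Z : R) : 0 < P -> X * Y * Z = X / P * Y * (P * Z) by move=> P0; field; rewrite gt_eqF.
    exact: fE.
  apply: ler_wpM2r; first exact: ltW.
  apply: le_trans (le2 _ _ _ _) _; [exact: mulr_ge0 | by apply: addr_ge0 => //; exact: mulr_ge0 |].
  apply: ler_wpM2r; first exact: addr_ge0.
  rewrite ler_pdivlMr // mulrC addrA -/A1 -addrA lerDl; exact: addr_ge0.
set u := q s p / p; set u' := q s p' / p'.
have -> : D0 s n%:Z + D0 s (- n%:Z) =
    (D0 s n%:Z + u%:C%C) + (D0 s (- n%:Z) - u'%:C%C) - (u - u')%:C%C.
  rewrite rmorphB /=; move: (D0 s n%:Z) (D0 s (- n%:Z)) (u%:C%C) (u'%:C%C) => c1 c2 c3 c4; ring.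
have sm : 0 < s * m ^+ 4 by rewrite mulr_gt0 // exprn_gt0.
have pm (x : R) : m <= `|x| -> K / (s * x ^+ 4) <= K / (s * m ^+ 4).
  move=> mx; apply: ler_wpM2l => //.
  have x4 : m ^+ 4 <= x ^+ 4.
    rewrite (_ : x ^+ 4 = `|x| ^+ 4); last by rewrite -normrX ger0_norm // exprn_even_ge0.
    by rewrite lerXn2r // nnegrE ltW.
  have m4 : 0 < m ^+ 4 by rewrite exprn_gt0.
  have sx : 0 < s * x ^+ 4 by rewrite mulr_gt0 // (lt_le_trans m4).
  by rewrite lef_pV2 ?posrE // ler_pM2l.
apply: le_trans (cmodB _ _) _; rewrite cmodR.
have l3 := le_trans l1 (pm _ (le_trans g1 (ler_norm _))).
have g4 : m <= `|- p'| by rewrite normrN; apply: le_trans g2 (ler_norm _).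
have l4 := le_trans l2 (pm _ g4); rewrite mulrN rmorphN /= in l4.
apply: le_trans (lerD (le_trans (cmodD _ _) (lerD l3 l4)) j2) _.
rewrite -dE.
have -> : K / (s * m ^+ 4) + K / (s * m ^+ 4) + d * (3 + 2 * r) / (s * m ^+ 4) =
  (2 * K + (3 + 2 * r) * d) / (s * m ^+ 4) by ring.
have nn0 : 0 < n%:R :> R by rewrite ltr0n; exact: leq_trans nn.
have -> : (A1 + A2 + A3) * (1 + d) * (N%:R ^+ 2 / n%:R ^+ 4) =
    (A1 + A2 + A3) * (pi * k0 ^+ 4) * (1 + d) / (s * m ^+ 4).
  have fE (X Y P k x y : R) : 0 < P -> 0 < k -> 0 < x -> 0 < y ->
      X * Y * (x ^+ 2 / y ^+ 4) = X * (P * k ^+ 4) * Y / (P / x ^+ 2 * (k * y) ^+ 4).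
    by move=> *; field; rewrite !gt_eqF.
  exact: fE.
apply: ler_wpM2r; first by rewrite invr_ge0 ltW.
apply: le_trans (le2 _ _ _ _) _; [exact: mulr_ge0 | by apply: addr_ge0 => //; exact: mulr_ge0 |].
apply: ler_wpM2r; first exact: addr_ge0.
rewrite -ler_pdivrMr; last by rewrite mulr_gt0 ?exprn_gt0.
rewrite addrA -/A2 [A1 + A2]addrC -addrA lerDl; exact: addr_ge0.
Qed.

(** With |a_n + a_(-n)| <= d n + C0, the low pairs cost at most about A (1 + C0 + d N) / N, and so
    does the tail, where 1 / n^2 telescopes. Both are of order A d once N d exceeds 1 + C0. *)
Lemma tauber (e : R) : 0 < e -> exists N0 : nat, forall N M : nat, (N0 <= N)%N -> (N <= M)%N ->
  cmod (ssum (fun n => (z - (a n)%:C%C)^-1) N - ssum (D0 (pi / N%:R ^+ 2)) M) <= e.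
Proof.
have [A A0 [n1 hA]] := tauber_pair => e0.
pose d := e / (6 * (A + 1)).
have d0 : 0 < d by rewrite divr_gt0 // mulr_gt0 // ltr_wpDl.
have [C0 C00 hC] := @pairing R Lam c Gam b a qc d d0.
exists (maxn n1 (Num.truncn ((1 + C0) / d)).+1) => N M; rewrite geq_max => /andP[N1 N2] NM.
have N0 : (0 < N)%N by apply: leq_trans N2.
have NR : 0 < N%:R :> R by rewrite ltr0n.
have NR1 : 1 <= N%:R :> R by rewrite ler1n.
have hNd : (1 + C0) / d <= N%:R.
  by apply/ltW/(lt_le_trans (truncnS_gt _)); rewrite ler_nat.
rewrite ler_pdivrMr // in hNd.
set s := pi / N%:R ^+ 2.
pose B := A * (1 + C0 + d * N%:R).
have B0 : 0 <= B by rewrite mulr_ge0 // !addr_ge0 // mulr_ge0 // ltW.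
have hB : 3 * B <= e * N%:R.
  have : B <= A * (2 * (d * N%:R)) by apply: ler_wpM2l => //; lra.
  have : A * d * 6 <= e by rewrite /d; apply: le_trans (_ : (A + 1) * (e / (6 * (A + 1))) * 6 <= _); [
    rewrite ler_pM2r // ler_wpM2r ?lerDl // ltW | rewrite le_eqVlt; apply/orP; left; apply/eqP; field; rewrite gt_eqF // ltr_wpDl].
  by move/(ler_wpM2r (ltW NR)); lra.
have small J : (J <= N)%N -> cmod (ssum (D1 s) J) <= B / N%:R ^+ 2 * J.+1%:R.
  have one n : (n <= N)%N -> cmod (D1 s n%:Z + D1 s (- n%:Z)) <= B / N%:R ^+ 2.
    move=> nN; have [h _] := hA N n N1 N0; apply: le_trans (h nN) _.
    apply: ler_wpM2r; first by rewrite invr_ge0 exprn_ge0 // ltW.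
    apply: ler_wpM2l => //; rewrite -addrA lerD2l; apply: le_trans (hC n) _.
    by rewrite [leLHS]addrC lerD2l; apply: ler_wpM2l; [exact: ltW | rewrite ler_nat].
  elim: J => [_|J IH JN].
    rewrite /ssum big_geq // addr0 mulr1.
    (* The pair of index 0 is the central term taken twice, so half of the bound is given away. *)
    have := one 0%N (leq0n _); rewrite oppr0 (_ : D1 s 0 + D1 s 0 = 2%:R * D1 s 0); last first.
      by rewrite mulr_natl mulr2n.
    rewrite cmodM cmod_nat.
    by have := cmod_ge0 (D1 s 0); lra.
  rewrite ssumS -[J.+2%:R]natr1 mulrDr mulr1; apply: le_trans (cmodD _ _) _.
  by apply: lerD; [apply: IH; exact: ltnW | exact: one].
have sD : ssum (fun n => (z - (a n)%:C%C)^-1) N - ssum (D0 s) N = ssum (D1 s) N.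
  by rewrite !ssum_ints -sumrB; apply: eq_bigr => n _; rewrite /D1 mulrBl mul1r.
have tail k : cmod (ssum (fun n => (z - (a n)%:C%C)^-1) N - ssum (D0 s) (N + k)) <=
    B / N%:R ^+ 2 * N.+1%:R + B * (N%:R^-1 - (N + k)%:R^-1).
  elim: k => [|k IH]; first by rewrite addn0 subrr mulr0 addr0 sD; exact: small.
  rewrite addnS ssumS opprD addrA.
  apply: le_trans (cmodB _ _) _.
  have -> : B / N%:R ^+ 2 * N.+1%:R + B * (N%:R^-1 - (N + k).+1%:R^-1) =
    B / N%:R ^+ 2 * N.+1%:R + B * (N%:R^-1 - (N + k)%:R^-1) + B * ((N + k)%:R^-1 - (N + k).+1%:R^-1).
    by ring.
  apply: lerD => //; set n := (N + k).+1.
  have nN : (N < n)%N by rewrite ltnS leq_addr.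
  have [_ h] := hA N n N1 N0; apply: le_trans (h nN) _.
  have nR : 0 < n%:R :> R by rewrite ltr0n.
  have nR' : 0 < (N + k)%:R :> R by rewrite ltr0n addn_gt0 N0.
  have NnR : N%:R <= n%:R :> R by rewrite ler_nat ltnW.
  apply: (@le_trans _ _ (B * (n%:R ^- 2))); last first.
    apply: ler_wpM2l => //.
    have -> : (N + k)%:R^-1 - n%:R^-1 = ((N + k)%:R * n%:R)^-1 :> R.
      have gE (x : R) : 0 < x -> x^-1 - (x + 1)^-1 = (x * (x + 1))^-1.
        by move=> x0; field; rewrite !gt_eqF // addr_gt0.
      by rewrite /n -natr1 gE.
    rewrite lef_pV2 ?posrE ?exprn_gt0 ?mulr_gt0 // expr2.
    by apply: ler_wpM2r; [exact: ltW | rewrite ler_nat leqnSn].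
  have -> : A * (1 + `|a n%:Z + a (- n%:Z)|) * (N%:R ^+ 2 / n%:R ^+ 4) =
     A * ((1 + `|a n%:Z + a (- n%:Z)|) * (N%:R / n%:R) ^+ 2) / n%:R ^+ 2.
    by field; rewrite gt_eqF.
  apply: ler_wpM2r; first by rewrite invr_ge0 exprn_ge0 // ltW.
  apply: ler_wpM2l => //.
  have t0 : 0 <= N%:R / n%:R :> R by rewrite divr_ge0 // ltW.
  have t1 : N%:R / n%:R <= 1 :> R by rewrite ler_pdivrMr // mul1r.
  have t2 : (N%:R / n%:R) ^+ 2 <= N%:R / n%:R :> R by rewrite expr2 ler_piMr.
  (* One factor N / n turns d n into d N, the other is bounded by 1. *)
  apply: (@le_trans _ _ ((1 + C0 + d * n%:R) * (N%:R / n%:R))).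
    apply: ler_pM; rewrite ?addr_ge0 ?sqr_ge0 //.
    by rewrite -addrA lerD2l [leRHS]addrC; exact: hC.
  have c1 : 0 <= 1 + C0 by apply: addr_ge0.
  rewrite [leLHS]mulrDl; apply: lerD; first by rewrite -[leRHS]mulr1 ler_wpM2l.
  by rewrite [N%:R / _]mulrC mulrA mulfK ?gt_eqF.
have := tail (M - N)%N; rewrite subnKC // => /le_trans; apply.
have h1 : B / N%:R ^+ 2 * N.+1%:R <= 2 * B / N%:R.
  have -> : 2 * B / N%:R = B / N%:R ^+ 2 * (N%:R + N%:R) by field; rewrite gt_eqF.
  apply: ler_wpM2l; first by rewrite divr_ge0 // exprn_ge0 // ltW.
  by rewrite -natr1 lerD2l.
have h2 : B * (N%:R^-1 - M%:R^-1) <= B / N%:R.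
  by apply: ler_wpM2l => //; rewrite gerBl invr_ge0.
apply: le_trans (lerD h1 h2) _.
by rewrite -mulrDl ler_pdivrMr //; lra.
Qed.

(** At sg = 1 / N, [tauber] compares the N-th symmetric sum with the Gaussian one truncated at any
    larger M; letting M grow gives a spectral sum by [step_kernel_cvg], and these converge by
    [Bsum_mstep_cvg]. *)
Lemma cauchy_sum_cvg : ccvg (ssum (fun n => (z - (a n)%:C%C)^-1)) (@cauchyL R Gam b z).
Proof.
move=> e e0; have e20 : 0 < e / 2 by rewrite divr_gt0.
have [N0 hN0] := tauber e20.
have [K hK] := @mstep_bound R Gam b z z0.
have [N1 hN1] := ccvgMl (- (2 * pi)%:C%C * 'i%C) (Bsum_mstep_cvg (qc := qc) z0) e20.
exists (maxn N0 N1.+1) => N; rewrite geq_max => /andP[NN0 NN1].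
case: N NN0 NN1 => // N NN0 NN1.
apply: le_trans (cmod_tri (- (2 * pi)%:C%C * 'i%C * Bsum (mstep N.+1%:R^-1 z)) _ _) _.
rewrite [e]splitr; apply: lerD; last by apply: hN1.
have dm : dominated (mstep N.+1%:R^-1 z).
  by exists K => g; apply: hK; [exact: inv_gt0 | exact: inv_le1].
have hs := @step_kernel_cvg R Lam c Gam b a qc z z0 _ (inv_gt0 N) dm.
apply/ler_addgt0Pl => e' e'0; have [M0 hM0] := hs _ e'0.
have h1 := hN0 N.+1 (maxn M0 N.+1) NN0 (leq_maxr _ _).
have h2 := hM0 (maxn M0 N.+1) (leq_maxl _ _).
apply: le_trans (cmod_tri (ssum (D0 (pi / N.+1%:R ^+ 2)) (maxn M0 N.+1)) _ _) _.
rewrite addrC; apply: lerD => //.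
by move: h2; rewrite exprVn.
Qed.

End TauberLimit.

(** * The symmetric product *)

Section ProductEstimates.
Context {R : realType}.
Local Notation C := (R[i]).

Let i1 (n : nat) : R := n.+1%:R^-1.

Lemma inv_sq_telescope n : (n.+2%:R ^+ 2)^-1 <= i1 n - i1 n.+1.
Proof.
have n0 : 0 < n.+1%:R :> R by rewrite ltr0n.
have gE (x : R) : 0 < x -> x^-1 - (x + 1)^-1 = (x * (x + 1))^-1.
  by move=> x0; field; rewrite !gt_eqF // addr_gt0.
rewrite /i1 -[n.+2%:R]natr1 gE // lef_pV2 ?posrE ?mulr_gt0 ?exprn_gt0 ?addr_gt0 // expr2.
by rewrite ler_pM2r ?addr_gt0 // lerDl.
Qed.

Lemma i1_ge0 n : 0 <= i1 n. Proof. by rewrite invr_ge0. Qed.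

Lemma telescope_cauchy (u : nat -> C) (A : R) : 0 <= A ->
  (forall n, cmod (u n.+1 - u n) <= A * (i1 n - i1 n.+1)) ->
  forall N M, (N <= M)%N -> cmod (u M - u N) <= A * i1 N.
Proof.
move=> A0 hu N M NM; have h k : cmod (u (N + k)%N - u N) <= A * (i1 N - i1 (N + k)%N).
  elim: k => [|k IH]; first by rewrite addn0 !subrr cmod0 mulr0.
  apply: le_trans (cmod_tri (u (N + k)%N) _ _) _; rewrite addnS.
  apply: le_trans (lerD (hu _) IH) _; rewrite -mulrDr; apply: ler_wpM2l => //; lra.
have := h (M - N)%N; rewrite subnKC // => /le_trans; apply.
by apply: ler_wpM2l => //; rewrite gerBl i1_ge0.
Qed.

Lemma i1_small (A e : R) : 0 <= A -> 0 < e -> exists N0 : nat, forall N, (N0 <= N)%N -> A * i1 N <= e.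
Proof.
move=> A0 e0; exists (Num.truncn (A / e)) => N hN.
rewrite ler_pdivrMr ?ltr0n // mulrC -ler_pdivrMr //.
by apply/ltW/(lt_le_trans (truncnS_gt _)); rewrite ler_nat ltnS.
Qed.

(** Weierstrass's primary factor of genus one. *)
Definition Efac (w : C) : C := (1 - w) * ce w.

Lemma Efac_le w : cmod (Efac w - 1) <= 13 * cmod w ^+ 2 * expR (2 * cmod w).
Proof.
have w0 := cmod_ge0 w.
have -> : Efac w - 1 = (1 - w) * (ce w - 1 - w) - w ^+ 2 by rewrite /Efac; ring.
apply: le_trans (cmodB _ _) _; rewrite cmodM cmodX.
have e1 := expR_ge1Dx (cmod w).
have h1 : cmod (1 - w) <= expR (cmod w) by apply: le_trans (cmodB _ _) _; rewrite cmod1.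
have h2 := cexp_taylor1 w.
have h3 := ler_pM (cmod_ge0 _) (cmod_ge0 _) h1 h2.
have -> : 13 * cmod w ^+ 2 * expR (2 * cmod w) =
    expR (cmod w) * (12 * cmod w ^+ 2 * expR (cmod w)) + cmod w ^+ 2 * expR (2 * cmod w).
  have -> : expR (2 * cmod w) = expR (cmod w) * expR (cmod w) by rewrite -expRD; congr expR; ring.
  ring.
apply: lerD => //; rewrite ler_peMr ?sqr_ge0 // -[leLHS]expR0 ler_expR mulr_ge0 //.
Qed.

Variable a : int -> R.
Variable k : R.
Hypothesis k0 : 0 < k.
Hypothesis ka : forall n : int, k * (`|n|%N.+1)%:R <= `|a n|.

Let a_neq0 n : (a n)%:C%C != 0 :> C.
Proof.
rewrite -(rmorph0 (real_complex R)) (inj_eq (@complexI R)) -normr_gt0.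
by apply: lt_le_trans (ka n); rewrite mulr_gt0 ?ltr0n.
Qed.

Lemma inv_a_le n : `|a n|^-1 <= k^-1 / (`|n|%N.+1)%:R.
Proof.
have kn : 0 < k * (`|n|%N.+1)%:R by rewrite mulr_gt0 ?ltr0n.
have an := lt_le_trans kn (ka n).
by rewrite -invfM lef_pV2 ?posrE.
Qed.

Definition sigma (N : nat) : C := ssum (fun n => (a n)%:C%C^-1) N.

Lemma sigma_cauchy_aux (z : C) : 0 < complex.Im z -> exists2 A : R, 0 <= A &
  forall n, cmod (((a n)%:C%C^-1 + (z - (a n)%:C%C)^-1)) <= A / (`|n|%N.+1)%:R ^+ 2.
Proof.
move=> z0; set K1 := 1 + cmod z / complex.Im z.
have K10 := K1_ge0 z0; have c0 := cmod_ge0 z.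
exists (cmod z * K1 * k^-1 ^+ 2) => [|n]; first by rewrite mulr_ge0 ?sqr_ge0 // mulr_ge0.
have zn := zsub_neq0 z0 (a n); have zp := zsub_cmod_gt0 z0 (a n); have an := a_neq0 n.
have -> : (a n)%:C%C^-1 + (z - (a n)%:C%C)^-1 = z * ((a n)%:C%C * (z - (a n)%:C%C))^-1.
  by field; rewrite an zn.
rewrite cmodM cmodV cmodM cmodR -!mulrA ler_wpM2l //.
rewrite invfM (_ : K1 * _ = (k^-1 / (`|n|%N.+1)%:R) * (K1 * (k^-1 / (`|n|%N.+1)%:R))); last first.
  by rewrite -exprVn; ring.
apply: ler_pM; rewrite ?invr_ge0 ?cmod_ge0 ?inv_a_le //.
apply: le_trans (_ : K1 * `|a n|^-1 <= _); last by apply: ler_wpM2l => //; exact: inv_a_le.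
have an0 : 0 < `|a n| by apply: lt_le_trans (ka n); rewrite mulr_gt0 ?ltr0n.
by rewrite ler_pdivlMr // mulrC ler_pdivrMr //; exact: zsub_ge.
Qed.

(** 1 / a_n + 1 / (z - a_n) = z / (a_n (z - a_n)) is O(1 / n^2), so convergence of the symmetric
    sums at a single [z] gives that of the sums of 1 / a_n. *)
Lemma sigma_cvg (z l : C) : 0 < complex.Im z ->
  ccvg (ssum (fun n => (z - (a n)%:C%C)^-1)) l -> exists s, ccvg sigma s.
Proof.
move=> z0 hl; have [A A0 hA] := sigma_cauchy_aux z0.
pose u := ssum (fun n => (a n)%:C%C^-1 + (z - (a n)%:C%C)^-1).
have hu n : cmod (u n.+1 - u n) <= 2 * A * (i1 n - i1 n.+1).
  rewrite /u ssumS addrAC subrr add0r; apply: le_trans (cmodD _ _) _.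
  apply: (@le_trans _ _ (A / n.+2%:R ^+ 2 + A / n.+2%:R ^+ 2)).
    by apply: lerD; [exact: (hA n.+1%:Z) | have := hA (- n.+1%:Z); rewrite abszN].
  have := ler_wpM2l A0 (inv_sq_telescope n).
  by move: (_ ^-1) (i1 n - i1 n.+1) => p q; lra.
have A20 : 0 <= 2 * A by rewrite mulr_ge0.
have [l' hl'] : exists l', ccvg u l'.
  apply: ccauchy_cvg => e e0; have [N0 hN0] := i1_small A20 (divr_gt0 e0 (ltr0n _ 2)).
  exists N0 => m n hm hn; apply: le_trans (cmod_tri (u N0) _ _) _.
  rewrite [e]splitr; apply: lerD; last rewrite cmod_dist;
    apply: le_trans (telescope_cauchy A20 hu _) (hN0 _ (leqnn _)) => //.
exists (l' + -1 * l); apply: ccvg_ext (ccvgD hl' (ccvgMl (-1) hl)) => n.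
rewrite /u /sigma !ssum_ints big_split /=; ring.
Qed.

Definition Pfac (N : nat) (z : C) : C := \prod_(n <- ints N) Efac (z / (a n)%:C%C).

Lemma PfacS N z : Pfac N.+1 z =
  Efac (z / (a N.+1%:Z)%:C%C) * Efac (z / (a (- N.+1%:Z))%:C%C) * Pfac N z.
Proof. by rewrite /Pfac /= !big_cons mulrA. Qed.

Lemma Efac_a_le (r : R) : 0 <= r -> exists2 K : R, 0 <= K & forall n z, cmod z <= r ->
  cmod (Efac (z / (a n)%:C%C) - 1) <= K / (`|n|%N.+1)%:R ^+ 2.
Proof.
move=> r0; pose W := r / k; have W0 : 0 <= W by rewrite divr_ge0 // ltW.
exists (13 * W ^+ 2 * expR (2 * W)) => [|n z zr]; first by rewrite mulr_ge0 ?expR_ge0 // mulr_ge0 ?sqr_ge0.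
have n0 : 0 < (`|n|%N.+1)%:R :> R by rewrite ltr0n.
have hw : cmod (z / (a n)%:C%C) <= W / (`|n|%N.+1)%:R.
  rewrite cmodM cmodV cmodR /W -mulrA; apply: ler_pM; rewrite ?cmod_ge0 ?invr_ge0 ?inv_a_le //.
have hw' : cmod (z / (a n)%:C%C) <= W.
  by apply: le_trans hw _; rewrite ler_pdivrMr // ler_peMr // ler1n.
apply: le_trans (Efac_le _) _; rewrite [leRHS]mulrAC; apply: ler_pM.
- by rewrite mulr_ge0 ?sqr_ge0.
- exact: expR_ge0.
- rewrite -[leRHS]mulrA ler_pM2l // -expr_div_n lerXn2r // nnegrE ?cmod_ge0 //.
  by rewrite divr_ge0 // ltW.
- by rewrite ler_expR ler_pM2l.
Qed.

Lemma Pfac_unif (r : R) : 0 <= r -> exists2 B : R, 0 <= B & (forall N z, cmod z <= r -> cmod (Pfac N z) <= B) /\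
  (forall N M z, cmod z <= r -> (N <= M)%N -> cmod (Pfac M z - Pfac N z) <= B * i1 N).
Proof.
move=> r0; have [K K0 hK] := Efac_a_le r0.
(* K (1 + K) + K, from splitting E1 E2 - 1 as (E1 - 1) E2 + (E2 - 1). *)
pose K' := K * (2 + K); have K'0 : 0 <= K' by rewrite mulr_ge0 // addr_ge0.
have pairK n z : cmod z <= r ->
    cmod (Efac (z / (a n.+1%:Z)%:C%C) * Efac (z / (a (- n.+1%:Z))%:C%C) - 1) <= K' * (i1 n - i1 n.+1).
  move=> zr; have h1 := hK n.+1%:Z z zr; have h2 := hK (- n.+1%:Z) z zr.
  rewrite abszN /= in h1 h2; have h3 := inv_sq_telescope n.
  set E1 := Efac _ in h1 *; set E2 := Efac _ in h2 *.
  have n2 : 1 <= n.+2%:R ^+ 2 :> R by rewrite exprn_ege1 // ler1n.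
  have h4 : cmod E2 <= 1 + K.
    apply: le_trans (cmod_rtri _ 1) _; rewrite cmod1 lerD2l; apply: le_trans h2 _.
    by rewrite ler_pdivrMr ?ler_peMr // (lt_le_trans ltr01).
  have -> : E1 * E2 - 1 = (E1 - 1) * E2 + (E2 - 1) by ring.
  apply: le_trans (cmodD _ _) _; rewrite cmodM.
  apply: le_trans (lerD (ler_pM (cmod_ge0 _) (cmod_ge0 _) h1 h4) h2) _.
  have -> : K / n.+2%:R ^+ 2 * (1 + K) + K / n.+2%:R ^+ 2 = K' / n.+2%:R ^+ 2 by rewrite /K'; ring.
  by apply: ler_wpM2l.
pose B0 := (1 + K) * expR K'; have B00 : 0 <= B0 by rewrite mulr_ge0 ?expR_ge0 // addr_ge0.
have bnd N z : cmod z <= r -> cmod (Pfac N z) <= (1 + K) * expR (K' * (1 - i1 N)).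
  move=> zr; elim: N => [|N IH].
    rewrite /i1 invr1 subrr mulr0 expR0 mulr1 /Pfac big_seq1.
    apply: le_trans (cmod_rtri _ 1) _; rewrite cmod1 lerD2l.
    by have := hK 0 z zr; rewrite expr1n divr1.
  rewrite PfacS cmodM; set E := Efac _ * _.
  have hE : cmod E <= expR (K' * (i1 N - i1 N.+1)).
    apply: le_trans (cmod_rtri _ 1) _; rewrite cmod1.
    by apply: le_trans (expR_ge1Dx _); rewrite lerD2l; exact: pairK.
  apply: le_trans (ler_pM (cmod_ge0 _) (cmod_ge0 _) hE IH) _.
  by rewrite mulrCA -expRD -mulrDr le_eqVlt; apply/orP; left; apply/eqP; congr (_ * expR (_ * _)); ring.
have bnd' N z : cmod z <= r -> cmod (Pfac N z) <= B0.
  move=> zr; apply: le_trans (bnd N z zr) _; rewrite /B0; apply: ler_wpM2l; first exact: addr_ge0.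
  by rewrite ler_expR ler_piMr // gerBl i1_ge0.
exists (B0 + K' * B0) => [|]; first by rewrite addr_ge0 // mulr_ge0.
split=> [N z zr|N M z zr NM].
  by apply: le_trans (bnd' N z zr) _; rewrite lerDl mulr_ge0.
have K'B : 0 <= K' * B0 by rewrite mulr_ge0.
apply: le_trans (telescope_cauchy (u := Pfac^~ z) K'B _ NM) _.
  move=> n; rewrite PfacS -[X in _ - X]mul1r -mulrBl cmodM [leRHS]mulrAC.
  by apply: ler_pM; rewrite ?cmod_ge0 ?pairK ?bnd' //.
by apply: ler_wpM2r; [exact: i1_ge0 | rewrite lerDr].
Qed.

Definition fpoly (N : nat) : {poly C} := \prod_(n <- ints N) (1 - (a n)%:C%C^-1 *: 'X).

(** This separates the conditionally convergent part, in [sigma], from an absolutely convergent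
    product of primary factors. *)
Lemma fpolyE N z : (fpoly N).[z] = ce (- (sigma N * z)) * Pfac N z.
Proof.
rewrite /fpoly /sigma ssum_ints /Pfac.
elim: (ints N) => [|n s IH]; first by rewrite !big_nil hornerC mul0r oppr0 ce0 mulr1.
rewrite !big_cons hornerM IH mulrDl opprD ceD /Efac.
rewrite hornerD hornerN hornerZ hornerX hornerC.
set E := ce (- ((\sum_(_ <- _) _) * z)); set P := \prod_(_ <- _) _.
rewrite ceN [z / _]mulrC; have := ce_neq0 ((a n)%:C%C^-1 * z).
by move: (ce _) => w w0; field; rewrite w0 andbT; exact: a_neq0.
Qed.

Lemma fpoly_unif (s : C) (r : R) : ccvg sigma s -> 0 <= r ->
  (exists B : R, exists N0 : nat, forall N z, (N0 <= N)%N -> cmod z <= r -> cmod (fpoly N).[z] <= B) /\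
  (forall e : R, 0 < e -> exists N0, forall N M z, (N0 <= N)%N -> (N <= M)%N -> cmod z <= r ->
    cmod ((fpoly M).[z] - (fpoly N).[z]) <= e).
Proof.
move=> hs r0; have [B B0 [hB1 hB2]] := Pfac_unif r0.
have [Ns [S hS]] := ccvg_bounded hs.
have hS0 : 0 <= S by apply: le_trans (hS Ns (leqnn _)); exact: cmod_ge0.
have ceb N z : (Ns <= N)%N -> cmod z <= r -> cmod (ce (- (sigma N * z))) <= expR (S * r).
  move=> Nn zr; apply: le_trans (cmod_ce_le _) _; rewrite ler_expR cmodN cmodM.
  by apply: ler_pM; rewrite ?cmod_ge0 ?hS.
split.
  exists (expR (S * r) * B), Ns => N z Nn zr; rewrite fpolyE cmodM.
  by apply: ler_pM; rewrite ?cmod_ge0 ?ceb ?hB1.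
move=> e e0; set T := expR (S * r).
have T0 : 0 < T := expR_gt0 _.
pose D := T * (4 * r * expR r) * B + T * B.
have D0 : 0 <= D by rewrite addr_ge0 // !mulr_ge0 ?expR_ge0 // ltW.
have D1 : 0 < D + 1 by rewrite ltr_wpDl.
have d0 : 0 < Num.min 1 (e / (D + 1)) by rewrite lt_min ltr01 divr_gt0.
set d := Num.min _ _ in d0.
have d1 : d <= 1 by rewrite ge_min lexx.
have d2 : d * (D + 1) <= e by rewrite -ler_pdivlMr // ge_min lexx orbT.
have [N1 hN1] := hs _ (divr_gt0 d0 (ltr0n _ 2)).
have [N2 hN2] := i1_small ler01 d0.
exists (maxn Ns (maxn N1 N2)) => N M z; rewrite !geq_max => /and3P[h0 h1 h2] NM zr.
have sd : cmod (sigma M - sigma N) <= d.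
  apply: le_trans (cmod_tri s _ _) _; rewrite [d]splitr; apply: lerD.
    by apply: hN1; exact: leq_trans NM.
  by rewrite cmod_dist; exact: hN1.
rewrite !fpolyE.
have -> : ce (- (sigma M * z)) * Pfac M z - ce (- (sigma N * z)) * Pfac N z =
  (ce (- (sigma M * z)) - ce (- (sigma N * z))) * Pfac M z +
  ce (- (sigma N * z)) * (Pfac M z - Pfac N z) by ring.
apply: le_trans (cmodD _ _) _.
rewrite [cmod (_ * Pfac M z)]cmodM [cmod (_ * (Pfac M z - _))]cmodM.
have k1 : cmod (ce (- (sigma M * z)) - ce (- (sigma N * z))) <= T * (4 * r * expR r) * d.
  apply: le_trans (cexp_dist _ _) _; rewrite -[leRHS]mulrA; apply: ler_pM; rewrite ?expR_ge0 //.
  - by rewrite !mulr_ge0 ?cmod_ge0 ?expR_ge0.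
  - by rewrite ler_expR cmodN cmodM; apply: ler_pM; rewrite ?cmod_ge0 ?hS.
  have -> : - (sigma M * z) - - (sigma N * z) = - ((sigma M - sigma N) * z) by ring.
  rewrite cmodN cmodM.
  have q1 : cmod (sigma M - sigma N) * cmod z <= d * r by apply: ler_pM; rewrite ?cmod_ge0.
  have q2 : d * r <= r by rewrite ler_piMl.
  have -> : 4 * r * expR r * d = 4 * (d * r) * expR r by ring.
  apply: ler_pM; rewrite ?expR_ge0 ?mulr_ge0 ?cmod_ge0 //.
    by rewrite ler_pM2l.
  by rewrite ler_expR (le_trans q1).
have k2 : cmod (Pfac M z - Pfac N z) <= B * d.
  apply: le_trans (hB2 N M z zr NM) _; apply: ler_wpM2l => //.
  by have := hN2 N h2; rewrite mul1r.
apply: le_trans (_ : T * (4 * r * expR r) * d * B + T * (B * d) <= _).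
  apply: lerD; apply: ler_pM; rewrite ?cmod_ge0 ?hB1 //; exact: ceb.
apply: (le_trans _ d2); rewrite /D; have := ltW d0; lra.
Qed.

Definition flim (z : C) : C := xget 0 [set l | ccvg (fun N => (fpoly N).[z]) l].

Lemma fpoly_cvg s z : ccvg sigma s -> ccvg (fun N => (fpoly N).[z]) (flim z).
Proof.
move=> hs; apply: (xgetPex (0 : C) (P := [set l | ccvg (fun N => (fpoly N).[z]) l])).
have [_ h] := fpoly_unif hs (cmod_ge0 z).
apply: ccauchy_cvg => e e0; have [N0 hN0] := h _ (divr_gt0 e0 (ltr0n _ 2)).
exists N0 => m n hm hn; apply: le_trans (cmod_tri ((fpoly N0).[z]) _ _) _.
by rewrite [e]splitr; apply: lerD; last rewrite cmod_dist; apply: hN0.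
Qed.

Lemma flim_polylim s : ccvg sigma s -> polylim flim.
Proof.
move=> hs r e e0.
have [_ h] := fpoly_unif hs (normr_ge0 r).
have [N0 hN0] := h _ (divr_gt0 e0 (ltr0n _ 2)).
exists (fpoly N0) => z zr.
have [N1 hN1] := fpoly_cvg z hs (divr_gt0 e0 (ltr0n _ 2)).
apply: le_trans (cmod_tri ((fpoly (maxn N0 N1)).[z]) _ _) _.
rewrite [e]splitr; apply: lerD; last by apply: hN1; exact: leq_maxr.
rewrite cmod_dist; apply: hN0; rewrite ?leq_maxl //.
by apply: le_trans zr (ler_norm _).
Qed.

Lemma fpoly_deriv N z : 0 < complex.Im z ->
  (fpoly N)^`().[z] = (fpoly N).[z] * ssum (fun n => (z - (a n)%:C%C)^-1) N.
Proof.
move=> z0; rewrite /fpoly ssum_ints.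
elim: (ints N) => [|n s IH]; first by rewrite !big_nil derivC hornerC mulr0.
rewrite !big_cons derivM hornerD !hornerM IH derivB derivC derivZ derivX.
rewrite !(hornerD, hornerN, hornerZ, hornerX, hornerC) mulr1.
have := zsub_neq0 z0 (a n); have := a_neq0 n.
move: (\sum_(_ <- _) _) (_.[z]) ((a n)%:C%C) => S P w w0 zw; field.
by rewrite w0 zw.
Qed.

(** The equation f' = L f with a remainder that is uniform on bounded parts of the upper half-plane,
    up to the real axis, since it comes from bounds for [fpoly] on a full disc. *)
Lemma flim_taylor s (L : C -> C) (r : R) : ccvg sigma s ->
  (forall z, 0 < complex.Im z -> ccvg (ssum (fun n => (z - (a n)%:C%C)^-1)) (L z)) -> 0 <= r ->
  exists2 M : R, 0 <= M & forall w h, 0 < complex.Im w -> cmod w <= r -> cmod h <= 2^-1 ->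
    cmod (flim (w + h) - flim w - h * (flim w * L w)) <= M * cmod h ^+ 2.
Proof.
move=> hs hL r0; have r1 : 0 <= r + 1 by rewrite addr_ge0.
have [[B [N0 hB]] _] := fpoly_unif hs r1.
exists (2 * `|B|) => [|w h w0 wr hh]; first by rewrite mulr_ge0.
apply: (poly_taylor1_lim (p := fpoly)) => // [z _||].
- exact: fpoly_cvg hs.
- exists N0 => n Nn z zw; apply: le_trans (hB n z Nn _) (ler_norm _).
  by apply: le_trans (cmod_rtri z w) _; apply: lerD.
- apply: ccvg_ext (ccvgM (fpoly_cvg w hs) (hL w w0)) => n.
  by rewrite fpoly_deriv.
Qed.

End ProductEstimates.

(** * Logarithmic derivative in the upper half-plane *)

Section LogDerivative.
Context {R : realType}.
Local Notation C := (R[i]).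

(* Cutting the segment into [n] pieces gives an increment of at most [M V^2 / n]. *)
Lemma segment_const (Q : C -> C) (z0 z1 : C) (M d : R) : 0 < d -> 0 <= M ->
  (forall t h, 0 <= t <= 1 -> cmod h <= d ->
    cmod (Q (z0 + t%:C%C * (z1 - z0) + h) - Q (z0 + t%:C%C * (z1 - z0))) <= M * cmod h ^+ 2) ->
  Q z1 = Q z0.
Proof.
move=> d0 M0 H; apply/eqP; rewrite -subr_eq0; apply/eqP/cmod_eq0/eqP.
rewrite eq_le cmod_ge0 andbT; set V := cmod (z1 - z0).
have V0 : 0 <= V := cmod_ge0 _.
apply/ler_addgt0Pl => e e0; rewrite addr0.
pose n := (Num.truncn (V / d) + Num.truncn (M * V ^+ 2 / e)).+1.
have n0 : 0 < n%:R :> R by rewrite ltr0n.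
have n1 : V / n%:R <= d.
  rewrite ler_pdivrMr // [d * _]mulrC -ler_pdivrMr //; apply/ltW/(lt_le_trans (truncnS_gt _)).
  by rewrite ler_nat ltnS leq_addr.
have n2 : M * V ^+ 2 / n%:R <= e.
  rewrite ler_pdivrMr // [e * _]mulrC -ler_pdivrMr //; apply/ltW/(lt_le_trans (truncnS_gt _)).
  by rewrite ler_nat ltnS leq_addl.
pose zt j : C := z0 + (j%:R / n%:R)%:C%C * (z1 - z0).
have step j : (j <= n)%N -> cmod (Q (zt j) - Q z0) <= j%:R * (M * (V / n%:R) ^+ 2).
  elim: j => [_|j IH jn]; first by rewrite /zt mul0r mul0r addr0 subrr cmod0 mul0r.
  apply: le_trans (cmod_tri (Q (zt j)) _ _) _.
  rewrite -[j.+1%:R]natr1 mulrDl mul1r addrC; apply: lerD; first exact: IH (ltnW jn).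
  pose h := (n%:R^-1)%:C%C * (z1 - z0).
  have -> : zt j.+1 = z0 + (j%:R / n%:R)%:C%C * (z1 - z0) + h.
    by rewrite /zt -addrA -mulrDl -rmorphD -natr1 mulrDl mul1r.
  have ch : cmod h = V / n%:R by rewrite /h cmodM cmodR ger0_norm ?invr_ge0 // mulrC.
  rewrite -ch; apply: H; rewrite ?ch //; apply/andP; split; first by rewrite divr_ge0.
  by rewrite ler_pdivrMr // mul1r ler_nat ltnW.
have := step n (leqnn _).
have -> : zt n = z1 by rewrite /zt divff ?gt_eqF // mul1r addrC subrK.
move=> /le_trans; apply; apply: le_trans n2.
by rewrite le_eqVlt; apply/orP; left; apply/eqP; field; rewrite gt_eqF.
Qed.

(** The increment form of (f e^(- l))' = 0: [fw] and [fh] stand for f at w and w + h, [l] for the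
    logarithmic derivative, [dl] for the increment of the logarithm. *)
Lemma exp_correction (B M1 M2 : R) : 0 <= B -> 0 <= M1 -> 0 <= M2 ->
  exists2 M : R, 0 <= M & forall fw fh l dl h : C, cmod fw <= B -> cmod l <= B -> cmod h <= 1 ->
    cmod (fh - fw - h * (fw * l)) <= M1 * cmod h ^+ 2 ->
    cmod (dl - h * l) <= M2 * cmod h ^+ 2 ->
    cmod (fh * ce (- dl) - fw) <= M * cmod h ^+ 2.
Proof.
move=> B0 M10 M20; pose U := B + M2; have U0 : 0 <= U by rewrite addr_ge0.
pose M := M1 * expR U + B * (1 + B) * (12 * U ^+ 2 * expR U) + B * (B ^+ 2 + M2 * (1 + B)).
have B1 : 0 <= 1 + B by rewrite addr_ge0.
have eU := expR_ge0 U.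
exists M => [|fw fh l dl h hf hl h1 e1 e2].
  rewrite /M addr_ge0 //; last by rewrite mulr_ge0 // addr_ge0 ?sqr_ge0 // mulr_ge0.
  by rewrite addr_ge0 // mulr_ge0 // mulr_ge0 // mulr_ge0 // sqr_ge0.
have h0 := cmod_ge0 h; have hh : cmod h ^+ 2 <= cmod h by rewrite expr2 ler_piMr.
pose rho := dl - h * l; pose E := ce (- dl).
have hdl : cmod dl <= U * cmod h.
  have -> : dl = h * l + rho by rewrite /rho; ring.
  apply: le_trans (cmodD _ _) _; rewrite mulrDl cmodM mulrC; apply: lerD; first exact: ler_wpM2r.
  by apply: le_trans e2 _; exact: ler_wpM2l.
have hdl' : cmod dl <= U by apply: le_trans hdl _; rewrite ler_piMr.
have hE : cmod E <= expR U by apply: le_trans (cmod_ce_le _) _; rewrite ler_expR cmodN.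
have hE2 : cmod (E - 1 - (- dl)) <= 12 * U ^+ 2 * expR U * cmod h ^+ 2.
  apply: le_trans (cexp_taylor1 _) _; rewrite cmodN [leRHS]mulrAC; apply: ler_pM.
  - by rewrite mulr_ge0 ?sqr_ge0.
  - exact: expR_ge0.
  - rewrite -[leRHS]mulrA ler_pM2l // -exprMn lerXn2r // nnegrE ?cmod_ge0 // mulr_ge0 //.
  - by rewrite ler_expR.
have h1l : cmod (1 + h * l) <= 1 + B.
  apply: le_trans (cmodD _ _) _; rewrite cmod1 lerD2l cmodM -[leRHS]mul1r.
  by apply: ler_pM; rewrite ?cmod_ge0.
(* The linear terms cancel and three terms of second order remain. *)
have -> : fh * E - fw = (fh - fw - h * (fw * l)) * E + fw * (1 + h * l) * (E - 1 - (- dl)) -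
    fw * ((h * l) ^+ 2 + rho * (1 + h * l)) by rewrite /rho; ring.
apply: le_trans (cmodB _ _) _; rewrite /M [leRHS]mulrDl; apply: lerD.
  rewrite [leRHS]mulrDl; apply: le_trans (cmodD _ _) _; apply: lerD.
    by rewrite [leLHS]cmodM [leRHS]mulrAC; apply: ler_pM; rewrite ?cmod_ge0.
  rewrite [leLHS]cmodM -[leRHS]mulrA; apply: ler_pM; rewrite ?cmod_ge0 // [leLHS]cmodM.
  by apply: ler_pM; rewrite ?cmod_ge0.
rewrite [leLHS]cmodM -[leRHS]mulrA; apply: ler_pM; rewrite ?cmod_ge0 //.
apply: le_trans (cmodD _ _) _; rewrite [leRHS]mulrDl; apply: lerD.
  by rewrite cmodX cmodM exprMn [leRHS]mulrC; apply: ler_wpM2l; rewrite ?sqr_ge0 // lerXn2r // nnegrE ?cmod_ge0.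
by rewrite [leLHS]cmodM [leRHS]mulrAC; apply: ler_pM; rewrite ?cmod_ge0.
Qed.

End LogDerivative.

(** * An antiderivative of the spectral series *)

Section Exponent.
Context {R : realType}.
Local Notation C := (R[i]).
Context {Lam : set R} {c : R -> nat} {Gam : set R} {b : R -> C} {a : int -> R}.
Context {qc : quasicrystal Lam c Gam b a}.

Let tb := qc_tempered (quasicrystal := qc).

Local Notation wt := (wt Gam b).
Local Notation wB := (wB Gam b).
Local Notation Bsum := (Bsum Gam b).
Local Notation dominated := (dominated Gam b).
Local Notation beta0 := (@beta0 R Gam b).

Lemma cmod_freq (g : R) (z : C) : cmod ('i%C * (2 * pi * g)%:C%C * z) = 2 * pi * `|g| * cmod z.
Proof.
by rewrite !cmodM cmodi mul1r cmodR normrM (ger0_norm (x := 2 * pi)) // mulr_ge0 // pi_ge0.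
Qed.

(** Integrating e^(2 pi i g z) divides it by [g]. Below frequency 1 the constant 1 is subtracted to
    compensate for small [g]; from 1 on, as in [hmult], the division is harmless. *)
Definition gmult (z : C) (g : R) : C :=
  if (0 < g) && (g < 1) then (ce ('i%C * (2 * pi * g)%:C%C * z) - 1) / g%:C%C else 0.

Definition hmult (z : C) (g : R) : C :=
  if 1 <= g then ce ('i%C * (2 * pi * g)%:C%C * z) / g%:C%C else 0.

Definition pmult (z : C) (g : R) : C :=
  if 0 < g then ce ('i%C * (2 * pi * g)%:C%C * z) else 0.

Lemma wt0 g : 0 <= wt g. Proof. by rewrite ltW // wt_gt0. Qed.

(** The difference vanishes to first order in [g], which pays for the division. As the frequencies
    stay below 1, the bound holds on discs of the whole plane, so [gfun] will be entire, whereas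
    [hmult] is bounded only above the real axis. *)
Lemma gmult_bound (r : R) : 0 <= r -> exists2 K : R, 0 <= K & forall z g, cmod z <= r ->
  cmod (gmult z g) * wt g <= K.
Proof.
move=> r0; exists (4 * (2 * pi * r) * expR (2 * pi * r) * 2 ^+ (wN Gam b)) => [|z g zr].
  by rewrite mulr_ge0 ?exprn_ge0 // mulr_ge0 ?expR_ge0 // !mulr_ge0 // pi_ge0.
have p0 : 0 <= 2 * pi * r by rewrite !mulr_ge0 // pi_ge0.
rewrite /gmult; case: ifPn => [/andP[g0 g1]|_]; last first.
  by rewrite cmod0 mul0r mulr_ge0 ?exprn_ge0 // mulr_ge0 ?expR_ge0 // mulr_ge0.
apply: ler_pM; rewrite ?cmod_ge0 ?wt0 //; last first.
  by rewrite /wt lerXn2r // ?nnegrE ?addr_ge0 // gtr0_norm //; lra.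
rewrite cmodM cmodV cmodR gtr0_norm // ler_pdivrMr //.
apply: le_trans (cexp_sub1 _) _; rewrite cmod_freq gtr0_norm //.
have hz : 2 * pi * g * cmod z <= 2 * pi * r * g.
  by rewrite mulrAC; apply: ler_wpM2r; [exact: ltW | apply: ler_wpM2l; rewrite ?mulr_ge0 ?pi_ge0].
rewrite [leRHS]mulrAC -[4 * (2 * pi * r) * g]mulrA; apply: ler_pM; rewrite ?expR_ge0 //.
- by rewrite !mulr_ge0 ?pi_ge0 ?cmod_ge0 // ltW.
- by rewrite ler_pM2l.
- by rewrite ler_expR (le_trans hz) // ler_piMr // ltW.
Qed.

Lemma freq_bound (s : R) : 0 < s -> exists2 K : R, 0 < K & forall z g, s <= complex.Im z -> 0 <= g ->
  cmod (ce ('i%C * (2 * pi * g)%:C%C * z)) * wt g <= K.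
Proof.
move=> s0; have p0 : 0 < 2 * pi * s by rewrite !mulr_gt0 ?pi_gt0.
have [K K0 hK] := @wt_le_exp R Gam b _ p0; exists K => // z g sz g0.
rewrite cmod_ce_re; apply: le_trans (_ : expR (- (2 * pi * s) * g) * (K * expR (2 * pi * s * `|g|)) <= _).
  apply: ler_pM; rewrite ?expR_ge0 ?wt0 //.
  by rewrite ler_expR ler_wpM2r // lerN2 ler_wpM2l // mulr_ge0 // pi_ge0.
by rewrite ger0_norm // mulrCA -expRD mulNr addNr expR0 mulr1.
Qed.

Lemma pmult_bound (s : R) : 0 < s -> exists2 K : R, 0 < K & forall z g, s <= complex.Im z ->
  cmod (pmult z g) * wt g <= K.
Proof.
move=> s0; have [K K0 hK] := freq_bound s0; exists K => // z g sz; rewrite /pmult.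
by case: ifPn => [g0|_]; [apply: hK => //; exact: ltW | rewrite cmod0 mul0r ltW].
Qed.

Lemma hmult_bound (s : R) : 0 < s -> exists2 K : R, 0 < K & forall z g, s <= complex.Im z ->
  cmod (hmult z g) * wt g <= K.
Proof.
move=> s0; have [K K0 hK] := freq_bound s0; exists K => // z g sz; rewrite /hmult.
case: ifPn => [g1|_]; last by rewrite cmod0 mul0r ltW.
have g0 : 0 < g by lra.
apply: le_trans (hK z g sz (ltW g0)); apply: ler_wpM2r; first exact: wt0.
rewrite cmodM cmodV cmodR gtr0_norm // ler_piMr ?cmod_ge0 //.
by rewrite invf_le1.
Qed.

Lemma gmult_dom z : dominated (gmult z).
Proof. by have [K _ hK] := gmult_bound (cmod_ge0 z); exists K => g; apply: hK. Qed.

Lemma pmult_dom z : 0 < complex.Im z -> dominated (pmult z).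
Proof. by move=> z0; have [K _ hK] := pmult_bound z0; exists K => g; apply: hK. Qed.

Lemma hmult_dom z : 0 < complex.Im z -> dominated (hmult z).
Proof. by move=> z0; have [K _ hK] := hmult_bound z0; exists K => g; apply: hK. Qed.

Lemma delta0_dom : dominated (fun g => (g == 0)%:R).
Proof.
exists (wt 0) => g; have [->|_] := eqVneq g 0; first by rewrite cmod1 mul1r.
by rewrite cmod0 mul0r wt0.
Qed.

Lemma BsumZ_dom (k : C) m : dominated m -> dominated (fun g => k * m g).
Proof.
move=> [K hK]; exists (cmod k * K) => g; rewrite cmodM -mulrA.
by apply: ler_wpM2l; [exact: cmod_ge0 | exact: hK].
Qed.

Lemma BsumD_dom m n : dominated m -> dominated n -> dominated (fun g => m g + n g).
Proof.
move=> [K hK] [L hL]; exists (K + L) => g.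
apply: le_trans (ler_wpM2r (wt0 g) (cmodD _ _)) _.
by rewrite mulrDl; apply: lerD.
Qed.

Lemma Bsum_hstep z : 0 < complex.Im z ->
  Bsum (hstep z) = (gcdf 0)%:C%C * beta0 + Bsum (pmult z).
Proof.
move=> z0; rewrite -BsumZ //; last exact: delta0_dom.
rewrite -BsumD //; [|exact: BsumZ_dom delta0_dom | exact: pmult_dom].
apply: eq_Bsum => g; rewrite /hstep /pmult; have [g0|g0|<-] := ltgtP 0 g.
- by rewrite /= mulr0 add0r mul1r.
- by rewrite /= mulr0 addr0 mul0r.
- by rewrite /= addr0 !mulr0 mul0r ce0 mulr1.
Qed.

Definition gfun (z : C) : C := Bsum (gmult z).
Definition hfun (z : C) : C := Bsum (hmult z).
(** An antiderivative of [cauchyL] on the upper half-plane: the factor - 2 pi i turns the integral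
    of e^(2 pi i g z) into - e^(2 pi i g z) / g. *)
Definition logf (z : C) : C :=
  - (2 * pi)%:C%C * 'i%C * ((gcdf 0)%:C%C * beta0) * z - gfun z - hfun z.

Lemma logf_taylor (s : R) : 0 < s -> exists2 M : R, 0 <= M & forall w h, s <= complex.Im w ->
  cmod h <= s / 2 ->
  cmod (logf (w + h) - logf w - h * @cauchyL R Gam b w) <= M * cmod h ^+ 2.
Proof.
move=> s0; have p0 : 0 < pi :> R := pi_gt0 R.
(* The decay e^(- 2 pi s g) pays for e^(pi s g), due to the increment [h], and twice for e^(pi s g /
   2): once for the weight, once for the factor [g] left by the second-order remainder. *)
have d0 : 0 < pi * s / 2 by rewrite divr_gt0 // mulr_gt0.
have [K K0 hK] := @wt_le_exp R Gam b _ d0.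
pose M := 12 * (2 * pi) ^+ 2 * (pi * s / 2)^-1 * K.
have M0 : 0 <= M by rewrite mulr_ge0 ?(ltW K0) // mulr_ge0 ?invr_ge0 ?(ltW d0) // mulr_ge0 // sqr_ge0.
exists (M * wB) => [|w h sw hs]; first by rewrite mulr_ge0 // (wB_ge0 tb).
have w0 : 0 < complex.Im w by exact: lt_le_trans sw.
have wh0 : 0 < complex.Im (w + h).
  rewrite ImD; have := le_trans (cmod_Im h) hs; have := ler_norm (- complex.Im h); rewrite normrN; lra.
pose T g : C := gmult (w + h) g + hmult (w + h) g + (- 1) * (gmult w g + hmult w g) +
   (- ((2 * pi)%:C%C * 'i%C * h)) * pmult w g.
have TE : logf (w + h) - logf w - h * @cauchyL R Gam b w = - Bsum T.
  have dg z := gmult_dom z; have dp := pmult_dom w0.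
  have dh1 := hmult_dom wh0; have dh2 := hmult_dom w0.
  have e1 := BsumD_dom (dg (w + h)) dh1.
  have e2 := BsumD_dom (dg w) dh2.
  rewrite /T !(BsumD tb) ?(BsumZ tb) ?(BsumD tb) //; do ?exact: BsumZ_dom; last first.
    by apply: BsumD_dom => //; exact: BsumZ_dom.
  rewrite /cauchyL Bsum_hstep // /logf /gfun /hfun; ring.
have Tb g : cmod (T g) * wt g <= M * cmod h ^+ 2.
  have hh0 : 0 <= M * cmod h ^+ 2 by rewrite mulr_ge0 // sqr_ge0.
  have [g0|g0] := leP g 0.
    have -> : T g = 0; last by rewrite cmod0 mul0r.
    rewrite /T /gmult /hmult /pmult ltNge g0 /= lt_geF /=; last by lra.
    ring.
  set W := 'i%C * (2 * pi * g)%:C%C.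
  have gc : g%:C%C != 0 :> C by rewrite -(rmorph0 (real_complex R)) (inj_eq (@complexI R)) gt_eqF.
  have -> : T g = ce (W * w) * (ce (W * h) - 1 - W * h) / g%:C%C.
    have WE : (2 * pi)%:C%C * 'i%C = W / g%:C%C :> C.
      by rewrite /W rmorphM /=; field.
    rewrite /T /gmult /hmult /pmult g0 /= -/W WE mulrDr ceD.
    by case: (ltP g 1) => g1; rewrite ?g1 /=; field.
  rewrite cmodM cmodV cmodM cmodR (gtr0_norm g0) cmod_ce_re.
  have h1 := cexp_taylor1 (W * h).
  rewrite /W cmod_freq (gtr0_norm g0) -/W in h1.
  have e1 : expR (- (2 * pi * complex.Im w) * g) <= expR (- (2 * pi * s) * g).
    by rewrite ler_expR ler_wpM2r ?(ltW g0) // lerN2 ler_wpM2l // mulr_ge0 // ltW.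
  have e2 : expR (2 * pi * g * cmod h) <= expR (pi * s * g).
    rewrite ler_expR [leRHS]mulrAC; apply: le_trans (_ : 2 * pi * g * (s / 2) <= _).
      by apply: ler_wpM2l => //; rewrite !mulr_ge0 // ltW.
    by rewrite le_eqVlt; apply/orP; left; apply/eqP; move: pi => p; field.
  have e3 : g <= (pi * s / 2)^-1 * expR (pi * s / 2 * g).
    by rewrite ler_pdivlMl //; have := expR_ge1Dx (pi * s / 2 * g); lra.
  have e4 := hK g; rewrite (gtr0_norm g0) in e4.
  have E : expR (- (2 * pi * s) * g) * expR (pi * s * g) * (expR (pi * s / 2 * g) * expR (pi * s / 2 * g)) = 1.
    by rewrite -!expRD -[RHS]expR0; congr expR; move: (pi) => p; field.
  apply: le_trans (_ : expR (- (2 * pi * s) * g) * (12 * (2 * pi * g * cmod h) ^+ 2 * expR (pi * s * g)) / g *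
     (K * expR (pi * s / 2 * g)) <= _).
    apply: ler_pM => //; rewrite ?wt0 //; first by rewrite divr_ge0 ?(ltW g0) // mulr_ge0 ?cmod_ge0 ?expR_ge0.
    apply: ler_wpM2r; first by rewrite invr_ge0 ltW.
    apply: ler_pM; rewrite ?cmod_ge0 ?expR_ge0 //; apply: le_trans h1 _.
    by apply: ler_wpM2l => //; rewrite mulr_ge0 // sqr_ge0.
  have -> : expR (- (2 * pi * s) * g) * (12 * (2 * pi * g * cmod h) ^+ 2 * expR (pi * s * g)) / g *
     (K * expR (pi * s / 2 * g)) = 12 * (2 * pi) ^+ 2 * K * cmod h ^+ 2 *
       (expR (- (2 * pi * s) * g) * expR (pi * s * g) * (g * expR (pi * s / 2 * g))).
    move: (expR _) (expR _) (expR _) => x1 x2 x3; move: (pi) => p; field; rewrite gt_eqF //.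
  have -> : M * cmod h ^+ 2 = 12 * (2 * pi) ^+ 2 * K * cmod h ^+ 2 * (pi * s / 2)^-1 by rewrite /M; ring.
  apply: ler_wpM2l.
    by rewrite mulr_ge0 ?sqr_ge0 // mulr_ge0 ?(ltW K0) // mulr_ge0 // sqr_ge0.
  have -> : (pi * s / 2)^-1 = expR (- (2 * pi * s) * g) * expR (pi * s * g) *
      (expR (pi * s / 2 * g) * expR (pi * s / 2 * g) * (pi * s / 2)^-1) by rewrite mulrA E mul1r.
  apply: ler_wpM2l; first by rewrite mulr_ge0 ?expR_ge0.
  rewrite [leRHS]mulrC [leRHS]mulrA; apply: ler_wpM2r => //; exact: expR_ge0.
rewrite TE cmodN; apply: le_trans (Bsum_le tb Tb) _.
by rewrite mulrAC.
Qed.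

End Exponent.

(** * The entire function F and its form in the upper half-plane *)

Section QuasicrystalFunction.
Context {R : realType}.
Local Notation C := (R[i]).
Context {Lam : set R} {c : R -> nat} {Gam : set R} {b : R -> C} {a : int -> R}.
Context {qc : quasicrystal Lam c Gam b a}.

Let tb := qc_tempered (quasicrystal := qc).

Local Notation wt := (wt Gam b).
Local Notation wB := (wB Gam b).
Local Notation Bsum := (Bsum Gam b).
Local Notation dominated := (dominated Gam b).
Local Notation beta0 := (@beta0 R Gam b).
Local Notation beta := (@beta R Gam b).

Local Notation cauchyL := (@cauchyL R Gam b).
Local Notation gfun := (@gfun R Gam b).
Local Notation hfun := (@hfun R Gam b).
Local Notation logf := (@logf R Gam b).
Local Notation gmult := (@gmult R).

Lemma abs_growth : exists2 k : R, 0 < k & forall n : int, k * (`|n|%N.+1)%:R <= `|a n|.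
Proof.
have [k0 [G [n1 [k00 G0 n10 hn1]]]] := @linear_growth R Lam c Gam b a qc.
have an0 n : 0 < `|a n| by rewrite normr_gt0; apply/eqP; exact: (qc_neq0 (quasicrystal := qc)).
(* Each 1 / |a n| in the range is at most [T], so 1 / T is a common lower bound for these finitely
   many nonzero points. *)
pose T := 1 + \sum_(n <- ints n1) `|a n|^-1.
have T0 : 0 < T by rewrite ltr_pwDl // sumr_ge0.
have hT n : n \in ints n1 -> T^-1 <= `|a n|.
  move=> hn; rewrite -[leRHS]invrK lef_pV2 ?posrE ?invr_gt0 //.
  by rewrite /T (big_rem n) //= addrCA lerDl addr_ge0 // sumr_ge0.
have n1R : 0 < n1.+1%:R :> R by rewrite ltr0n.
exists (Num.min (k0 / 2) (T^-1 / n1.+1%:R)) => [|n].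
  by rewrite lt_min !divr_gt0 // invr_gt0.
have [hn|hn] := leqP `|n| n1.
  apply: le_trans (hT n _); last by rewrite mem_ints.
  apply: le_trans (_ : T^-1 / n1.+1%:R * n1.+1%:R <= _); last by rewrite divfK // gt_eqF.
  apply: ler_pM => //; last by rewrite ler_nat ltnS.
    by rewrite le_min !divr_ge0 // ltW // invr_gt0.
  by rewrite ge_min lexx orbT.
have [h1 h2 _] := hn1 `|n|%N (ltnW hn).
have h3 : k0 * `|n|%N%:R <= `|a n|.
  case: (intP n) h1 h2 => [|m|m]; rewrite ?abszN /= => h1 h2.
  - exact: le_trans h1 (ler_norm _).
  - exact: le_trans h1 (ler_norm _).
  - by apply: le_trans h2 _; rewrite -normrN ler_norm.
apply: le_trans h3; apply: le_trans (_ : k0 / 2 * (`|n|%N.+1)%:R <= _).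
  by apply: ler_wpM2r => //; rewrite ge_min lexx.
rewrite -mulrA ler_pM2l // ler_pdivrMl // -natr1.
have : 1 <= `|n|%N%:R :> R by rewrite ler1n; apply: leq_trans hn.
lra.
Qed.

Lemma sigma_converges : exists s, ccvg (sigma a) s.
Proof.
have [k k0 ka] := abs_growth.
have i0 : 0 < complex.Im ('i%C : C) by [].
exact: (sigma_cvg k0 ka i0 (@cauchy_sum_cvg R Lam c Gam b a qc _ i0)).
Qed.

Lemma flim_entire : polylim (flim a).
Proof.
have [k k0 ka] := abs_growth; have [s hs] := sigma_converges.
exact (flim_polylim k0 ka hs).
Qed.

Lemma fpoly_flim z : ccvg (fun N => (fpoly a N).[z]) (flim a z).
Proof.
have [k k0 ka] := abs_growth; have [s hs] := sigma_converges.
exact (fpoly_cvg k0 ka z hs).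
Qed.

Lemma hfun_bound (s : R) : 0 < s -> exists2 K : R, 0 <= K & forall z, s <= complex.Im z -> cmod (hfun z) <= K.
Proof.
move=> s0; have [K K0 hK] := @hmult_bound R Gam b s s0.
exists (K * wB) => [|z sz]; first by rewrite mulr_ge0 ?(wB_ge0 tb) // ltW.
by apply: (Bsum_le tb) => g; exact: hK.
Qed.

Lemma gfun_bound (r : R) : 0 <= r -> exists2 K : R, 0 <= K & forall z, cmod z <= r -> cmod (gfun z) <= K.
Proof.
move=> r0; have [K K0 hK] := @gmult_bound R Gam b r r0.
exists (K * wB) => [|z sz]; first by rewrite mulr_ge0 ?(wB_ge0 tb).
by apply: (Bsum_le tb) => g; exact: hK.
Qed.

Lemma cauchyL_bound (s : R) : 0 < s -> exists2 K : R, 0 <= K & forall z, s <= complex.Im z -> cmod (cauchyL z) <= K.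
Proof.
move=> s0; have [K K0 hK] := @pmult_bound R Gam b s s0.
pose B := cmod ((gcdf 0)%:C%C * beta0 : C) + K * wB.
have B0 : 0 <= B by rewrite addr_ge0 ?cmod_ge0 // mulr_ge0 ?(wB_ge0 tb) // ltW.
exists (cmod (- (2 * pi)%:C%C * 'i%C : C) * B) => [|z sz]; first by rewrite mulr_ge0 ?cmod_ge0.
rewrite /cauchyL cmodM; apply: ler_wpM2l; first exact: cmod_ge0.
rewrite (@Bsum_hstep R Lam c Gam b a qc); last exact: lt_le_trans sz.
apply: le_trans (cmodD _ _) _; rewrite lerD2l.
by apply: (Bsum_le tb) => g; exact: hK.
Qed.

(* Both sides have logarithmic derivative [cauchyL], which integrates to [logf]. *)
Lemma flim_logf : exists A : C, forall z, 0 < complex.Im z -> flim a z = A * ce (logf z).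
Proof.
exists (flim a 'i%C * ce (- logf 'i%C)) => z z0.
pose Q w := flim a w * ce (- logf w).
suff h : Q z = Q 'i%C by rewrite -/(Q 'i%C) -h /Q -mulrA -ceD addNr ce0 mulr1.
(* [s] and [r] are such that the segment from i to [z] stays at height at least [s] and modulus at
   most [r]. *)
pose s := Num.min 1 (complex.Im z).
have s0 : 0 < s by rewrite lt_min ltr01.
have s1 : s <= 1 by rewrite ge_min lexx.
have sz : s <= complex.Im z by rewrite ge_min lexx orbT.
pose r := 1 + cmod (z - 'i%C); have r0 : 0 <= r by rewrite addr_ge0 ?cmod_ge0.
have [k k0 ka] := abs_growth; have [sg hs] := sigma_converges.
have [M1 M10 hM1] := flim_taylor k0 ka (s := sg) hs (fun z h => @cauchy_sum_cvg R Lam c Gam b a qc z h) r0.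
have [M2 M20 hM2] := @logf_taylor R Lam c Gam b a qc s s0.
have [B1 B10 hB1] := polylim_bounded r flim_entire.
have [B2 B20 hB2] := cauchyL_bound s0.
have [B3 B30 hB3] := hfun_bound s0.
have [B4 B40 hB4] := gfun_bound r0.
have B120 : 0 <= B1 + B2 by rewrite addr_ge0.
have [M M0 hM] := exp_correction B120 M10 M20.
set k1 : C := - (2 * pi)%:C%C * 'i%C * ((gcdf 0)%:C%C * beta0).
pose E := expR (cmod k1 * r + B4 + B3).
have d0 : 0 < Num.min (2^-1 : R) (s / 2) by rewrite lt_min invr_gt0 ltr0n divr_gt0.
apply: (@segment_const R Q 'i%C z (M * E) (Num.min 2^-1 (s / 2)) d0).
  by rewrite mulr_ge0 ?expR_ge0.
move=> t h /andP[t0 t1] hh; set w := 'i%C + _.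
have hh1 : cmod h <= 2^-1 by apply: le_trans hh _; rewrite ge_min lexx.
have hh2 : cmod h <= s / 2 by apply: le_trans hh _; rewrite ge_min lexx orbT.
have sw : s <= complex.Im w.
  rewrite /w !(ImD, ImM, ImB) /= mul0r addr0.
  have : t * s <= t * complex.Im z by apply: ler_wpM2l.
  have : (1 - t) * s <= (1 - t) * 1 by apply: ler_wpM2l => //; rewrite subr_ge0.
  lra.
have w0 : 0 < complex.Im w by apply: lt_le_trans sw.
have wr : cmod w <= r.
  apply: le_trans (cmodD _ _) _; rewrite cmodi /r lerD2l cmodM cmodR ger0_norm //.
  by rewrite ler_piMl ?cmod_ge0.
have -> : Q (w + h) - Q w = (flim a (w + h) * ce (- (logf (w + h) - logf w)) - flim a w) * ce (- logf w).
  rewrite mulrBl -mulrA -ceD; congr (_ * ce _ - _); ring.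
rewrite cmodM [leRHS]mulrAC; apply: ler_pM; rewrite ?cmod_ge0 //.
  apply: hM (hM1 _ _ w0 wr hh1) (hM2 _ _ sw hh2).
  - by apply: le_trans (hB1 w wr) _; rewrite lerDl.
  - by apply: le_trans (hB2 w sw) _; rewrite lerDr.
  - by apply: le_trans hh1 _; rewrite invf_le1 // ler1n.
apply: le_trans (cmod_ce_le _) _; rewrite ler_expR cmodN /logf -/k1.
apply: le_trans (cmodB _ _) _; apply: lerD (hB3 w sw).
apply: le_trans (cmodB _ _) _; apply: lerD (hB4 w wr).
by rewrite cmodM; apply: ler_wpM2l; rewrite ?cmod_ge0.
Qed.

Definition Ffun (z : C) : C := ce (gfun z) * flim a z.

(** The factor e^g removes the low frequencies from the exponent of f. What remains is one pure
    exponential and [hfun], whose series converges absolutely and uniformly on each half-plane Im z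
    >= s > 0. *)
Lemma Ffun_upper : exists A : C, forall z, 0 < complex.Im z ->
  Ffun z = A * (ce ('i%C * (2 * pi * (- (gcdf 0 * beta)))%:C%C * z) * ce (- hfun z)).
Proof.
have [A hA] := flim_logf; exists A => z z0; rewrite /Ffun hA // mulrCA -!ceD; congr (_ * ce _).
rewrite /logf (@beta0E R Lam c Gam b a qc) !(rmorphM, rmorphN) /=; ring.
Qed.

(** Finite partial sums are limits of polynomials, and one finite set from [summ_tail] makes the
    rest small for all [z] in the disc. *)
Lemma Bsum_polylim (m : C -> R -> C) : (forall g, polylim (m^~ g)) ->
  (forall r : R, 0 <= r -> exists2 K : R, 0 <= K & forall z g, cmod z <= r -> cmod (m z g) * wt g <= K) ->
  polylim (fun z => Bsum (m z)).
Proof.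
move=> hp hK; apply: polylim_lim => r e e0.
have [K K0 {}hK] := hK `|r| (normr_ge0 r).
have K1 : 0 < K + 1 by rewrite ltr_wpDl.
have wp g : 0 <= cmod (b g) / wt g by rewrite divr_ge0 ?cmod_ge0 ?wt0.
have [F0 [fF0 F0G hF0]] := summ_tail wp (summ_wt tb) (divr_gt0 e0 K1).
exists (fun z => \sum_(g \in F0) b g * m z g).
  apply: (polylim_ext (F := fun z => \sum_(g <- finmap.enum_fset (fset_set F0)) b g * m z g)).
    by move=> z; rewrite fsbig_finite.
  elim: (finmap.enum_fset (fset_set F0)) => [|g l IH].
    by apply: (polylim_ext (F := fun=> 0)) (polylim_cst _) => z; rewrite big_nil.
  apply: (polylim_ext (F := fun z => b g * m z g + \sum_(g <- l) b g * m z g)).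
    by move=> z; rewrite big_cons.
  by apply: polylimD => //; exact: polylimMl.
move=> z zr; have {}zr : cmod z <= `|r| by apply: le_trans zr (ler_norm _).
have dm : dominated (m z) by exists K => g; exact: hK.
rewrite cmod_dist; apply: (has_sum_approx fF0 F0G (Bsum_has_sum tb dm)) => F fF F0F FG.
rewrite (fsum_split F0 _ fF) (_ : F `&` F0 = F0); last by rewrite setIC; exact/setIidl.
rewrite addrAC subrr add0r.
have fD : finite_set (F `\` F0) by exact: finite_setD.
apply: le_trans (fsum_cmod _ fD) _.
apply: le_trans (fsum_le fD (g := fun g => K * (cmod (b g) / wt g)) _) _.
  by move=> g _; apply: dominated_le; exact: hK.
rewrite -mulr_fsumr; apply: le_trans (_ : K * (e / (K + 1)) <= _).
  apply: ler_wpM2l => //; apply: hF0 => //; first by move=> x [/FG].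
  by apply/seteqP; split=> x // [[]].
by rewrite mulrCA ler_piMr ?(ltW e0) // ler_pdivrMr // mul1r lerDl.
Qed.

Lemma gfun_polylim : polylim gfun.
Proof.
apply: Bsum_polylim => [g|r r0]; last exact: gmult_bound.
have [E|E] := boolP ((0 < g) && (g < 1)); last first.
  by apply: (polylim_ext (F := fun=> 0)) (polylim_cst _) => z; rewrite /gmult (negbTE E).
apply: (polylim_ext (F := fun z => (g%:C%C)^-1 * (ce ('i%C * (2 * pi * g)%:C%C * z) - 1))).
  by move=> z; rewrite /gmult E mulrC.
apply: polylimMl; apply: polylimB; last exact: polylim_cst.
by apply: polylim_ce; apply: polylimMl; exact: polylim_id.
Qed.

Lemma Ffun_polylim : polylim Ffun.
Proof. by apply: polylimM flim_entire; exact: polylim_ce gfun_polylim. Qed.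

Lemma gfun_has_sum z : has_sum (Gam `&` `]0, 1[)
  (fun g => b g * (ce ('i%C * (2 * pi * g)%:C%C * z) - 1) / g%:C%C) (gfun z).
Proof.
apply: (has_sum_ext (h := fun g => b g * gmult z g)) => [g [_]|].
  by rewrite /= in_itv /= /gmult => ->; rewrite mulrA.
apply: (has_sum_restrict (S := Gam)) (Bsum_has_sum tb (gmult_dom z)) => [g []//|g Gg hg].
rewrite /gmult; case: ifPn => [h|]; last by rewrite mulr0.
by exfalso; apply: hg; split=> //; rewrite /= in_itv.
Qed.

End QuasicrystalFunction.

(** * Almost periodicity *)

Section AlmostPeriodicity.
Context {R : realType}.
Local Notation C := (R[i]).
Context {Lam : set R} {c : R -> nat} {Gam : set R} {b : R -> C} {a : int -> R}.
Context {qc : quasicrystal Lam c Gam b a}.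

Let tb := qc_tempered (quasicrystal := qc).

Local Notation wt := (wt Gam b).
Local Notation wB := (wB Gam b).
Local Notation beta := (@beta R Gam b).

Local Notation gfun := (@gfun R Gam b).
Local Notation hfun := (@hfun R Gam b).
Local Notation gmult := (@gmult R).
Local Notation hmult := (@hmult R).
Local Notation Ffun := (@Ffun R Gam b a).

Lemma ccvg_cmod_le (u v : nat -> C) l m : ccvg u l -> ccvg v m ->
  (forall n, cmod (u n) <= cmod (v n)) -> cmod l <= cmod m.
Proof.
move=> hu hv uv; apply/ler_addgt0Pl => e e0.
have [N1 h1] := hu _ (divr_gt0 e0 (ltr0n _ 2)); have [N2 h2] := hv _ (divr_gt0 e0 (ltr0n _ 2)).
have k1 := h1 _ (leq_maxl N1 N2); have k2 := h2 _ (leq_maxr N1 N2).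
have := uv (maxn N1 N2); rewrite cmod_dist in k1.
have := cmod_rtri l (u (maxn N1 N2)); have := cmod_rtri (v (maxn N1 N2)) m; lra.
Qed.

(* The zeros are real, so the modulus increases away from the real axis. *)
Lemma flim_mono (x y T : R) : `|y| <= T -> cmod (flim a (x +i* y)%C) <= cmod (flim a (x +i* T)%C).
Proof.
move=> yT; apply: (ccvg_cmod_le (@fpoly_flim R Lam c Gam b a qc _) (@fpoly_flim R Lam c Gam b a qc _)) => N.
rewrite /fpoly; elim: (ints N) => [|n s IH]; first by rewrite !big_nil !hornerC.
rewrite !big_cons !hornerM !cmodM; apply: ler_pM; rewrite ?cmod_ge0 //.
rewrite !(hornerD, hornerN, hornerZ, hornerX, hornerC) -fmorphV.
rewrite !cmodE ler_wsqrtr // !(ReB, ImB, ReM, ImM) /=.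
set p := 1 - _ ; have -> : 1 - ((a n)^-1 * x - 0 * T) = p by rewrite /p; ring.
rewrite lerD2l !mul0r !addr0 !sub0r !sqrrN !exprMn; apply: ler_wpM2l; first exact: sqr_ge0.
by rewrite -[leLHS]real_normK ?num_real // lerXn2r // nnegrE // (le_trans _ yT).
Qed.

(** Only the vertical variation is bounded uniformly in [x]: once the exponential at height [T], of
    modulus at most 1, is factored out, the horizontal position has disappeared. *)
Lemma gfun_strip (T : R) : exists2 K : R, 0 <= K & forall x y : R, `|y| <= T ->
  cmod (gfun (x +i* y)%C - gfun (x +i* T)%C) <= K.
Proof.
pose A := 2 * pi * (2 * `|T|); have A0 : 0 <= A by rewrite !mulr_ge0 // pi_ge0.
pose K := 4 * A * expR A * 2 ^+ (wN Gam b).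
have K0 : 0 <= K by rewrite mulr_ge0 ?exprn_ge0 // mulr_ge0 ?expR_ge0 // mulr_ge0.
exists (K * wB) => [|x y yT]; first by rewrite mulr_ge0 // (wB_ge0 tb).
have T0 : 0 <= T by apply: le_trans yT.
rewrite /gfun -(BsumB tb); [|exact: gmult_dom|exact: gmult_dom].
apply: (Bsum_le tb) => g; rewrite /gmult; case: ifPn => [/andP[g0 g1]|_]; last by rewrite subrr cmod0 mul0r.
set z := (x +i* y)%C; set zT := (x +i* T)%C; set W := 'i%C * (2 * pi * g)%:C%C.
have -> : (ce (W * z) - 1) / g%:C%C - (ce (W * zT) - 1) / g%:C%C =
   ce (W * zT) * (ce (W * (z - zT)) - 1) / g%:C%C.
  have -> : ce (W * z) = ce (W * zT) * ce (W * (z - zT)) by rewrite -ceD; congr ce; ring.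
  ring.
apply: ler_pM; rewrite ?cmod_ge0 ?wt0 //; last first.
  by rewrite /wt lerXn2r // ?nnegrE ?addr_ge0 // gtr0_norm //; lra.
rewrite cmodM cmodM cmodV cmodR gtr0_norm // ler_pdivrMr //.
have e1 : cmod (ce (W * zT)) <= 1.
  by rewrite cmod_ce_re -[leRHS]expR0 ler_expR mulNr oppr_le0 !mulr_ge0 ?pi_ge0 // ltW.
have hz : cmod (W * (z - zT)) <= A * g.
  rewrite cmod_freq gtr0_norm // /A mulrAC; apply: ler_wpM2r; first exact: ltW.
  apply: ler_wpM2l; first by rewrite mulr_ge0 // pi_ge0.
  apply: le_trans (cmod_le _) _; rewrite ReB ImB /= subrr normr0 add0r.
  apply: le_trans (ler_normB _ _) _; rewrite (ger0_norm T0); lra.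
apply: le_trans (_ : 1 * (4 * (A * g) * expR A) <= _); last first.
  by rewrite mul1r le_eqVlt; apply/orP; left; apply/eqP; ring.
apply: (ler_pM (cmod_ge0 _) (cmod_ge0 _) e1); apply: le_trans (cexp_sub1 _) _.
have W0 : 0 <= 4 * cmod (W * (z - zT)) by rewrite mulr_ge0 // cmod_ge0.
apply: (ler_pM W0 (expR_ge0 _)); first by rewrite ler_pM2l.
by rewrite ler_expR (le_trans hz) // ler_piMr // ltW.
Qed.

(** Comparison with the line Im z = T, where [Ffun_upper] gives an explicit bound; [gfun_strip]
    handles the exponential factor and [flim_mono] the product. *)
Lemma Ffun_strip (T : R) : 0 < T -> exists2 B : R, 0 <= B & forall z,
  `|complex.Im z| <= T -> cmod (Ffun z) <= B.
Proof.
move=> T0; have [K K0 hK] := gfun_strip T.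
have [A hA] := @Ffun_upper R Lam c Gam b a qc.
have [H H0 hH] := @hfun_bound R Lam c Gam b a qc T T0.
pose k : R := - (gcdf 0 * beta).
exists (expR K * (cmod A * (expR (- (2 * pi * T) * k) * expR H))) => [|[x y] /= yT].
  by rewrite mulr_ge0 ?expR_ge0 // mulr_ge0 ?cmod_ge0 // mulr_ge0 ?expR_ge0.
have -> : Ffun (x +i* y)%C = ce (gfun (x +i* y)%C - gfun (x +i* T)%C) *
    (ce (gfun (x +i* T)%C) * flim a (x +i* y)%C).
  by rewrite /Ffun mulrA -ceD subrK.
rewrite [leLHS]cmodM; apply: ler_pM; rewrite ?cmod_ge0 //.
  by apply: le_trans (cmod_ce_le _) _; rewrite ler_expR hK.
apply: le_trans (_ : cmod (Ffun (x +i* T)%C) <= _).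
  by rewrite /Ffun [leLHS]cmodM [leRHS]cmodM; apply: ler_wpM2l; [exact: cmod_ge0 | exact: flim_mono].
rewrite hA //= [leLHS]cmodM; apply: ler_wpM2l; first exact: cmod_ge0.
rewrite [leLHS]cmodM cmod_ce_re /=; apply: ler_wpM2l; first exact: expR_ge0.
apply: le_trans (cmod_ce_le _) _; rewrite ler_expR cmodN; apply: hH => /=; exact: lexx.
Qed.

Lemma hfun_shift (e s : R) : 0 < s -> 0 < e -> exists (r : seq R) (d : R), 0 < d /\
  forall tau : R, (forall g, g \in r -> cmod (phase (g * tau) - 1) <= d) ->
  forall z, s <= complex.Im z -> cmod (hfun (z + tau%:C%C) - hfun z) <= e.
Proof.
move=> s0 e0; have [K0 K00 hK] := @hmult_bound R Gam b s s0.
have [r [d [d0 hr]]] := @Bsum_ap R Lam c Gam b a qc K0 e K00 e0.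
exists r, d; split=> // tau ht z sz.
have z0 : 0 < complex.Im z by exact: lt_le_trans sz.
have z1 : 0 < complex.Im (z + tau%:C%C) by rewrite ImD addr0.
rewrite /hfun -(BsumB tb); [|exact: hmult_dom z1|exact: hmult_dom z0].
have := hr tau (hmult z) (fun g => hK z g sz) ht.
congr (cmod _ <= _); apply: eq_Bsum => g; rewrite mulrBr mulr1; congr (_ - _).
rewrite /hmult; case: ifP => _; last by rewrite mul0r.
rewrite mulrAC /phase -ceD; congr (ce _ / _); rewrite !rmorphM; ring.
Qed.

Lemma Ffun_shift (s S e : R) : 0 < s -> s <= S -> 0 < e -> exists (r : seq R) (d : R), 0 < d /\
  forall tau : R, (forall g, g \in r -> cmod (phase (g * tau) - 1) <= d) ->
  forall z, s <= complex.Im z -> complex.Im z <= S -> cmod (Ffun (z + tau%:C%C) - Ffun z) <= e.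
Proof.
move=> s0 sS e0; have S0 : 0 < S by exact: lt_le_trans sS.
have [B B0 hB] := Ffun_strip S0.
have [A hA] := @Ffun_upper R Lam c Gam b a qc.
pose k : R := - (gcdf 0 * beta).
have E0 : 0 < expR 1 :> R := expR_gt0 1.
pose D := 5 * expR 1 * (B + 1); have D0 : 0 < D by rewrite !mulr_gt0 // ltr_wpDl.
pose eta := Num.min 1 (e / D); have eta0 : 0 < eta by rewrite lt_min ltr01 divr_gt0.
have eta1 : eta <= 1 by rewrite ge_min lexx.
have eta2 : eta * D <= e by rewrite -ler_pdivlMr // ge_min lexx orbT.
have [r [d [d0 hr]]] := hfun_shift s0 eta0.
(* [k] is the frequency of the pure exponential in [Ffun_upper], which [tau] must nearly preserve as
   well. *)
exists (k :: r), (Num.min d eta); split; first by rewrite lt_min d0.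
move=> tau ht z sz zS.
have hk : cmod (phase (k * tau) - 1) <= eta.
  by apply: le_trans (ht k _) _; [rewrite inE eqxx | rewrite ge_min lexx orbT].
have hh : cmod (hfun (z + tau%:C%C) - hfun z) <= eta.
  apply: hr => // g gr; apply: le_trans (ht g _) _; first by rewrite inE gr orbT.
  by rewrite ge_min lexx.
have z0 : 0 < complex.Im z by exact: lt_le_trans sz.
have z1 : 0 < complex.Im (z + tau%:C%C) by rewrite ImD addr0.
set E := ce (- (hfun (z + tau%:C%C) - hfun z)).
have FE : Ffun (z + tau%:C%C) = Ffun z * (phase (k * tau) * E).
  rewrite !hA // -/k /E /phase -!ceD -[RHS]mulrA; congr (_ * _); rewrite -ceD; congr ce.
  rewrite !rmorphM; ring.
have hE1 : cmod E <= expR 1.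
  by apply: le_trans (cmod_ce_le _) _; rewrite ler_expR cmodN (le_trans hh).
have hE2 : cmod (E - 1) <= 4 * eta * expR 1.
  apply: le_trans (cexp_sub1 _) _; rewrite cmodN; apply: ler_pM; rewrite ?expR_ge0 ?mulr_ge0 ?cmod_ge0 //.
    by rewrite ler_pM2l.
  by rewrite ler_expR (le_trans hh).
have -> : Ffun (z + tau%:C%C) - Ffun z = Ffun z * ((phase (k * tau) - 1) * E + (E - 1)).
  by rewrite FE; ring.
rewrite [leLHS]cmodM; apply: le_trans eta2.
have -> : eta * D = (B + 1) * (eta * expR 1 + 4 * eta * expR 1) by rewrite /D; ring.
apply: ler_pM; rewrite ?cmod_ge0 //.
  apply: le_trans (hB z _) _; last by rewrite lerDl.
  by rewrite ger0_norm // ltW.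
apply: le_trans (cmodD _ _) _; apply: lerD => //.
by rewrite [leLHS]cmodM; apply: ler_pM; rewrite ?cmod_ge0.
Qed.

(* The difference [F (z + tau) - F z] is small on a disc in the upper half-plane and
   bounded on a large one, hence small on the strip by the three circles theorem. *)
Lemma Ffun_ap : @almost_periodic R Ffun.
Proof.
move=> al be _ eps eps0.
pose Y := `|al| + `|be|; have Y0 : 0 <= Y by rewrite addr_ge0.
(* The discs are centred at height Y + 2. The unit disc stays between heights 1 and Y + 3, radius
   [rho] reaches the points below the centre down to height -Y, and [T] bounds the heights in the
   disc of radius 2 rho. *)
pose rho := 2 * Y + 3; have rho1 : 1 <= rho by rewrite /rho; lra.
pose T := Y + 2 + 2 * rho; have T0 : 0 < T by rewrite /T /rho; lra.
have [B B0 hB] := Ffun_strip T0.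
have eta0 : 0 < eps / 2 by rewrite divr_gt0.
have B20 : 0 <= B + B by rewrite addr_ge0.
have [e e0 he] := @polylim_three_circles R rho (B + B) (eps / 2) rho1 B20 eta0.
have Y3 : 1 <= Y + 3 by lra.
have [r [d [d0 hr]]] := Ffun_shift ltr01 Y3 e0.
have [L hL] := almost_periods r d0.
exists L => x0; have [tau [htau ht]] := hL x0; exists tau; split=> //.
exists (eps / 2); split; first by rewrite ltr_pdivrMr //; lra.
move=> x y /andP[y1 y2].
pose G z := Ffun (z + tau%:C%C) - Ffun z.
pose w : C := (x +i* (Y + 2))%C.
have -> : Ffun ((x + tau) +i* y)%C - Ffun (x +i* y)%C = G (x +i* y)%C.
  rewrite /G; congr (Ffun _ - _); apply/eqP; rewrite eq_complex ReD ImD /= addr0 !eqxx //.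
have hy : `|y| <= Y.
  rewrite ler_norml /Y; have := ler_norm (- al); have := ler_norm be; rewrite normrN => h1 h2.
  by have n1 := normr_ge0 al; have n2 := normr_ge0 be; apply/andP; split; lra.
have hy2 := hy; rewrite ler_norml in hy2; case/andP: hy2 => hy2 hy3.
change (cmod (G (x +i* y)%C) <= eps / 2).
have imw z rr : cmod (z - w) <= rr -> Y + 2 - rr <= complex.Im z <= Y + 2 + rr.
  move=> hz; have := le_trans (cmod_Im _) hz; rewrite ImB /= ler_norml => /andP[h1 h2].
  by apply/andP; split; lra.
apply: (he G w).
- apply: polylimB; last exact: (@Ffun_polylim R Lam c Gam b a qc).
  exact: polylim_shift (@Ffun_polylim R Lam c Gam b a qc).
- by move=> z /imw /andP[h1 h2]; apply: hr => //; lra.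
- move=> z /imw /andP[h1 h2]; rewrite /T /rho in hB h1 h2.
  apply: le_trans (cmodB _ _) _; apply: lerD; apply: hB; rewrite ?ImD ?addr0 ler_norml;
    by apply/andP; split=> /=; rewrite ?addr0; lra.
- apply: le_trans (cmod_le _) _; rewrite ReB ImB /= subrr normr0 add0r ler_norml /rho.
  by apply/andP; split; lra.
Qed.

Lemma partial_prodE z N : partial_prod a z N = (fpoly a N).[z].
Proof.
rewrite /partial_prod /fpoly; elim: N => [|N IH].
  by rewrite big_geq // mulr1 big_seq1 hornerD hornerN hornerZ hornerX hornerC mulrC.
rewrite big_nat_recr //= mulrA IH !big_cons !hornerM.
rewrite !(hornerD, hornerN, hornerZ, hornerX, hornerC) [z / _]mulrC [z / (a (- _))%:C%C]mulrC.
ring.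
Qed.

Lemma partial_prod_cvg (z : CC R) : partial_prod a z n @[n --> \oo] --> (flim a z : CC R).
Proof.
apply/cvgrPdist_le => /= e e0.
(* The norm of [R[i]] is complex valued, so the positive [e] of the filter is a real number in
   disguise. *)
have eE : e = (complex.Re e)%:C%C.
  by move: e0; rewrite ltcE /= => /andP[/eqP h _]; case: e h => er ei /= ->.
rewrite eE; rewrite eE ltcR in e0.
have [N hN] := @fpoly_flim R Lam c Gam b a qc z _ e0.
exists N => // n /= Nn.
rewrite -[Num.norm _]/((cmod _)%:C%C) lecR cmod_dist partial_prodE; exact: hN.
Qed.

End AlmostPeriodicity.

Theorem theorem2 (R : realType) (Lam : set R) (c : R -> nat)
    (Gam : set R) (b : R -> CC R) (a : int -> R) :
  (* Lam locally finite, c_l positive integers *)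
  (forall r : R, finite_set (Lam `&` `[- r, r])) ->
  (forall l : R, Lam l -> (0 < c l)%N) ->
  (* mu = sum c_l delta_l is temperate *)
  tempered_discrete Lam (fun l => (c l)%:R) ->
  (* Gam countable, mu^ = sum b_g delta_g, |mu^| temperate *)
  countable Gam ->
  fourier_transform_is Lam c Gam b ->
  tempered_discrete Gam (fun g => cabs (b g)) ->
  (* (a_n)_{n in Z} is a nondecreasing enumeration of the multiset A *)
  (forall n : int, a n <= a (n + 1)) ->
  (forall x : R, Lam x -> ([set n : int | a n = x] #= `I_(c x))%card) ->
  (forall x : R, ~ Lam x -> forall n : int, a n <> x) ->
  (* 0 is not in A *)
  (forall n : int, a n <> 0) ->
  exists f g F : CC R -> CC R,
    (forall z : CC R, partial_prod a z n @[n --> \oo] --> f z) /\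
    (forall z : CC R,
       has_sum (Gam `&` `]0, 1[)
         (fun gam => b gam * (cexp ('i%C * (2 * pi * gam)%:C%C * z) - 1) / gam%:C%C)
         (g z)) /\
    (forall z : CC R, F z = cexp (g z) * f z) /\
    entire F /\ almost_periodic F.
Proof.
move=> locfin cpos _ _ ft tb a_nd a_card a_Lam a_neq0.
have qc := Quasicrystal locfin cpos ft tb a_nd a_card a_Lam a_neq0.
exists (flim a), (@gfun R Gam b), (@Ffun R Gam b a); split; first exact: (@partial_prod_cvg R Lam c Gam b a qc).
split; first exact: (@gfun_has_sum R Lam c Gam b a qc).
split=> //; split; last exact: (@Ffun_ap R Lam c Gam b a qc).
exact: polylim_entire (@Ffun_polylim R Lam c Gam b a qc).
Qed.
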